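(* Let $w\in S_\infty^{(n)}$. The unique surjective morphism of $\mathcal U(\mathfrak b)$-modules $\mathcal U(\mathfrak b)/I_w\to\mathcal S_w$ sending $1 \bmod I_w$ to $u_w$ is an isomorphism. Here $I_w$ is the left ideal of $\mathcal U(\mathfrak b)$ generated by the elements $h-\langle \mathrm{code}(w),h\rangle$ $(h\in\mathfrak h)$ and $e_{ij}^{m_{ij}(w)+1}$ $(1\le i<j\le n)$, where $m_{ij}(w)=\#\{k>j : w(i)<w(k)<w(j)\}$.
   Context: Fix a positive integer $n$ and a field $K$ of characteristic zero. $\mathfrak b$ is the Lie algebra of all upper triangular $n\times n$ matrices over $K$, $\mathfrak h\subset\mathfrak b$ the subalgebra of diagonal matrices, $\mathcal U(\mathfrak b)$ the universal enveloping algebra, and $e_{ij}$ ($i<j$) the matrix with $1$ in position $(i,j)$ and $0$ elsewhere. For $\lambda\in\mathbb Z^n$ and $h=\mathrm{diag}(h_1,\dots,h_n)\in\mathfrak h$ put $\langle\lambda,h\rangle=\sum_i\lambda_ih_i$. A permutation is a bijection $w$ of $\mathbb Z_{>0}$ fixing all but finitely many points; $S_\infty$ is the group of permutations and $S_\infty^{(n)}=\{w\in S_\infty: w(n+1)<w(n+2)<\cdots\}$. Put $I(w)=\{(i,j): i<j,\ w(i)>w(j)\}$. For $w\in S_\infty^{(n)}$, $\mathrm{code}(w)\in\mathbb Z_{\ge0}^n$ is given by $\mathrm{code}(w)_i=\#\{j: i<j,\ w(i)>w(j)\}$. Kraśkiewicz–Pragacz (KP) module: let $K^n=\bigoplus_{i=1}^nKu_i$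 be the vector representation of $\mathfrak b$ ($e_{pq}u_q=u_p$, $e_{pq}u_r=0$ for $r\ne q$). For $w\in S_\infty^{(n)}$ and $j\ge1$ write $\{i:(i,j)\in I(w)\}=\{i_1<\cdots<i_{l_j}\}\subset\{1,\dots,n\}$ and $u_w^{(j)}=u_{i_1}\wedge\cdots\wedge u_{i_{l_j}}\in\bigwedge^{l_j}K^n$ (equal to $1\in K$ if $l_j=0$, which holds for all but finitely many $j$). Put $u_w=u_w^{(1)}\otimes u_w^{(2)}\otimes\cdots\in\bigwedge^{l_1}K^n\otimes\bigwedge^{l_2}K^n\otimes\cdots$ and $\mathcal S_w=\mathcal U(\mathfrak b)u_w$. The generators of $I_w$ annihilate $u_w$, so the surjection in the claim exists and is unique. *)

(* Defs.v *)
From HB Require Import structures.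
From mathcomp Require Import all_boot all_order all_algebra.
From mathcomp Require Import perm generic_quotient ring_quotient finmap.
From mathcomp Require Import boolp classical_sets cardinality.
From mathcomp Require Import ring.

Set Implicit Arguments.
Unset Strict Implicit.
Unset Printing Implicit Defensive.

Import GRing.Theory.
Local Open Scope ring_scope.
Local Open Scope quotient_scope.

HB.mixin Record Lmodule_isLieAlgebra (K : fieldType) L of GRing.Lmodule K L := {
  lie : L -> L -> L;
  lie_linl : forall y, linear (lie^~ y);
  lie_linr : forall x, linear (lie x);
  liexx : forall x, lie x x = 0;
  lie_jacobi : forall x y z,
    lie x (lie y z) + lie y (lie z x) + lie z (lie x y) = 0
}.

#[short(type="lieAlgType")]
HB.structure Definition LieAlgebra (K : fieldType) :=
  {L of GRing.Lmodule K L & Lmodule_isLieAlgebra K L}.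

Record lie_rep (K : fieldType) (L : lieAlgType K) (V : lmodType K) := LieRep {
  rep_act :> L -> V -> V;
  rep_linl : forall v, linear (rep_act^~ v);
  rep_linr : forall x, linear (rep_act x);
  rep_lie : forall x y v,
    rep_act (lie x y) v = rep_act x (rep_act y v) - rep_act y (rep_act x v)
}.

(** [Uenv L] is the unital associative [K]-algebra presented by the generators
    [x : L] and the relations making [x |-> Uin x] linear, together with
    [Uin [x, y] = Uin x * Uin y - Uin y * Uin x].  It is built as the type of
    algebra expressions in [L] modulo the least congruence containing the
    algebra axioms and these relations. *)

Inductive uterm (K L : Type) :=
| UGen of L
| UZero
| UOne
| UAdd of uterm K L & uterm K L
| UOpp of uterm K L
| UMul of uterm K L & uterm K L
| UScale of K & uterm K L.

Arguments UGen {K L}.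
Arguments UZero {K L}.
Arguments UOne {K L}.

HB.instance Definition _ (K L : Type) := gen_eqMixin (uterm K L).
HB.instance Definition _ (K L : Type) := gen_choiceMixin (uterm K L).

Inductive ueq (K : fieldType) (L : lieAlgType K) :
    uterm K L -> uterm K L -> Prop :=
| ueq_refl a : ueq a a
| ueq_sym a b : ueq a b -> ueq b a
| ueq_trans a b c : ueq a b -> ueq b c -> ueq a c
| ueq_add a a' b b' : ueq a a' -> ueq b b' -> ueq (UAdd a b) (UAdd a' b')
| ueq_opp a a' : ueq a a' -> ueq (UOpp a) (UOpp a')
| ueq_mul a a' b b' : ueq a a' -> ueq b b' -> ueq (UMul a b) (UMul a' b')
| ueq_scale k a a' : ueq a a' -> ueq (UScale k a) (UScale k a')
| ueq_addA a b c : ueq (UAdd a (UAdd b c)) (UAdd (UAdd a b) c)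
| ueq_addC a b : ueq (UAdd a b) (UAdd b a)
| ueq_add0 a : ueq (UAdd UZero a) a
| ueq_addN a : ueq (UAdd (UOpp a) a) UZero
| ueq_mulA a b c : ueq (UMul a (UMul b c)) (UMul (UMul a b) c)
| ueq_mul1l a : ueq (UMul UOne a) a
| ueq_mul1r a : ueq (UMul a UOne) a
| ueq_mulDl a b c : ueq (UMul (UAdd a b) c) (UAdd (UMul a c) (UMul b c))
| ueq_mulDr a b c : ueq (UMul a (UAdd b c)) (UAdd (UMul a b) (UMul a c))
| ueq_scaleA k l a : ueq (UScale k (UScale l a)) (UScale (k * l) a)
| ueq_scale1 a : ueq (UScale 1 a) a
| ueq_scaleDr k a b : ueq (UScale k (UAdd a b)) (UAdd (UScale k a) (UScale k b))
| ueq_scaleDl k l a : ueq (UScale (k + l) a) (UAdd (UScale k a) (UScale l a))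
| ueq_scaleAl k a b : ueq (UScale k (UMul a b)) (UMul (UScale k a) b)
| ueq_scaleAr k a b : ueq (UScale k (UMul a b)) (UMul a (UScale k b))
| ueq_lin k x y : ueq (UGen (k *: x + y)) (UAdd (UScale k (UGen x)) (UGen y))
| ueq_lie x y : ueq (UGen (lie x y))
    (UAdd (UMul (UGen x) (UGen y)) (UOpp (UMul (UGen y) (UGen x)))).

Section Uenv.
Variables (K : fieldType) (L : lieAlgType K).
Local Notation T := (uterm K L).

Definition ueqb (a b : T) : bool := `[< ueq a b >].

Lemma ueqb_equiv : equiv_class_of ueqb.
Proof.
split=> [a|a b|b a c]; first exact/asboolP/ueq_refl.
- by apply/asboolP/asboolP => ?; apply: ueq_sym.
- by move=> /asboolP ab /asboolP bc; apply/asboolP; apply: ueq_trans bc.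
Qed.

Canonical ueqb_equiv_rel := EquivRelPack ueqb_equiv.
Canonical ueqb_encModRel := defaultEncModRel ueqb.

Definition Uenv := {eq_quot ueqb}.
HB.instance Definition _ := Choice.on Uenv.
HB.instance Definition _ := EqQuotient.on Uenv.

Definition Upi (a : T) : Uenv := \pi_Uenv a.

Lemma UreprK (a : Uenv) : Upi (repr a) = a.
Proof. exact: reprK. Qed.

Lemma UenvP (a b : T) : Upi a = Upi b <-> ueq a b.
Proof. by split=> [/eqmodP/asboolP //|?]; apply/eqmodP/asboolP. Qed.

Lemma repr_pi (a : T) : ueq (repr (Upi a)) a.
Proof. by apply/UenvP; rewrite UreprK. Qed.

Definition Uzero : Uenv := Upi UZero.
Definition Uone : Uenv := Upi UOne.
Definition Uadd (a b : Uenv) : Uenv := Upi (UAdd (repr a) (repr b)).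
Definition Uopp (a : Uenv) : Uenv := Upi (UOpp (repr a)).
Definition Umul (a b : Uenv) : Uenv := Upi (UMul (repr a) (repr b)).
Definition Uscale k (a : Uenv) : Uenv := Upi (UScale k (repr a)).

Lemma UaddE a b : Uadd (Upi a) (Upi b) = Upi (UAdd a b).
Proof. by apply/UenvP; apply: ueq_add; apply: repr_pi. Qed.
Lemma UoppE a : Uopp (Upi a) = Upi (UOpp a).
Proof. by apply/UenvP; apply: ueq_opp; apply: repr_pi. Qed.
Lemma UmulE a b : Umul (Upi a) (Upi b) = Upi (UMul a b).
Proof. by apply/UenvP; apply: ueq_mul; apply: repr_pi. Qed.
Lemma UscaleE k a : Uscale k (Upi a) = Upi (UScale k a).
Proof. by apply/UenvP; apply: ueq_scale; apply: repr_pi. Qed.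

Let UE := (UaddE, UoppE, UmulE, UscaleE).

Fact UaddA : associative Uadd.
Proof.
by move=> a b c; rewrite -[a]UreprK -[b]UreprK -[c]UreprK !UE; apply/UenvP; constructor.
Qed.
Fact UaddC : commutative Uadd.
Proof. by move=> a b; rewrite -[a]UreprK -[b]UreprK !UE; apply/UenvP; constructor. Qed.
Fact Uadd0 : left_id Uzero Uadd.
Proof. by move=> a; rewrite -[a]UreprK !UE; apply/UenvP; constructor. Qed.
Fact UaddN : left_inverse Uzero Uopp Uadd.
Proof. by move=> a; rewrite -[a]UreprK !UE; apply/UenvP; constructor. Qed.
Fact UmulA : associative Umul.
Proof.
by move=> a b c; rewrite -[a]UreprK -[b]UreprK -[c]UreprK !UE; apply/UenvP; constructor.
Qed.
Fact Umul1l : left_id Uone Umul.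
Proof. by move=> a; rewrite -[a]UreprK !UE; apply/UenvP; constructor. Qed.
Fact Umul1r : right_id Uone Umul.
Proof. by move=> a; rewrite -[a]UreprK !UE; apply/UenvP; constructor. Qed.
Fact UmulDl : left_distributive Umul Uadd.
Proof.
by move=> a b c; rewrite -[a]UreprK -[b]UreprK -[c]UreprK !UE; apply/UenvP; constructor.
Qed.
Fact UmulDr : right_distributive Umul Uadd.
Proof.
by move=> a b c; rewrite -[a]UreprK -[b]UreprK -[c]UreprK !UE; apply/UenvP; constructor.
Qed.

Fixpoint uaug (a : T) : K :=
  match a with
  | UGen _ => 0
  | UZero => 0
  | UOne => 1
  | UAdd a b => uaug a + uaug b
  | UOpp a => - uaug a
  | UMul a b => uaug a * uaug b
  | UScale k a => k * uaug a
  end.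

Lemma uaug_eq a b : ueq a b -> uaug a = uaug b.
Proof.
elim=> //=; intros;
  rewrite ?(addrA, add0r, addNr, mulrA, mul1r, mulr1, mulrDl, mulrDr,
            mulr0, oppr0) //; try congruence.
- exact: addrC.
- by rewrite (mulrC k).
Qed.

Fact Uone_neq0 : Uone != Uzero.
Proof.
by apply/eqP => /UenvP /uaug_eq /= /eqP; rewrite oner_eq0.
Qed.

HB.instance Definition _ := GRing.isZmodule.Build Uenv UaddA UaddC Uadd0 UaddN.
HB.instance Definition _ := GRing.Zmodule_isNzRing.Build Uenv
  UmulA Umul1l Umul1r UmulDl UmulDr Uone_neq0.

Fact UscaleA k l a : Uscale k (Uscale l a) = Uscale (k * l) a.
Proof. by rewrite -[a]UreprK !UE; apply/UenvP; constructor. Qed.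
Fact Uscale1 : left_id 1 Uscale.
Proof. by move=> a; rewrite -[a]UreprK !UE; apply/UenvP; constructor. Qed.
Fact UscaleDr : right_distributive Uscale +%R.
Proof.
by move=> k a b; rewrite -[a]UreprK -[b]UreprK /= /GRing.add/= !UE; apply/UenvP; constructor.
Qed.
Fact UscaleDl a : {morph Uscale^~ a : k l / k + l}.
Proof. by move=> k l; rewrite -[a]UreprK /GRing.add/= !UE; apply/UenvP; constructor. Qed.

HB.instance Definition _ := GRing.Zmodule_isLmodule.Build K Uenv
  UscaleA Uscale1 UscaleDr UscaleDl.

Fact UscaleAl k (a b : Uenv) : k *: (a * b) = (k *: a) * b.
Proof.
rewrite -[a]UreprK -[b]UreprK /GRing.mul /GRing.scale /= !UE.
by apply/UenvP; constructor.
Qed.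
HB.instance Definition _ := GRing.Lmodule_isLalgebra.Build K Uenv UscaleAl.

Fact UscaleAr k (a b : Uenv) : k *: (a * b) = a * (k *: b).
Proof.
rewrite -[a]UreprK -[b]UreprK /GRing.mul /GRing.scale /= !UE.
by apply/UenvP; constructor.
Qed.
HB.instance Definition _ := GRing.Lalgebra_isAlgebra.Build K Uenv UscaleAr.

Definition Uin (x : L) : Uenv := Upi (UGen x).

Lemma Uin_linear : linear Uin.
Proof.
move=> k x y; rewrite /GRing.scale /GRing.add /= /Uin !UE.
by apply/UenvP; constructor.
Qed.

Lemma Uin_lie x y : Uin (lie x y) = Uin x * Uin y - Uin y * Uin x.
Proof.
by rewrite /GRing.opp /GRing.mul /GRing.add /= /Uin !UE; apply/UenvP; constructor.
Qed.

End Uenv.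

(** A representation [rho] of [L] on [V] makes [V] a left [Uenv L]-module;
    [rep_mod rho] is [V] with that structure. *)

Section RepMod.
Variables (K : fieldType) (L : lieAlgType K) (V : lmodType K).
Variable rho : lie_rep L V.

Fixpoint ueval (a : uterm K L) (v : V) : V :=
  match a with
  | UGen x => rho x v
  | UZero => 0
  | UOne => v
  | UAdd a b => ueval a v + ueval b v
  | UOpp a => - ueval a v
  | UMul a b => ueval a (ueval b v)
  | UScale k a => k *: ueval a v
  end.

Lemma ueval_linear a : linear (ueval a).
Proof.
elim: a => //=.
- exact: rep_linr.
- by move=> k u v; rewrite scaler0 addr0.
- by move=> a IHa b IHb k u v; rewrite IHa IHb scalerDr addrACA.
- by move=> a IHa k u v; rewrite IHa opprD scalerN.
- by move=> a IHa b IHb k u v; rewrite IHb IHa.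
- by move=> l a IHa k u v; rewrite IHa scalerDr !scalerA mulrC.
Qed.

Lemma uevalD a u v : ueval a (u + v) = ueval a u + ueval a v.
Proof. by have := ueval_linear a 1 u v; rewrite !scale1r. Qed.

Lemma uevalZ a k v : ueval a (k *: v) = k *: ueval a v.
Proof.
have u0 : ueval a 0 = 0.
  by apply: (addIr (ueval a 0)); rewrite -uevalD !add0r.
by have := ueval_linear a k v 0; rewrite u0 !addr0.
Qed.

Lemma ueval_eq a b : ueq a b -> ueval a =1 ueval b.
Proof.
elim; intros; move=> v /=;
  try match goal with
    Hab : ueval ?a =1 ueval ?b, Hbc : ueval ?b =1 ueval ?c
      |- ueval ?a _ = ueval ?c _ => exact: etrans (Hab v) (Hbc v) end;
  repeat match goal with H : ueval _ =1 ueval _ |- _ => rewrite ?H; clear H end;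
  rewrite ?(addrA, add0r, addNr, uevalD, uevalZ, scalerA, scale1r,
            scalerDr, scalerDl, rep_lie) //.
- exact: addrC.
- exact: rep_linl.
Qed.

Definition rep_mod of lie_rep L V : Type := V.
Local Notation W := (rep_mod rho).
HB.instance Definition _ := GRing.Zmodule.copy W V.

Definition rep_scale (a : Uenv L) (v : W) : W := ueval (repr a) v.

Lemma rep_scaleE a v : rep_scale (Upi a) v = ueval a v.
Proof. by apply: ueval_eq; apply: repr_pi. Qed.

Fact rep_scaleA a b v : rep_scale a (rep_scale b v) = rep_scale (a * b) v.
Proof.
by rewrite -[a]UreprK -[b]UreprK /GRing.mul /= UmulE !rep_scaleE.
Qed.
Fact rep_scale1 : left_id 1 rep_scale.
Proof. by move=> v; rewrite /GRing.one /= rep_scaleE. Qed.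
Fact rep_scaleDr : right_distributive rep_scale +%R.
Proof. by move=> a u v; apply: uevalD. Qed.
Fact rep_scaleDl v : {morph rep_scale^~ v : a b / a + b}.
Proof.
by move=> a b; rewrite -[a]UreprK -[b]UreprK {1}/GRing.add /= UaddE !rep_scaleE.
Qed.

HB.instance Definition _ := GRing.Zmodule_isLmodule.Build (Uenv L) W
  rep_scaleA rep_scale1 rep_scaleDr rep_scaleDl.

Lemma Uin_scale x (v : W) : Uin x *: v = rho x v.
Proof. exact: rep_scaleE. Qed.

End RepMod.

Section CyclicSubmodule.
Variables (R : nzRingType) (M : lmodType R) (m : M).

Definition cyc_pred : {pred M} := fun v => `[< exists a : R, v = a *: m >].

Fact cyc_pred_closed : subsemimod_closed cyc_pred.
Proof.
split; first split.
- by apply/asboolP; exists 0; rewrite scale0r.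
- move=> u v /asboolP[a ->] /asboolP[b ->]; apply/asboolP.
  by exists (a + b); rewrite scalerDl.
- move=> a v /asboolP[b ->]; apply/asboolP.
  by exists (a * b); rewrite scalerA.
Qed.
HB.instance Definition _ := GRing.isSubmodClosed.Build R M cyc_pred cyc_pred_closed.

Record cyclic := Cyclic { cyc_val : M; cyc_valP : cyc_val \in cyc_pred }.
HB.instance Definition _ := [isSub for cyc_val].
HB.instance Definition _ := [Choice of cyclic by <:].
HB.instance Definition _ := [SubChoice_isSubLmodule of cyclic by <:].

Fact cyc_gen_subproof : m \in cyc_pred.
Proof. by apply/asboolP; exists 1; rewrite scale1r. Qed.

Definition cyc_gen : cyclic := Cyclic cyc_gen_subproof.

End CyclicSubmodule.

Section LeftIdeal.
Variables (R : nzRingType) (G : R -> Prop).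

Inductive in_lideal : R -> Prop :=
| lideal0 : in_lideal 0
| lideal_step a g x : G g -> in_lideal x -> in_lideal (a * g + x).

Definition lideal : {pred R^o} := fun x => `[< in_lideal x >].

Fact lideal_closed : subsemimod_closed lideal.
Proof.
split; first split.
- exact/asboolP/lideal0.
- move=> x y /asboolP + /asboolP Hy; elim=> [|a g z Gg _ /asboolP Hz].
    by rewrite add0r; apply/asboolP.
  by rewrite -addrA; apply/asboolP/lideal_step.
- move=> a x /asboolP; elim=> [|b g z Gg _ /asboolP Hz].
    by rewrite scaler0; apply/asboolP/lideal0.
  rewrite scalerDr; apply/asboolP.
  have -> : a *: (b * g : R^o) = (a * b) * g by rewrite -mulrA.
  exact: lideal_step.
Qed.
HB.instance Definition _ := GRing.isSubmodClosed.Build R R^o lideal lideal_closed.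

End LeftIdeal.

Section ModQuotient.
Variables (R : nzRingType) (M : lmodType R) (N : submodClosed M).

Definition sub_pred : {pred M} := fun v => v \in N.

Fact sub_pred_zmod : zmod_closed sub_pred.
Proof.
split=> [|u v]; first exact: (rpred0 N).
by rewrite -!topredE /= /sub_pred => Nu Nv; rewrite -scaleN1r rpredD ?rpredZ.
Qed.
HB.instance Definition _ := GRing.isZmodClosed.Build M sub_pred sub_pred_zmod.

Definition mod_quot : Type := Quotient.quot sub_pred.
HB.instance Definition _ := GRing.Zmodule.copy mod_quot (Quotient.quot sub_pred).

Definition mod_pi (v : M) : mod_quot := \pi_(Quotient.quot sub_pred) v.

Definition mod_quot_scale (a : R) (v : mod_quot) : mod_quot :=
  mod_pi (a *: repr (v : Quotient.quot sub_pred)).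

Lemma mod_piP u v : mod_pi u = mod_pi v <-> u - v \in N.
Proof.
rewrite -[u - v \in N]/(u - v \in sub_pred) Quotient.idealrBE.
by split=> [/eqP|/eqP].
Qed.

Lemma mod_piD : {morph mod_pi : u v / u + v}.
Proof. by move=> u v; rewrite /mod_pi /= (Quotient.pi_add sub_pred). Qed.

Lemma mod_quot_scaleE a v : mod_quot_scale a (mod_pi v) = mod_pi (a *: v).
Proof.
apply/mod_piP; rewrite -scalerBr; apply: rpredZ.
by apply/mod_piP; rewrite /mod_pi reprK.
Qed.

Lemma mod_pi_surj v : exists u, v = mod_pi u.
Proof. by exists (repr (v : Quotient.quot sub_pred)); rewrite /mod_pi reprK. Qed.

Fact mod_quot_scaleA a b v :
  mod_quot_scale a (mod_quot_scale b v) = mod_quot_scale (a * b) v.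
Proof. by have [u ->] := mod_pi_surj v; rewrite !mod_quot_scaleE scalerA. Qed.
Fact mod_quot_scale1 : left_id 1 mod_quot_scale.
Proof.
by move=> v; have [u ->] := mod_pi_surj v; rewrite !mod_quot_scaleE scale1r.
Qed.
Fact mod_quot_scaleDr : right_distributive mod_quot_scale +%R.
Proof.
move=> a v v'; have [u ->] := mod_pi_surj v; have [u' ->] := mod_pi_surj v'.
by rewrite -mod_piD !mod_quot_scaleE scalerDr mod_piD.
Qed.
Fact mod_quot_scaleDl v : {morph mod_quot_scale^~ v : a b / a + b}.
Proof.
move=> a b; have [u ->] := mod_pi_surj v.
by rewrite !mod_quot_scaleE scalerDl mod_piD.
Qed.
HB.instance Definition _ := GRing.Zmodule_isLmodule.Build R mod_quot
  mod_quot_scaleA mod_quot_scale1 mod_quot_scaleDr mod_quot_scaleDl.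

Fact mod_pi_linear : linear mod_pi.
Proof. by move=> a u v; rewrite mod_piD -mod_quot_scaleE. Qed.
HB.instance Definition _ := GRing.isLinear.Build R M mod_quot _ mod_pi mod_pi_linear.

End ModQuotient.

Section Borel.
Variables (K : fieldType) (n : nat).

Definition upper_trig : {pred 'M[K]_n} := fun A => is_trig_mx A^T.

Lemma upper_trigP (A : 'M[K]_n) :
  reflect (forall i j : 'I_n, (j < i)%N -> A i j = 0) (A \in upper_trig).
Proof.
apply: (iffP is_trig_mxP) => H i j ji; last by rewrite mxE H.
by have := H j i ji; rewrite mxE.
Qed.

Fact upper_trig_closed : subsemimod_closed upper_trig.
Proof.
split; first split.
- by apply/upper_trigP => i j _; rewrite mxE.
- move=> A B /upper_trigP HA /upper_trigP HB; apply/upper_trigP => i j ji.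
  by rewrite mxE HA // HB // addr0.
- move=> k A /upper_trigP HA; apply/upper_trigP => i j ji.
  by rewrite mxE HA // mulr0.
Qed.
HB.instance Definition _ :=
  GRing.isSubmodClosed.Build K 'M[K]_n upper_trig upper_trig_closed.

Lemma upper_trigM (A B : 'M[K]_n) :
  A \in upper_trig -> B \in upper_trig -> A *m B \in upper_trig.
Proof.
move=> /upper_trigP HA /upper_trigP HB; apply/upper_trigP => i j ji.
rewrite mxE big1 // => k _; case: (ltnP k i) => ki; first by rewrite HA ?mul0r.
by rewrite HB ?mulr0 // (leq_trans ji).
Qed.

Record borel := Borel { bmx : 'M[K]_n; bmxP : bmx \in upper_trig }.
HB.instance Definition _ := [isSub for bmx].
HB.instance Definition _ := [Choice of borel by <:].
HB.instance Definition _ := [SubChoice_isSubLmodule of borel by <:].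

Fact blie_subproof (x y : borel) :
  bmx x *m bmx y - bmx y *m bmx x \in upper_trig.
Proof. by rewrite rpredB // upper_trigM // bmxP. Qed.

Definition blie (x y : borel) : borel := Borel (blie_subproof x y).

Fact blie_linl y : linear (blie^~ y).
Proof.
move=> k x x'; apply: val_inj => /=.
by rewrite mulmxDl mulmxDr -scalemxAl -scalemxAr scalerBr opprD addrACA.
Qed.
Fact blie_linr x : linear (blie x).
Proof.
move=> k y y'; apply: val_inj => /=.
by rewrite mulmxDl mulmxDr -scalemxAl -scalemxAr scalerBr opprD addrACA.
Qed.
Fact bliexx x : blie x x = 0.
Proof. by apply: val_inj => /=; rewrite subrr. Qed.
Fact blie_jacobi x y z :
  blie x (blie y z) + blie y (blie z x) + blie z (blie x y) = 0.
Proof.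
apply: val_inj => /=; move: (bmx x) (bmx y) (bmx z) => {x y z} x y z.
rewrite !(mulmxBl, mulmxBr) !mulmxA !opprB.
set a := x *m y *m z; set b := x *m z *m y; set c := y *m z *m x.
set d := z *m y *m x; set e := y *m x *m z; set f := z *m x *m y.
apply/matrixP => i j; rewrite !mxE; ring.
Qed.

HB.instance Definition _ := Lmodule_isLieAlgebra.Build K borel
  blie_linl blie_linr bliexx blie_jacobi.

Fact emx_subproof (i j : 'I_n) :
  (i < j)%N -> delta_mx i j \in upper_trig.
Proof.
move=> ij; apply/upper_trigP => p q qp; rewrite mxE.
case: eqP => [pi|//]; case: eqP => [qj|//].
by move: qp; rewrite pi qj ltnNge ltnW.
Qed.

Definition emx (i j : 'I_n) (ij : (i < j)%N) : borel := Borel (emx_subproof ij).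

Definition pairing (lam : 'I_n -> int) (h : borel) : K :=
  \sum_(i < n) (lam i)%:~R * bmx h i i.

End Borel.

(** [ext K n l] is the [l]-th exterior power of [K^n], in coordinates with
    respect to the basis of the [u_(s_0) /\ ... /\ u_(s_(l-1))], indexed by the
    [l]-element subsets [S = {s_0 < ... < s_(l-1)}].  The coordinates of
    [v_0 /\ ... /\ v_(l-1)] are the maximal minors of the matrix with columns
    [v_i], so the wedges of the [u_s] are the coordinate vectors
    ([wedge_basis]).  A matrix acts by the Leibniz rule on these;
    [ext_act_wedge] is the Leibniz rule for arbitrary vectors. *)

Section Exterior.
Variables (K : fieldType) (n l : nat).

Definition lsub := {S : {set 'I_n} | #|S| == l}.
HB.instance Definition _ := Finite.on lsub.

(** Increasing in [i], since [enum_val] is on a set of ordinals. *)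
Definition selt (S : lsub) (i : 'I_l) : 'I_n :=
  enum_val (cast_ord (esym (eqP (valP S))) i).

Definition uvec (i : 'I_n) : 'cV[K]_n := delta_mx i 0.

Definition ext := {ffun lsub -> K^o}.

Definition wedge (v : 'I_l -> 'cV[K]_n) : ext :=
  [ffun S => \det (\matrix_(i, j) v i (selt S j) 0)].

Definition leibniz (x : 'M[K]_n) (v : 'I_l -> 'cV[K]_n) : ext :=
  \sum_(k < l) wedge [eta v with k |-> x *m v k].

Definition ext_act (x : 'M[K]_n) (f : ext) : ext :=
  \sum_S f S *: leibniz x (fun i => uvec (selt S i)).

Lemma ext_sumE I (r : seq I) (P : pred I) (F : I -> ext) S :
  (\sum_(i <- r | P i) F i) S = \sum_(i <- r | P i) (F i S : K).
Proof. by apply: (big_morph (fun f : ext => f S : K)) => [f g|]; rewrite ffunE. Qed.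

Lemma ext_act_linear x : linear (ext_act x).
Proof.
move=> k f g; rewrite /ext_act scaler_sumr -big_split; apply: eq_bigr => S _.
by rewrite /= !ffunE scalerDl scalerA.
Qed.


Lemma wedge_lin (v v1 v2 : 'I_l -> 'cV[K]_n) k c :
    v k = c *: v1 k + v2 k ->
    (forall i, i != k -> v1 i = v i) -> (forall i, i != k -> v2 i = v i) ->
  wedge v = c *: wedge v1 + wedge v2.
Proof.
move=> vk v1E v2E; apply/ffunP => S; rewrite !ffunE -[_ *: _]/(_ * _).
rewrite -[X in _ = _ + X]mul1r; apply: (determinant_multilinear (i0 := k)).
- by apply/rowP => j; rewrite !mxE vk !mxE mul1r.
- by apply/matrixP => i j; rewrite !mxE v1E // eq_sym neq_lift.
- by apply/matrixP => i j; rewrite !mxE v2E // eq_sym neq_lift.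
Qed.

Lemma eq_wedge (v v' : 'I_l -> 'cV[K]_n) : v =1 v' -> wedge v = wedge v'.
Proof.
move=> e; apply/ffunP => S; rewrite !ffunE.
by congr (\det _); apply/matrixP => i j; rewrite !mxE e.
Qed.

Lemma wedge_perm (s : 'S_l) (v : 'I_l -> 'cV[K]_n) :
  wedge (v \o s) = (-1) ^+ s *: wedge v.
Proof.
apply/ffunP => S; rewrite !ffunE -[_ *: _]/(_ * _) -det_perm -det_mulmx -row_permE.
by congr (\det _); apply/matrixP => i j; rewrite !mxE.
Qed.

Lemma wedge_alt (v : 'I_l -> 'cV[K]_n) i1 i2 :
  i1 != i2 -> v i1 = v i2 -> wedge v = 0.
Proof.
move=> ne e; apply/ffunP => S; rewrite !ffunE.
by apply: (determinant_alternate ne) => j; rewrite !mxE e.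
Qed.

Lemma leibniz_linl v : linear (leibniz^~ v).
Proof.
move=> k x y; rewrite /leibniz scaler_sumr -big_split; apply: eq_bigr => i _ /=.
apply: (wedge_lin (k := i)); rewrite /= ?eqxx.
- by rewrite mulmxDl scalemxAl.
- by move=> j /negPf->.
- by move=> j /negPf->.
Qed.

Lemma eq_leibniz x v v' : v =1 v' -> leibniz x v = leibniz x v'.
Proof.
move=> e; apply: eq_bigr => k _; apply: eq_wedge => i /=.
by rewrite !e.
Qed.

Lemma leibniz_perm x (s : 'S_l) v :
  leibniz x (v \o s) = (-1) ^+ s *: leibniz x v.
Proof.
rewrite /leibniz scaler_sumr [RHS](reindex_inj (@perm_inj _ s)) /=.
apply: eq_bigr => k _; rewrite -wedge_perm; apply: eq_wedge => i /=.
by rewrite (inj_eq perm_inj).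
Qed.

Lemma leibniz_alt x v i1 i2 :
  i1 != i2 -> v i1 = v i2 -> leibniz x v = 0.
Proof.
move=> ne e; rewrite /leibniz (bigD1 i1) //= (bigD1 i2) 1?eq_sym //=.
rewrite big1 ?addr0 => [|k /andP[k1 k2]]; last first.
  by apply: (wedge_alt ne) => /=; rewrite !(eq_sym _ k) (negPf k1) (negPf k2).
rewrite [X in _ + X](_ : _ = - wedge [eta v with i1 |-> x *m v i1]) ?subrr //.
have := wedge_perm (tperm i1 i2) [eta v with i1 |-> x *m v i1].
rewrite odd_tperm ne expr1 scaleN1r => <-; apply: eq_wedge => i /=.
case: tpermP => [->|->|/eqP/negPf n1 /eqP/negPf n2].
- by rewrite (negPf ne) eq_sym (negPf ne).
- by rewrite !eqxx e.
- by rewrite n1 n2.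
Qed.

Lemma leibniz_expand x v :
  leibniz x v = \sum_(a : {ffun 'I_l -> 'I_n})
    (\prod_i v i (a i) 0) *: leibniz x (fun i => uvec (a i)).
Proof.
apply/ffunP => T; rewrite [RHS]ext_sumE.
transitivity (\sum_k \sum_(a : {ffun 'I_l -> 'I_n}) (\prod_i v i (a i) 0) *
   wedge [eta (fun i => uvec (a i)) with k |-> x *m uvec (a k)] T).
  rewrite /leibniz ext_sumE; apply: eq_bigr => k _; rewrite ffunE /determinant.
  pose Y i p j := if i == k then x (selt T j) p else (selt T j == p)%:R.
  transitivity (\sum_(s : 'S_l) \sum_(a : {ffun 'I_l -> 'I_n})
      (-1) ^+ s * ((\prod_i v i (a i) 0) * \prod_i Y i (a i) (s i))).
    apply: eq_bigr => s _; rewrite -mulr_sumr; congr (_ * _).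
    under [RHS]eq_bigr do rewrite -big_split /=.
    rewrite -(bigA_distr_bigA (fun i p => v i p 0 * Y i p (s i))).
    apply: eq_bigr => i _; rewrite !mxE /= /Y; case: eqP => [->|_].
      by rewrite mxE; apply: eq_bigr => p _; rewrite mulrC.
    rewrite (bigD1 (selt T (s i))) //= eqxx mulr1 big1 ?addr0 // => p.
    by rewrite eq_sym => /negPf ->; rewrite mulr0.
  rewrite exchange_big; apply: eq_bigr => a _; rewrite ffunE mulr_sumr.
  apply: eq_bigr => s _; rewrite mulrCA; congr (_ * (_ * _)).
  apply: eq_bigr => i _; rewrite !mxE /Y /=; case: eqP => [->|_]; last first.
    by rewrite mxE andbT.
  rewrite mxE (bigD1 (a k)) //= big1 ?addr0 => [|p /negPf pk].
    by rewrite mxE !eqxx mulr1.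
  by rewrite mxE pk mulr0.
rewrite exchange_big; apply: eq_bigr => a _ /=.
by rewrite ffunE /leibniz ext_sumE -[_ *: _]/(_ * _) mulr_sumr.
Qed.

Lemma selt_inj S : injective (selt S).
Proof. by move=> i j /enum_val_inj /cast_ord_inj. Qed.

Lemma selt_mem (S : lsub) i : selt S i \in val S.
Proof. exact: enum_valP. Qed.

Lemma seltP (S : lsub) p : p \in val S -> exists i, selt S i = p.
Proof.
move=> pS; exists (cast_ord (eqP (valP S)) (enum_rank_in pS p)).
by rewrite /selt cast_ordK enum_rankK_in.
Qed.

Lemma wedge_basis S :
  wedge (fun i => uvec (selt S i)) = [ffun T => (T == S)%:R].
Proof.
apply/ffunP => T; rewrite !ffunE; case: eqP => [->|/eqP ne].
  rewrite (_ : \matrix_(i, j) _ = 1%:M) ?det1 //.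
  by apply/matrixP => i j; rewrite !mxE andbT (inj_eq (@selt_inj S)) eq_sym.
have /subsetPn[p /seltP[i <-] pT] : ~~ (val S \subset val T).
  apply: contra ne => ST; rewrite -val_eqE eq_sym eqEcard ST.
  by rewrite (eqP (valP S)) (eqP (valP T)) leqnn.
rewrite (expand_det_row _ i) big1 // => j _; rewrite !mxE andbT.
case: eqP => [e|_]; last by rewrite mul0r.
by rewrite -e selt_mem in pT.
Qed.

Lemma ext_act_wedge x v : ext_act x (wedge v) = leibniz x v.
Proof.
rewrite leibniz_expand (bigID (fun a : {ffun _ -> _} => injectiveb a)) /=.
rewrite [X in _ = _ + X]big1 ?addr0; last first.
  move=> a /injectivePn[i1 [i2 ne e]].
  by rewrite (leibniz_alt x ne) ?scaler0 // e.
pose h (u : lsub * 'S_l) : {ffun 'I_l -> 'I_n} := [ffun i => selt u.1 (u.2 i)].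
have h_inj : {in [set: lsub * 'S_l]%SET &, injective h}.
  move=> [S s] [S' s'] _ _ /ffunP e.
  have ih i : selt S (s i) = selt S' (s' i) by have := e i; rewrite !ffunE.
  have eS : S = S'.
    apply: val_inj; apply/setP => p; apply/idP/idP => /seltP[i <-].
      by rewrite -[i](permKV s) ih selt_mem.
    by rewrite -[i](permKV s') -ih selt_mem.
  rewrite -eS in ih *; congr (_, _); apply/permP => i; exact: (selt_inj (ih i)).
have h_im : [set a : {ffun 'I_l -> 'I_n} | injectiveb a]%SET = (h @: [set: lsub * 'S_l])%SET.
  apply/setP => a; rewrite inE; apply/idP/imsetP => [/injectiveP a_inj|[[S s] _ ->]].
    have cS : #|[set a i | i : 'I_l]%SET| == l by rewrite card_imset // card_ord.
    pose S : lsub := exist (fun S : {set 'I_n} => #|S| == l) _ cS.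
    have aS i : exists j, selt S j = a i.
      by apply: seltP; apply/imsetP; exists i.
    pose f i := projT1 (cid (aS i)).
    have fE i : selt S (f i) = a i by rewrite /f; case: (cid (aS i)).
    have f_inj : injective f by move=> i j e; apply: a_inj; rewrite -!fE e.
    by exists (S, perm f_inj) => //; apply/ffunP => i; rewrite ffunE /= permE fE.
  by apply/injectiveP => i j; rewrite !ffunE /= => /selt_inj /perm_inj.
transitivity (\sum_(a in [set a : {ffun 'I_l -> 'I_n} | injectiveb a]%SET)
    (\prod_i v i (a i) 0) *: leibniz x (fun i => uvec (a i))); last first.
  by apply: eq_bigl => a; rewrite inE.
rewrite h_im big_imset //= /ext_act.
rewrite (eq_bigl xpredT) => [|u]; last by rewrite inE.
rewrite -(pair_bigA _ (fun S s => (\prod_i v i (h (S, s) i) 0) *: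
  leibniz x (fun i => uvec (h (S, s) i)))) /=.
apply: eq_bigr => S _; rewrite ffunE /determinant scaler_suml.
apply: eq_bigr => s _.
rewrite (@eq_leibniz x (fun i => uvec (h (S, s) i))
  ((fun i => uvec (selt S i)) \o s)); last by move=> i; rewrite /= /h ffunE.
rewrite leibniz_perm scalerA mulrC; congr (_ * _ *: _).
by apply: eq_bigr => i _; rewrite mxE ?ffunE.
Qed.

Lemma ext_act_sum x I (r : seq I) (F : I -> ext) :
  ext_act x (\sum_(i <- r) F i) = \sum_(i <- r) ext_act x (F i).
Proof.
pose g : {linear ext -> ext} := HB.pack (ext_act x)
  (GRing.isLinear.Build K ext ext _ (ext_act x) (ext_act_linear x)).
exact: (linear_sum g).
Qed.

Lemma ext_actZ x c f : ext_act x (c *: f) = c *: ext_act x f.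
Proof.
by rewrite /ext_act scaler_sumr; apply: eq_bigr => S _; rewrite ffunE scalerA.
Qed.

Lemma ext_act_linl f : linear (ext_act^~ f).
Proof.
move=> k x y; rewrite /ext_act scaler_sumr -big_split; apply: eq_bigr => S _ /=.
by rewrite leibniz_linl scalerDr !scalerA mulrC.
Qed.

Lemma ext_act_leibniz x y v :
  ext_act x (leibniz y v) = \sum_k wedge [eta v with k |-> x *m (y *m v k)] +
   \sum_k \sum_(m | m != k)
     wedge (fun i => if i == k then y *m v k else if i == m then x *m v m else v i).
Proof.
rewrite ext_act_sum -big_split; apply: eq_bigr => k _ /=.
rewrite ext_act_wedge /leibniz (bigD1 k) //= eqxx; congr (_ + _).
  by apply: eq_wedge => i /=; case: eqP.
apply: eq_bigr => m mk; apply: eq_wedge => i /=; rewrite (negPf mk).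
by case: eqP => [->|//]; rewrite (negPf mk).
Qed.

Lemma ext_act_lie x y f :
  ext_act (x *m y - y *m x) f = ext_act x (ext_act y f) - ext_act y (ext_act x f).
Proof.
rewrite [ext_act y f]/ext_act [ext_act x f]/ext_act !ext_act_sum -sumrB.
rewrite /ext_act; apply: eq_bigr => S _; rewrite -!/(ext_act _ _) !ext_actZ -scalerBr.
congr (_ *: _); rewrite !ext_act_leibniz; set v := fun i => uvec _.
rewrite [X in _ = _ + X - _](_ : _ = \sum_k \sum_(m | m != k)
     wedge (fun i => if i == k then x *m v k else if i == m then y *m v m else v i)).
  rewrite opprD addrACA subrr addr0 -sumrB; apply: eq_bigr => k _.
  rewrite -[X in _ = _ + X]scaleN1r [RHS]addrC; apply: (wedge_lin (k := k)); rewrite /= ?eqxx.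
  - by rewrite mulmxBl !mulmxA scaleN1r addrC.
  - by move=> i /negPf->.
  - by move=> i /negPf->.
rewrite (exchange_big_dep xpredT) //=; apply: eq_bigr => k _.
apply: eq_big => [m|m mk]; first by rewrite eq_sym.
apply: eq_wedge => i; case: eqP => [->|//]; case: eqP => // km.
by rewrite km eqxx in mk.
Qed.

End Exterior.

(** [tens K n N l] is [ext K n (l 0) (x) ... (x) ext K n (l (N-1))], in
    coordinates with respect to the tensor products of basis vectors.
    For [c] an index and [k < N], [slice f c k] is the vector in the [k]-th
    factor obtained from [f] by fixing the other coordinates to those of [c],
    so that [1 (x) ... (x) x (x) ... (x) 1] ([x] acting in the [k]-th factor)
    sends [f] to [c |-> (x . slice f c k) (c k)]. *)

Section Tensor.
Variables (K : fieldType) (n N : nat) (l : nat -> nat).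

Definition tidx := {dffun forall j : 'I_N, lsub n (l j)}.
HB.instance Definition _ := Finite.on tidx.

Definition tens := {ffun tidx -> K^o}.

Definition pure (v : forall j : 'I_N, ext K n (l j)) : tens :=
  [ffun c : tidx => \prod_j v j (c j)].

Definition upd (c : tidx) (k : 'I_N) (b : lsub n (l k)) : tidx :=
  finfun (dfwith c b).
Arguments upd : clear implicits.

Definition slice (f : tens) (c : tidx) (k : 'I_N) : ext K n (l k) :=
  [ffun b => f (upd c k b)].

Definition tens_act (x : 'M[K]_n) (f : tens) : tens :=
  [ffun c : tidx => \sum_k ext_act x (slice f c k) (c k)].

Lemma upd_in c k b : upd c k b k = b.
Proof. by rewrite ffunE dfwith_in. Qed.

Lemma upd_out c k b j : k != j -> upd c k b j = c j.
Proof. by move=> kj; rewrite ffunE dfwith_out. Qed.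

Lemma upd_upd c k b b' : upd (upd c k b) k b' = upd c k b'.
Proof.
apply/ffunP => j; have [<-|kj] := eqVneq k j; first by rewrite !upd_in.
by rewrite !upd_out.
Qed.

Lemma upd_comm c k b m b' :
  k != m -> upd (upd c k b) m b' = upd (upd c m b') k b.
Proof.
move=> km; apply/ffunP => j; have [<-|kj] := eqVneq k j.
  by rewrite upd_in upd_out ?upd_in // eq_sym.
rewrite (upd_out _ _ kj); have [<-|mj] := eqVneq m j; first by rewrite !upd_in.
by rewrite !upd_out.
Qed.

Lemma tens_act_pure x v :
  tens_act x (pure v) = \sum_k pure (dfwith v (ext_act x (v k))).
Proof.
apply/ffunP => c.
have sumE (F : 'I_N -> tens) : (\sum_k F k) c = \sum_k (F k c : K).
  by apply: (big_morph (fun f : tens => f c : K)) => [f g|]; rewrite ffunE.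
rewrite sumE ffunE; apply: eq_bigr => k _; rewrite ffunE (bigD1 k) //= dfwith_in.
have -> : slice (pure v) c k = (\prod_(j | j != k) v j (c j) : K) *: v k.
  apply/ffunP => b; rewrite !ffunE (bigD1 k) //= upd_in mulrC; congr (_ * _).
  by apply: eq_bigr => j jk; rewrite upd_out // eq_sym.
rewrite ext_actZ ffunE -[_ *: _]/(_ * _) mulrC; congr (_ * _).
by apply: eq_bigr => j jk; rewrite dfwith_out // eq_sym.
Qed.

Lemma tens_act_linr x : linear (tens_act x).
Proof.
move=> k f g; apply/ffunP => c; rewrite !ffunE -[X in _ = X + _]/(k * _) mulr_sumr -big_split.
apply: eq_bigr => i _ /=.
have -> : slice (k *: f + g) c i = k *: slice f c i + slice g c i.
  by apply/ffunP => b; rewrite !ffunE.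
by rewrite ext_act_linear !ffunE.
Qed.

Lemma tens_act_linl f : linear (tens_act^~ f).
Proof.
move=> k x y; apply/ffunP => c; rewrite !ffunE -[X in _ = X + _]/(k * _) mulr_sumr -big_split.
by apply: eq_bigr => i _ /=; rewrite ext_act_linl !ffunE.
Qed.

Lemma tens_act_act x y f c :
  tens_act x (tens_act y f) c = \sum_k ext_act x (ext_act y (slice f c k)) (c k) +
    \sum_k \sum_(m | m != k) \sum_b \sum_b'
       leibniz x (fun i => uvec K (selt b i)) (c k) *
       (leibniz y (fun i => uvec K (selt b' i)) (c m) *
        f (upd (upd c k b) m b')).
Proof.
rewrite ffunE -big_split; apply: eq_bigr => k _ /=.
have -> : slice (tens_act y f) c k = ext_act y (slice f c k) +
    [ffun b => \sum_(m | m != k) ext_act y (slice f (upd c k b) m) (c m)].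
  apply/ffunP => b; rewrite !ffunE (bigD1 k) //= upd_in; congr (ext_act _ _ _ + _).
    by apply/ffunP => b'; rewrite !ffunE upd_upd.
  by apply: eq_bigr => m mk; rewrite upd_out // eq_sym.
have -> u v : ext_act x (u + v) = ext_act x u + ext_act x v.
  by have := ext_act_linear x 1 u v; rewrite !scale1r.
rewrite ffunE; congr (_ + _); rewrite {1}/ext_act ext_sumE.
rewrite exchange_big; apply: eq_bigr => b _ /=.
rewrite !ffunE -[_ *: _]/(_ * _) mulr_suml; apply: eq_bigr => m mk.
rewrite /ext_act ext_sumE mulr_suml; apply: eq_bigr => b' _.
by rewrite !ffunE -[_ *: _]/(_ * _) [RHS]mulrC; congr (_ * _); rewrite mulrC.
Qed.

Lemma tens_act_lie x y f :
  tens_act (x *m y - y *m x) f =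
  tens_act x (tens_act y f) - tens_act y (tens_act x f).
Proof.
apply/ffunP => c; rewrite [RHS]ffunE [X in _ = _ + X]ffunE !tens_act_act.
set A := \sum_k \sum_(m | m != k) _; set B := \sum_k \sum_(m | m != k) _.
have -> : A = B.
  rewrite /A (exchange_big_dep xpredT) //=; apply: eq_bigr => m _.
  apply: eq_big => [k|k mk]; first by rewrite eq_sym.
  rewrite exchange_big; apply: eq_bigr => b' _; apply: eq_bigr => b _ /=.
  by rewrite mulrCA upd_comm // eq_sym.
rewrite opprD addrACA subrr addr0 -sumrB ffunE; apply: eq_bigr => k _.
by rewrite ext_act_lie !ffunE.
Qed.

Definition tens_rep : lie_rep (borel K n) tens :=
  @LieRep K (borel K n) tens (fun x => tens_act (bmx x))
    (fun f k x y => tens_act_linl f k (bmx x) (bmx y))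
    (fun x => tens_act_linr (bmx x))
    (fun x y => tens_act_lie (bmx x) (bmx y)).

End Tensor.

(** Positions and values are shifted by one: [w : nat -> nat] stands for the
    permutation [i + 1 |-> w i + 1] of the positive integers. *)

Definition Sinf (w : nat -> nat) : Prop :=
  bijective w /\ exists N, forall k, (N <= k)%N -> w k = k.

Definition Sinf_n (n : nat) (w : nat -> nat) : Prop :=
  Sinf w /\ forall i j, (n <= i)%N -> (i < j)%N -> (w i < w j)%N.

Definition inversion (w : nat -> nat) (i j : nat) : bool :=
  (i < j)%N && (w j < w i)%N.

(* All the sets of naturals below are finite when [Sinf w]; [ncard] would
   return 0 on an infinite set. *)
Definition ncard (A : set nat) : nat := #|` fset_set A |.

Definition code (w : nat -> nat) (i : nat) : nat :=
  ncard [set j | inversion w i j]%classic.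

Definition mstat (w : nat -> nat) (i j : nat) : nat :=
  ncard [set k | (j < k)%N /\ (w i < w k < w j)%N]%classic.

Definition Dset (n : nat) (w : nat -> nat) (j : nat) : {set 'I_n} :=
  [set i : 'I_n | inversion w i j]%SET.

Definition ldeg (n : nat) (w : nat -> nat) (j : nat) : nat := #|Dset n w j|.

Lemma ldeg_eventually0 n w : Sinf_n n w ->
  exists N, forall j, (N <= j)%N -> ldeg n w j = 0%N.
Proof.
move=> [[[w' wK _] [N wN]] _]; exists N => j Nj.
apply/eqP; rewrite cards_eq0; apply/eqP/setP => i; rewrite !inE.
apply/negP => /andP[ij]; rewrite (wN j Nj) => jwi.
have := wN (w i) (leq_trans Nj (ltnW jwi)) => /(can_inj wK) e.
by rewrite e ltnNge (ltnW ij) in jwi.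
Qed.

Section KP.
Variables (K : fieldType) (n : nat) (w : nat -> nat).

Definition uwj (j : nat) : ext K n (ldeg n w j) :=
  wedge (fun i : 'I_#|Dset n w j| => uvec K (enum_val i)).

(** [N] is a number of tensor factors beyond which [ldeg n w j = 0], so that
    the omitted factors are all equal to [K], with [uwj j] equal to 1. *)
Definition KPspace (N : nat) := rep_mod (tens_rep K n N (ldeg n w)).
HB.instance Definition _ (N : nat) := GRing.Lmodule.on (KPspace N).

Definition uw (N : nat) : KPspace N := pure (fun j : 'I_N => uwj j).

Definition KP (N : nat) := cyclic (uw N).
HB.instance Definition _ (N : nat) := GRing.Lmodule.on (KP N).

Definition KPgen (N : nat) : KP N := cyc_gen (uw N).

Inductive Iw_gen : Uenv (borel K n) -> Prop :=
| Iw_diag (h : borel K n) : is_diag_mx (bmx h) ->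
    Iw_gen (Uin h - (pairing (fun i => (code w i)%:Z) h)%:A)
| Iw_e (i j : 'I_n) (ij : (i < j)%N) :
    Iw_gen (Uin (emx K ij) ^+ (mstat w i j).+1).

Definition Iw : submodClosed (Uenv (borel K n))^o := lideal Iw_gen.

Definition U_mod_Iw := mod_quot Iw.
HB.instance Definition _ := GRing.Lmodule.on U_mod_Iw.

Definition one_mod_Iw : U_mod_Iw := mod_pi Iw 1.

End KP.

(* Main.v *)
(** Positions and values are numbered from 0.  Let [j] be the last descent of
    [w], [k] the last position with [w k < w j], [v = w t_jk], let [i] run
    through the positions with [l(v t_ij) = l(v) + 1], and put [w_i = v t_ij],
    [m_i = m_ij(w)] and [y_i = e_ij ^ m_i] (the transition recursion of Lascoux
    and Schützenberger).  Commutator computations in [U(b)] show that 1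
    satisfies the relations of [I_v], twisted by the [j]-th coordinate
    character, modulo [I_w + sum_i U(b) y_i], and that [y_i] satisfies those of
    [I_(w_i)] modulo [I_w + sum_(i' < i) U(b) y_i'].

    On the side of [S_w], where tensor factors are labelled by the values of
    [w], contraction of the factor [w k] with the dual of [u_j] maps [u_w] to a
    multiple of [u_v], and moving vectors from the factor [w k] to the factor
    [w i] maps [y_i u_w] to a nonzero multiple of [u_(w_i)] and [y_i' u_w] to 0
    for [i' < i]; both maps commute with [b], up to the twist.  So if [f]
    annihilates [u_w], induction on the last descent and then on the value
    there puts [f] first in [I_w + sum_i U(b) y_i], and then, descending
    through the partial sums, in [I_w].  No dimensions need to be compared.

    The tensor product of exterior powers is embedded in a fermionic Fock
    space, whose modes are pairs (row, factor): the action of [b] and the two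
    maps above become linear or quadratic in creation and annihilation
    operators. *)
From HB Require Import structures.
From mathcomp Require Import finmap boolp classical_sets cardinality.
From mathcomp Require Import all_boot all_order all_algebra.
From mathcomp Require Import zify ring.
Require Import Defs.
Set Implicit Arguments.
Unset Strict Implicit.
Unset Printing Implicit Defensive.
Import GRing.Theory.

(** * Inequalities between the statistics m_pq *)

Definition bterm (w : nat -> nat) (p q r : nat) : nat := (q < r) && (w p < w r < w q).

(* This is [mstat w p q] when the permutation [w] fixes all [r >= B]. *)
Definition bstat (B : nat) (w : nat -> nat) (p q : nat) : nat :=
  \sum_(r < B) bterm w p q r.

(** Transposing values changes the summands at two or three positions only. There the totals are
    compared, elsewhere the summands one by one. *)
Lemma leq_sum2 B j k (F G : nat -> nat) : j < B -> k < B -> j <> k ->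
    (forall r, r < B -> r <> j -> r <> k -> F r <= G r) ->
  F j + F k <= G j + G k -> \sum_(r < B) F r <= \sum_(r < B) G r.
Proof.
move=> jB kB /eqP jk; pose J := Ordinal jB; pose k' := Ordinal kB.
have E (H : nat -> nat) : \sum_(r < B) H r =
    H j + H k + \sum_(r < B | (r != J) && (r != k')) H r.
  by rewrite (bigD1 J) //= (bigD1 k') 1?eq_sym //= addnA.
move=> FG FGjk; rewrite !E leq_add // leq_sum // => r /andP[/eqP rJ /eqP rk].
by apply: FG => // e; [apply: rJ | apply: rk]; apply: val_inj.
Qed.

Lemma leq_sum3 B i j k (F G : nat -> nat) : i < B -> j < B -> k < B ->
    i <> j -> i <> k -> j <> k ->
    (forall r, r < B -> r <> i -> r <> j -> r <> k -> F r <= G r) ->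
  F i + F j + F k <= G i + G j + G k -> \sum_(r < B) F r <= \sum_(r < B) G r.
Proof.
move=> iB jB kB /eqP ij /eqP ik /eqP jk.
pose I := Ordinal iB; pose J := Ordinal jB; pose k' := Ordinal kB.
have E (H : nat -> nat) : \sum_(r < B) H r = H i + H j + H k +
    \sum_(r < B | [&& r != I, r != J & r != k']) H r.
  rewrite (bigD1 I) //= (bigD1 J) -?val_eqE 1?eq_sym //=.
  rewrite (bigD1 k') -?val_eqE /= ?(eq_sym k) ?ik //= !addnA; congr (_ + _).
  by apply: eq_bigl => r; rewrite andbA.
move=> FG FGijk; rewrite !E leq_add // leq_sum // => r /and3P[/eqP ri /eqP rj /eqP rk].
by apply: FG => // e; [apply: ri | apply: rj | apply: rk]; apply: val_inj.
Qed.

(** By [pivot_inc], [w] has no descent after [j]. Together with [pivot_max], the values below [w j]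
    at positions after [j] are those at [j + 1, ..., k], and [w k] is the largest of them; the
    comparisons below rest on this. *)
Record pivot (B : nat) (w wi : nat -> nat) (j k : nat) : Prop := Pivot {
  pivot_can : cancel w wi;
  pivot_can_inv : cancel wi w;
  pivot_fix : forall r, B <= r -> w r = r;
  pivot_inc : forall a b, j < a -> a < b -> w a < w b;
  pivot_lt : j < k;
  pivot_desc : w k < w j;
  pivot_max : forall r, k < r -> w j < w r
}.

(** This is [v = w t_jk]. Parents, transitions and children are given by values rather than as
    products of permutations, so that [lia] can use them. *)
Record parent (w : nat -> nat) (j k : nat) (v : nat -> nat) : Prop := Parent {
  parent_j : v j = w k;
  parent_k : v k = w j;
  parent_out : forall r, r <> j -> r <> k -> v r = w r
}.

(* [w i < w k] and the last condition say that [l(v t_ij) = l(v) + 1]. *)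
Record transition (w : nat -> nat) (j k i : nat) : Prop := Transition {
  transition_lt : i < j;
  transition_val : w i < w k;
  transition_between : forall r, i < r < j -> ~~ (w i < w r < w k)
}.

(* [w' = v t_ij], where [v] is the parent. *)
Record child (w : nat -> nat) (j k i : nat) (w' : nat -> nat) : Prop := Child {
  child_i : w' i = w k;
  child_j : w' j = w i;
  child_k : w' k = w j;
  child_out : forall r, r <> i -> r <> j -> r <> k -> w' r = w r
}.

Section Transition.
Variables (B : nat) (w wi : nat -> nat) (j k : nat).
Hypothesis pv : pivot B w wi j k.

Let w_inj : injective w. Proof. exact: can_inj (pivot_can pv). Qed.
Let wB : forall r, B <= r -> w r = r. Proof. exact (pivot_fix pv). Qed.
Let w_inc : forall a b, j < a -> a < b -> w a < w b. Proof. exact (pivot_inc pv). Qed.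
Let jk : j < k. Proof. exact: pivot_lt pv. Qed.
Let wkj : w k < w j. Proof. exact: pivot_desc pv. Qed.
Let kmax : forall r, k < r -> w j < w r. Proof. exact (pivot_max pv). Qed.

(** If [k >= B], then [w k = k < w j], so [w] fixes [w j] as well and [w j = j < k]. *)
Lemma trans_lt_bound : k < B.
Proof.
rewrite ltnNge; apply/negP => /[dup] Bk /wB wk.
have /w_inj : w (w j) = w j by apply: wB; lia.
lia.
Qed.

Lemma bstat_inc_eq0 p q : j < q -> bstat B w p q = 0.
Proof.
move=> jq; apply: big1 => r _; rewrite /bterm; have := @w_inc q r jq.
by case: (ltnP q r) => //= _ /(_ isT); lia.
Qed.

Lemma bstat_gt_eq0 p q : w q < w p -> bstat B w p q = 0.
Proof. by move=> qp; apply: big1 => r _; rewrite /bterm; lia. Qed.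

(** The values below [w j] after position [j] are at most [w k], so none exceeds [w p]. *)
Lemma bstat_last_eq0 p : w k < w p -> bstat B w p j = 0.
Proof.
move=> kp; apply: big1 => r _; rewrite /bterm; have := @w_inc r k; have := @w_inc k r; have := @kmax r.
have : (r : nat) = k \/ (r : nat) <> k by lia.
case=> [->|]; lia.
Qed.

Section TransitionParent.
Variable v : nat -> nat.
Hypothesis pa : parent w j k v.
Let vj : v j = w k. Proof. exact: parent_j pa. Qed.
Let vk : v k = w j. Proof. exact: parent_k pa. Qed.
Let vE : forall r, r <> j -> r <> k -> v r = w r. Proof. exact (parent_out pa). Qed.

Lemma bstat_trans_lt p q : q < j -> p < q -> bstat B w p q <= bstat B v p q.
Proof.
move=> qj pq; have kB := trans_lt_bound.
apply: (@leq_sum2 _ j k (bterm w p q) (bterm v p q)); rewrite /bterm; try lia.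
  by move=> r rB rj rk; rewrite !vE; lia.
by rewrite vj vk !(@vE p) ?(@vE q); lia.
Qed.

(** Lowering the value at [j] from [w j] to [w k] loses at most the position [k], as every other
    value below [w j] after [j] is already below [w k]. The added sum is the indicator of [k]. *)
Lemma bstat_trans_last p : p < j -> bstat B w p j <= (bstat B v p j).+1.
Proof.
move=> pj; have kB := trans_lt_bound.
rewrite -addn1 -[1](_ : \sum_(r < B) (r == k :> nat) = 1) -?big_split /=; last first.
  rewrite (bigD1 (Ordinal kB)) //= eqxx big1 // => r /eqP rk.
  by case: eqP => // e; case: rk; apply: val_inj.
apply: leq_sum => r _; rewrite /bterm vj (@vE p); try lia.
have := @w_inc r k; have := @kmax r; have := @vE r.
by case: (eqVneq (r : nat) k) => [->|]; lia.
Qed.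

End TransitionParent.

(** The positions counted by [m_rj] carry values above [w r], those counted by [m_pr] values below;
    by the last hypothesis the latter also come after [j]. *)
Lemma bstat_add r p : p < r -> r < j -> w p < w r -> w r < w k ->
    (forall a, r < a < j -> ~~ (w p < w a < w r)) ->
  bstat B w r j + bstat B w p r <= bstat B w p j.
Proof.
move=> pr rj wpr wrk nr; rewrite -big_split leq_sum //= => a _.
rewrite /bterm; have := nr a; have : (a : nat) = j \/ (a : nat) <> j by lia.
by case=> [->|]; lia.
Qed.

Lemma bstat_trans_gt0 p : p < j -> w p < w k -> 0 < bstat B w p j.
Proof.
move=> pj wpk; rewrite /bstat (bigD1 (Ordinal trans_lt_bound)) //= {1}/bterm; lia.
Qed.

Section TransitionChild.
Variables (i : nat) (w' : nat -> nat).
Hypotheses (tr : transition w j k i) (ch : child w j k i w').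
Let ij : i < j. Proof. exact: transition_lt tr. Qed.
Let wik : w i < w k. Proof. exact: transition_val tr. Qed.
Let ibetween : forall r, i < r < j -> ~~ (w i < w r < w k). Proof. exact (transition_between tr). Qed.
Let w'i : w' i = w k. Proof. exact: child_i ch. Qed.
Let w'j : w' j = w i. Proof. exact: child_j ch. Qed.
Let w'k : w' k = w j. Proof. exact: child_k ch. Qed.
Let w'E : forall r, r <> i -> r <> j -> r <> k -> w' r = w r. Proof. exact (child_out ch). Qed.

Let kB := trans_lt_bound.

Let w_neq p r : p <> r -> w p <> w r.
Proof. by move=> pr /w_inj. Qed.

Let w_tail r : j < r -> r <> k -> r < k /\ w r < w k \/ k < r /\ w j < w r.
Proof.
move=> jr rk; have [rlk|] := ltnP r k; first by left; rewrite w_inc.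
by move=> kr; right; have := kmax (r := r); lia.
Qed.

(** The value [w i] cuts the interval from [w p] to [w j] in two: positions below it are counted for
    [w'], where [w' j = w i], and positions above it in [m_ij]. *)
Lemma bstat_child_last_gt p : i < p < j -> w p < w i ->
  bstat B w p j <= bstat B w' p j + bstat B w i j.
Proof.
move=> pj wpi; rewrite -big_split leq_sum //= => r _; rewrite /bterm w'j (@w'E p); try lia.
have := w_tail (r := r); case: (eqVneq (r : nat) k) => [->|rk]; first lia.
by have := @w'E r; have := @w_neq r i; lia.
Qed.

Lemma bstat_child_le p : w p < w i -> bstat B w i j <= bstat B w p j.
Proof. by move=> wpi; apply: leq_sum => r _; rewrite /bterm; lia. Qed.

Lemma bstat_child_last_add p r : p < i -> i < r < j -> w p < w r -> w r < w i ->
    (forall a, r < a < j -> ~~ (w p < w a < w i)) ->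
  bstat B w' r j + bstat B w p r <= bstat B w' p j.
Proof.
move=> pi irj wpr wri nr; rewrite -big_split leq_sum //= => a _.
rewrite /bterm w'j (@w'E p) ?(@w'E r); try lia.
have := w_tail (r := a); have := nr a; have := @w'E a.
case: (eqVneq (a : nat) k) => [->|ak]; first lia.
by case: (eqVneq (a : nat) j) => [->|aj]; lia.
Qed.

Lemma bstat_child_last_lt p : p < i -> w p < w i ->
    (forall a, i < a < j -> ~~ (w p < w a < w i)) ->
  bstat B w p i <= bstat B w' p j.
Proof.
move=> pi wpi nr; apply: leq_sum => a _.
rewrite /bterm w'j (@w'E p); try lia.
have := w_tail (r := a); have := nr a; have := @w'E a.
case: (eqVneq (a : nat) k) => [->|ak]; first lia.
by case: (eqVneq (a : nat) j) => [->|aj]; lia.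
Qed.

Lemma bstat_child_mid p : p < i -> w i < w p -> w p < w k ->
  bstat B w p j <= (bstat B w' p i).+1.
Proof.
move=> pi wip wpk.
rewrite -addn1 -[1](_ : \sum_(r < B) (r == k :> nat) = 1) -?big_split /=; last first.
  rewrite (bigD1 (Ordinal kB)) //= eqxx big1 // => r /eqP rk.
  by case: eqP => // e; case: rk; apply: val_inj.
apply: leq_sum => r _; rewrite /bterm w'i (@w'E p); try lia.
have := w_tail (r := r); have := @w'E r.
by case: (eqVneq (r : nat) k) => [->|]; lia.
Qed.

(** The position [k], which only [m_ij] counts, is made up for by [j] on the right, where
    [w' j = w i]. *)
Lemma bstat_child_col p : p < i -> w p < w i ->
  bstat B w p i + bstat B w i j <= bstat B w' p i.
Proof.
move=> pi wpi; rewrite -big_split /=.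
apply: (@leq_sum2 _ j k (fun r => bterm w p i r + bterm w i j r) (bterm w' p i)); try lia.
  move=> r rB rj rk; rewrite /bterm w'i (@w'E p); try lia.
  by have := w_tail (r := r); have := @w'E r; lia.
by rewrite /bterm w'i w'j w'k (@w'E p); lia.
Qed.

(** Values between [w i] and [w q] that are lost when the lower bound rises to [w' i = w k] sit
    after [j], because [i] is a transition; there [m_ij] counts them. *)
Lemma bstat_child_row q : i < q < j -> w k < w q ->
  bstat B w i q <= bstat B w' i q + bstat B w i j.
Proof.
move=> iqj wkq; rewrite -big_split /=.
apply: (@leq_sum2 _ j k (bterm w i q) (fun r => bterm w' i q r + bterm w i j r)); try lia.
  move=> r rB rj rk; rewrite /bterm w'i (@w'E q); try lia.
  have [rq|qr] := leqP r q; first lia.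
  rewrite (@w'E r); try lia; have [jr|rj'] := ltnP j r.
    by case: (w_tail jr rk); lia.
  by have := @ibetween r; have := @w_neq r k; have := @w_neq r i; lia.
by rewrite /bterm w'i w'j w'k (@w'E q); lia.
Qed.

Lemma bstat_child_row_le q : i < q < j -> w k < w q -> bstat B w i j <= bstat B w i q.
Proof.
move=> iqj wkq; apply: leq_sum => r _; rewrite /bterm.
have := w_tail (r := r); case: (eqVneq (r : nat) k) => [->|]; lia.
Qed.

Lemma bstat_child_off_lt p q : p < q -> q < i -> bstat B w p q <= bstat B w' p q.
Proof.
move=> pq qi; apply: (@leq_sum3 _ i j k (bterm w p q) (bterm w' p q)); try lia.
  move=> r rB ri rj rk; rewrite /bterm (@w'E p) ?(@w'E q) ?(@w'E r) //; lia.
by rewrite /bterm w'i w'j w'k (@w'E p) ?(@w'E q); lia.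
Qed.

(** At the two positions [j] and [k] the value [w k] is replaced by [w i]. This can only lose a
    position when [w i < w p < w k < w q], which the last hypothesis excludes. *)
Lemma bstat_child_off_mid p q : p < q -> p <> i -> i < q < j ->
  ~~ (w i < w p < w k) || (w q < w k) -> bstat B w p q <= bstat B w' p q.
Proof.
move=> pq pi iqj H; apply: (@leq_sum2 _ j k (bterm w p q) (bterm w' p q)); try lia.
  move=> r rB rj rk; rewrite /bterm (@w'E p) ?(@w'E q); try lia.
  by have := @w'E r; have := w_tail (r := r); lia.
have := @w_neq p i; rewrite /bterm w'j w'k (@w'E p) ?(@w'E q); lia.
Qed.

(** After [j], exchanging the lower ends of the intervals [(w i, w q)] and [(w p, w j)] does not
    change how often a value is covered. Between [q] and [j] no value lies between [w i] and [w k].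
    The summand 1 pays for [k]. *)
Lemma bstat_child_corner p q : p < i -> i < q < j -> w i < w p -> w p < w k -> w k < w q ->
  bstat B w i q + bstat B w p j <= bstat B w' p q + 1 + bstat B w i j.
Proof.
move=> pi iqj wip wpk wkq.
rewrite -addnA [1 + _]addnC addnA -[1](_ : \sum_(r < B) (r == k :> nat) = 1) -?big_split /=; last first.
  rewrite (bigD1 (Ordinal kB)) //= eqxx big1 // => r /eqP rk.
  by case: eqP => // e; case: rk; apply: val_inj.
apply: (@leq_sum2 _ j k (fun r => bterm w i q r + bterm w p j r)
  (fun r => bterm w' p q r + bterm w i j r + (r == k))); try lia.
  move=> r rB rj rk; rewrite /bterm (@w'E p) ?(@w'E q); try lia.
  have [rq|qr] := leqP r q; first lia.
  rewrite (@w'E r); try lia; have [jr|rj'] := ltnP j r.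
    by case: (w_tail jr rk); lia.
  by have := @ibetween r; have := @w_neq r k; have := @w_neq r i; lia.
by rewrite /bterm w'j w'k (@w'E p) ?(@w'E q); lia.
Qed.

End TransitionChild.
End Transition.

Local Open Scope ring_scope.

(** * Left ideals and commutation *)

Section LeftIdeals.
Variables (K : fieldType) (R : algType K).

Definition left_ideal (L : R -> Prop) :=
  [/\ L 0, forall a b, L a -> L b -> L (a + b) & forall a b, L b -> L (a * b)].

Definition colon (L : R -> Prop) (u : R) : R -> Prop := fun f => L (f * u).

Lemma left_ideal_colon L u : left_ideal L -> left_ideal (colon L u).
Proof.
case=> L0 LD LM; split; rewrite /colon ?mul0r // => a b.
  by rewrite mulrDl; apply: LD.
by rewrite -mulrA; apply: LM.
Qed.

Variable L : R -> Prop.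
Hypothesis idL : left_ideal L.

Lemma lid0 : L 0. Proof. by case: idL. Qed.
Lemma lidD a b : L a -> L b -> L (a + b). Proof. by case: idL => _ + _; apply. Qed.
Lemma lidM a b : L b -> L (a * b). Proof. by case: idL => _ _; apply. Qed.
Lemma lidN a : L a -> L (- a). Proof. by rewrite -mulN1r; apply: lidM. Qed.
Lemma lidB a b : L a -> L b -> L (a - b).
Proof. by move=> La /lidN; apply: lidD. Qed.
Lemma lidZ (c : K) a : L a -> L (c *: a).
Proof. by rewrite -mulr_algl; apply: lidM. Qed.
Lemma lidMn a m : L a -> L (a *+ m).
Proof. by rewrite -mulr_natl; apply: lidM. Qed.
Lemma lid_sum I (r : seq I) (P : pred I) (F : I -> R) :
  (forall i, P i -> L (F i)) -> L (\sum_(i <- r | P i) F i).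
Proof. by move=> H; elim/big_ind: _ => //; [exact: lid0 | exact: lidD]. Qed.
Lemma lid_addr a b : L b -> L (a + b) -> L a.
Proof. by move=> Lb Lab; rewrite -(addrK b a); apply: lidB. Qed.
Lemma lidX x a b : (a <= b)%N -> L (x ^+ a) -> L (x ^+ b).
Proof. by move=> ab; rewrite -(subnK ab) exprD; apply: lidM. Qed.

Hypothesis charK0 : [pchar K] =i pred0.

Lemma lid_div a m : (0 < m)%N -> L (a *+ m) -> L a.
Proof.
move=> m0 /(lidZ (m%:R^-1)); rewrite -scaler_nat scalerA mulVf ?scale1r //.
by rewrite ((pcharf0P K).1 charK0) -lt0n.
Qed.

Section Heisenberg.
Variables x y z : R.
Hypothesis xyE : x * y = y * x + z.
Hypothesis xz : GRing.comm x z.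
Hypothesis yz : GRing.comm y z.

Lemma mul_expr s : x * y ^+ s = y ^+ s * x + z * y ^+ s.-1 *+ s.
Proof.
elim: s => [|s IHs]; first by rewrite expr0 mulr1 mul1r mulr0n addr0.
rewrite !exprSr mulrA IHs mulrDl -mulrA xyE mulrDr mulrA -addrA; congr (_ + _).
rewrite mulrnAl -mulrA mulrS -(commrX s (commr_sym yz)) /=; congr (_ + _).
by case: s {IHs} => [|s] //=; rewrite -exprSr.
Qed.

Lemma expr_mul s : x ^+ s * y = y * x ^+ s + z * x ^+ s.-1 *+ s.
Proof.
elim: s => [|s IHs]; first by rewrite expr0 mulr1 mul1r mulr0n addr0.
rewrite exprS -mulrA IHs mulrDr mulrA xyE mulrDl -!mulrA -addrA; congr (_ + _).
rewrite mulrnAr mulrS /=; congr (_ + _).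
by case: s {IHs} => [|s] //=; rewrite mulrA xz -mulrA -exprS.
Qed.

(** Normal ordering. For [i > S] the exponent [S - i] is truncated to 0, but then [S ^_ i = 0]. *)
Lemma expr_mul_expr N S : x ^+ N * y ^+ S =
  \sum_(i < N.+1) (y ^+ (S - i) * z ^+ i * x ^+ (N - i)) *+ ('C(N, i) * S ^_ i).
Proof.
elim: N => [|N IHN]; first by rewrite big_ord1 /= !expr0 !mulr1 mul1r subn0 bin0 ffactn0.
rewrite exprS -mulrA IHN mulr_sumr.
pose T i := y ^+ (S - i) * z ^+ i * x ^+ (N.+1 - i).
have step (i : nat) : (i <= N)%N -> x * (y ^+ (S - i) * z ^+ i * x ^+ (N - i)) =
    T i + T i.+1 *+ (S - i).
  move=> iN; rewrite /T !mulrA mul_expr !mulrDl subSS; congr (_ + _).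
    by rewrite -!mulrA; congr (_ * _); rewrite mulrA (commrX i xz) -mulrA -exprS subSn //.
  by rewrite !mulrnAl -subnS exprS (commrX _ (commr_sym yz)) !mulrA.
rewrite (eq_bigr (fun i : 'I_N.+1 => T i *+ ('C(N, i) * S ^_ i) +
    T i.+1 *+ ('C(N, i) * S ^_ i.+1))); last first.
  move=> i _; rewrite mulrnAr step -1?ltnS // mulrnDl -mulrnA; congr (_ + _ *+ _).
  by rewrite ffactnSr mulnC -mulnA.
rewrite big_split /= [RHS]big_ord_recl [X in X + _]big_ord_recl /= -addrA.
congr (_ + _); first by rewrite !bin0.
rewrite [X in _ + X]big_ord_recr /= addrA.
rewrite [RHS]big_ord_recr /= /bump /= add1n !binn; congr (_ + _).
rewrite -big_split; apply: eq_bigr => i _ /=.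
by rewrite /T /bump /= add1n binS mulnDl mulrnDr.
Qed.

(* In the expansion of [x ^ (a + b) * y ^ (a + c)], which lies in [L], the terms
   of index below [a] contain [x ^ (b + 1)], those between [a] and [a + c] are
   covered by the induction hypothesis, and the term of index [a + c] is a
   multiple of the claimed element. *)
Lemma lid_heisenberg_mix a b c : (c <= b)%N ->
  L (x ^+ b.+1) -> L (y ^+ a) -> L (z ^+ (a + c) * x ^+ (b - c)).
Proof.
move=> + Lx Ly; elim/ltn_ind: c => c IHc cb.
have : L (x ^+ (a + b) * y ^+ (a + c)) by apply: lidM; apply: lidX Ly; lia.
have aclt : (a + c < (a + b).+1)%N by rewrite ltnS leq_add2l.
rewrite expr_mul_expr (bigD1 (Ordinal aclt)) //= subnn mul1r subnDl => Lsum.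
apply: (@lid_div _ ('C(a + b, a + c) * (a + c) ^_ (a + c))).
  by rewrite muln_gt0 bin_gt0 ffact_gt0 leqnn leq_add2l cb.
apply: lid_addr Lsum; apply: lid_sum => i ne.
have [iac|aci] := ltnP (a + c) i; first by rewrite ffact_small // muln0 mulr0n; apply: lid0.
apply: lidMn; have [ia|ai] := ltnP i a; first by apply: lidM; apply: lidX Lx; lia.
have iac : (i - a < c)%N.
  have : (i : nat) <> (a + c)%N by move=> e; move/eqP: ne; apply; apply: val_inj.
  by lia.
rewrite -mulrA; apply: lidM; have := IHc _ iac.
have -> : (a + (i - a) = i)%N by lia.
have -> : (b - (i - a) = a + b - i)%N by lia.
by apply; lia.
Qed.

Lemma lid_heisenberg a b : L (x ^+ b.+1) -> L (y ^+ a) -> L (z ^+ (a + b)).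
Proof.
by move=> Lx Ly; have := lid_heisenberg_mix (leqnn b) Lx Ly; rewrite subnn mulr1.
Qed.

(** As [x] is in [L], left multiplication by [x] acts modulo [L] like the bracket with [x], sending
    [z ^ t * y ^ s] to [s] times [z ^ (t + 1) * y ^ (s - 1)]. The factor is cancelled in
    characteristic zero. *)
Lemma lid_ad t s M : L x -> L (z ^+ t * y ^+ (s + M)) -> L (z ^+ (t + M) * y ^+ s).
Proof.
move=> Lx; elim: M t s => [|M IHM] t s; first by rewrite !addn0.
rewrite -addSnnS => H; rewrite -addSnnS; apply: IHM; move: H.
rewrite addSn => /(lidM x); rewrite mulrA (commrX t xz) -mulrA mul_expr mulrDr.
rewrite addrC mulrnAr !mulrA -exprSr => H.
by apply: (@lid_div _ (s + M).+1) => //; apply: lid_addr H; apply: lidM.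
Qed.

Lemma lid_ad_expr M t s : L x -> L (z ^+ (t + M) * y ^+ s) ->
  L (x ^+ M * (z ^+ t * y ^+ (s + M))).
Proof.
move=> Lx; elim: M t s => [|M IHM] t s; first by rewrite !addn0 mul1r.
rewrite exprSr -[x ^+ M * x * _]mulrA [x * _]mulrA (commrX t xz) -(mulrA _ x).
rewrite mul_expr mulrDr mulrDr addnS => H; apply: lidD.
  by rewrite !mulrA; apply: lidM.
rewrite !mulrnAr /= [z ^+ t * _]mulrA -exprSr; apply: lidMn; rewrite addnS.
by apply: IHM; rewrite addSn.
Qed.

Lemma lid_mul_expr m : L x -> L z -> L (x * y ^+ m).
Proof.
move=> Lx Lz; rewrite mul_expr; apply: lidD; first exact: lidM.
by rewrite (commrX _ (commr_sym yz)); apply/lidMn/lidM.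
Qed.

(** Each [y] moved to the left past the powers of [x] uses up at most one [x], and [m] of them are
    to spare. *)
Lemma lid_expr_add b m : L (x ^+ b) -> L (x ^+ (b + m) * y ^+ m).
Proof.
move=> Lx; elim: m => [|m IHm]; first by rewrite addn0 mulr1.
have Lxm : L (x ^+ (b + m).+1 * y ^+ m) by rewrite exprS -mulrA; apply: lidM.
rewrite addnS (exprS y) (mulrA _ y) expr_mul /= mulrDl; apply: lidD.
  by rewrite -mulrA; apply: lidM.
by rewrite mulrnAl -mulrA; apply/lidMn/lidM.
Qed.

End Heisenberg.

(* [a, b, c, d] stand for [e_pq, e_iq, e_pj, e_ij] with [p < i < q < j], and
   [X, Z] for [e_pi, e_qj].  Bracketing [Y g s] with [X] gives a combination of
   [Y g s.+1] and [Y g.+1 s.+1] with positive coefficients; [Y g 0] comes from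
   [b ^ (A + m + 1)] and [Y B s] from [c ^ B]. *)
Lemma lid_two_by_two (X Z a b c d : R) (A B m : nat) :
    X * b = b * X + a -> X * d = d * X + c -> Z * b = b * Z - d ->
    GRing.comm X a -> GRing.comm X c -> GRing.comm Z d ->
    GRing.comm a b -> GRing.comm a c -> GRing.comm a d ->
    GRing.comm b c -> GRing.comm b d -> GRing.comm c d ->
    L X -> L Z -> L (b ^+ (A + m).+1) -> L (c ^+ B) -> (0 < B <= m)%N ->
  L (a ^+ (A + B) * d ^+ m).
Proof.
move=> Xb Xd Zb Xa Xc Zd ab ac ad bc bd cd LX LZ Lb Lc /andP[B0 Bm].
have commXX (x y : R) g h : GRing.comm x y -> GRing.comm (x ^+ g) (y ^+ h).
  by move=> xy; apply/commrX/commr_sym/commrX/commr_sym.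
pose Y g s := c ^+ g * a ^+ (s + B.-1 - g) * (d ^+ (m - g) * b ^+ (A + g.+1 - s)).
have LY0 g s : (B <= g)%N -> L (Y g s).
  move=> Bg; rewrite /Y -mulrA.
  have -> : c ^+ g * (a ^+ (s + B.-1 - g) * (d ^+ (m - g) * b ^+ (A + g.+1 - s))) =
      a ^+ (s + B.-1 - g) * (d ^+ (m - g) * b ^+ (A + g.+1 - s)) * c ^+ g.
    by apply: commrM; last apply: commrM; apply: commXX => //; apply: commr_sym.
  by apply: lidM; apply: lidX Lc.
suff LY s g : (s <= A.+1)%N -> (g <= B)%N -> L (Y g s).
  have := LY A.+1 0%N (leqnn _) (leq0n _); rewrite /Y expr0 mul1r.
  have -> : (A.+1 + B.-1 - 0 = A + B)%N by lia.
  by rewrite addn1 subnn mulr1 subn0.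
elim: s g => [|s IHs] g sA gB.
  have [Bg|gB'] := leqP B g; first exact: LY0.
  apply: lidM; rewrite subn0.
  (* For [s = 0], bracket [b ^ (A + m + 1)] with [Z] exactly [m - g] times. Since [[Z, b] = - d],
     the power of [d] comes with a sign, removed by [signrMK]. *)
  have := @lid_ad Z b (- d) _ _ _ 0 (A + g.+1) (m - g) LZ.
  rewrite add0n mul1r [(- d) ^+ _]exprNn -mulrA => H.
  have {}H : L ((-1) ^+ (m - g) * (d ^+ (m - g) * b ^+ (A + g.+1))).
    apply: H => //; [exact: commrN | exact: commrN |].
    by have -> : (A + g.+1 + (m - g) = (A + m).+1)%N by lia.
  by have := lidM ((-1) ^+ (m - g)) H; rewrite signrMK.
(* Descending induction on [g], from [g = B], where [c ^ B] is in [L]. *)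
have [k ->] : exists k, g = (B - k)%N by exists (B - g)%N; lia.
elim: k {g gB} => [|k IHk]; first by apply: LY0; rewrite subn0.
have [kB|Bk] := leqP B k.
  by have -> : (B - k.+1 = B - k)%N by lia.
move: IHk; have -> : (B - k = (B - k.+1).+1)%N by lia.
move: (B - k.+1)%N (leq_subr k.+1 B) (ltn_subrL k.+1 B) => g gB.
rewrite B0 => gltB Lnext.
have Lprev : L (Y g s) by apply: IHs => //; lia.
(* This sum is the bracket of [X] with [Y g s], which lies in [L] as both do. Since [Y g.+1 s.+1] is
   in [L] already, [Y g s.+1] follows. *)
have : L (Y g s.+1 *+ (A + g.+1 - s) + Y g.+1 s.+1 *+ (m - g)); last first.
  move=> H; apply: (@lid_div _ (A + g.+1 - s)); first lia.
  by apply: lid_addr H; apply: lidMn.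
have -> : Y g s.+1 *+ (A + g.+1 - s) + Y g.+1 s.+1 *+ (m - g) =
    X * Y g s - c ^+ g * a ^+ (s + B.-1 - g) * (d ^+ (m - g) * b ^+ (A + g.+1 - s)) * X.
  rewrite /Y; have -> : (s.+1 + B.-1 - g = (s + B.-1 - g).+1)%N by lia.
  have -> : (s.+1 + B.-1 - g.+1 = s + B.-1 - g)%N by lia.
  have -> : (A + g.+2 - s.+1 = A + g.+1 - s)%N by lia.
  rewrite [in LHS]subnS [in X in _ + X]subnS.
  move: (s + B.-1 - g)%N (m - g)%N (A + g.+1 - s)%N => e f h.
  have XP : X * (c ^+ g * a ^+ e) = c ^+ g * a ^+ e * X by apply: commrM; apply: commrX.
  rewrite [X * (_ * _ * _)]mulrA XP -[_ * X * _]mulrA [X * (_ * _)]mulrA (mul_expr Xd (commr_sym cd)).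
  rewrite mulrDl -(mulrA _ X) (mul_expr Xb (commr_sym ab)) !mulrDr.
  have -> : c ^+ g * a ^+ e * (d ^+ f * b ^+ h) * X =
    c ^+ g * a ^+ e * (d ^+ f * (b ^+ h * X)) by rewrite -!mulrA.
  rewrite [in RHS]addrC !addrA addNr add0r.
  congr (_ + _).
    rewrite !mulrnAr; congr (_ *+ _); rewrite exprSr -!mulrA; do 2 congr (_ * _).
    by rewrite !mulrA (commrX f ad).
  rewrite mulrnAl mulrnAr; congr (_ *+ _); rewrite exprSr -!mulrA; congr (_ * _).
  by rewrite !mulrA (commrX e (commr_sym ac)).
by apply: lidB; apply: lidM.
Qed.

End LeftIdeals.

(** * The relations along a transition *)

Section ElementaryMatrices.
Variables (K : fieldType) (n : nat).
Local Notation U := (Uenv (borel K n)).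

(* Meant for [p <= q]: [insubd] makes it 0 otherwise. *)
Definition ebor (p q : 'I_n) : borel K n := insubd 0 (delta_mx p q).

Lemma ebor_val (p q : 'I_n) : (p <= q)%N -> bmx (ebor p q) = delta_mx p q.
Proof.
move=> pq; rewrite [bmx _]insubdK //; apply/upper_trigP => i j; rewrite mxE.
by case: (i =P p) => [->|//]; case: (j =P q) => [->|//]; lia.
Qed.

Lemma emx_ebor (p q : 'I_n) (pq : (p < q)%N) : emx K pq = ebor p q.
Proof. by apply: val_inj; rewrite /= ebor_val // ltnW. Qed.

Definition Uelt p q : U := Uin (ebor p q).

Lemma UinB (x y : borel K n) : Uin (x - y) = Uin x - Uin y :> U.
Proof. by rewrite addrC -scaleN1r Uin_linear scaleN1r addrC. Qed.

Lemma Uin0 : Uin 0 = 0 :> U.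
Proof. by rewrite -(subrr 0) UinB subrr. Qed.

Lemma Uelt_mul (p q r s : 'I_n) : (p <= q)%N -> (r <= s)%N ->
  Uelt p q * Uelt r s = Uelt r s * Uelt p q +
    (if q == r then Uelt p s else 0) - (if s == p then Uelt r q else 0).
Proof.
move=> pq rs; apply/eqP; rewrite -addrA addrC -subr_eq /Uelt -Uin_lie; apply/eqP.
have -> : lie (ebor p q) (ebor r s) =
    (if q == r then ebor p s else 0) - (if s == p then ebor r q else 0).
  apply: val_inj; rewrite /= !ebor_val // !mul_delta_mx_cond.
  case: eqP => [qr|_]; case: eqP => [sp|_]; rewrite ?subr0 ?sub0r /=.
  - by rewrite !ebor_val //; subst; lia.
  - by rewrite ebor_val //; subst; lia.
  - by rewrite ebor_val //; subst; lia.
  - by [].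
by rewrite UinB; case: (q == r); case: (s == p); rewrite ?Uin0.
Qed.

End ElementaryMatrices.

Section Serre.
Variables (K : fieldType) (n : nat) (charK0 : [pchar K] =i pred0).
Variables (R : algType K) (E : 'I_n -> 'I_n -> R).
Hypothesis E_mul : forall p q r s : 'I_n, (p <= q)%N -> (r <= s)%N ->
  E p q * E r s = E r s * E p q + (if q == r then E p s else 0) -
    (if s == p then E r q else 0).

Lemma E_comm (p q r s : 'I_n) : (p <= q)%N -> (r <= s)%N -> q != r -> s != p ->
  GRing.comm (E p q) (E r s).
Proof.
by move=> pq rs /negPf qr /negPf sp; rewrite /GRing.comm E_mul // qr sp addr0 subr0.
Qed.

Lemma E_bracket (p q r : 'I_n) : (p < q)%N -> (q < r)%N -> E p q * E q r = E q r * E p q + E p r.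
Proof.
move=> pq qr; rewrite (E_mul (ltnW pq) (ltnW qr)) eqxx.
by case: eqP => [rp|_]; [move: qr; rewrite rp; lia | rewrite subr0].
Qed.

Lemma E_bracketN (p q r : 'I_n) : (p < q)%N -> (q < r)%N -> E q r * E p q = E p q * E q r - E p r.
Proof. by move=> pq qr; rewrite E_bracket // addrK. Qed.

Variables (B : nat) (w wi : nat -> nat) (j : 'I_n) (k : nat).
Hypothesis pv : pivot B w wi j k.

Local Notation m := (bstat B w).

Definition serre (s : nat -> nat -> nat) (L : R -> Prop) :=
  forall p q : 'I_n, (p < q)%N -> L (E p q ^+ (s p q).+1).

Variable L : R -> Prop.
Hypotheses (idL : left_ideal L) (serreL : serre m L).

Let serre0 (p q : 'I_n) : (p < q)%N -> m p q = 0%N -> L (E p q).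
Proof. by move=> pq m0; have := serreL pq; rewrite m0 expr1. Qed.

(* Unless [p] is itself a transition, take the last [r < j] after [p] with
   [w p < w r < w k]; then [m_pj >= m_rj + m_pr], and [e_pj = [e_pr, e_rj]]. *)
Lemma serre_chain (p : 'I_n) : (p < j)%N -> (w p < w k)%N ->
    (forall r : 'I_n, transition w j k r -> (p <= r)%N -> (w p <= w r)%N -> L (E r j ^+ m r j)) ->
  L (E p j ^+ m p j).
Proof.
have [d] := ubnP (j - p)%N; elim: d p => // d IHd p jpd pj wpk Ltr.
pose P (a : 'I_n) := (p < a < j)%N && (w p < w a < w k)%N.
have [a0 Pa0|Pn] := pickP P; last first.
  apply: Ltr => //; split=> // a paj.
  have an : (a < n)%N by have := ltn_ord j; lia.
  by have /negbT := Pn (Ordinal an); rewrite /P /= paj.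
case: (@arg_maxnP _ a0 P val Pa0) => r /andP[prj wprk] rmax.
have prr : L (E r j ^+ m r j).
  apply: IHd; try lia.
  by move=> a tra ra wra; apply: Ltr => //; lia.
apply: (lidX idL) (lid_heisenberg idL charK0 (E_bracket _ _) _ _ (serreL _) prr); try lia.
- apply: (bstat_add pv); try lia; move=> a raj; apply/negP => wa.
  have an : (a < n)%N by have := ltn_ord j; lia.
  by have := rmax (Ordinal an); rewrite /P /=; lia.
- by apply: E_comm; rewrite -?val_eqE /=; lia.
- by apply: E_comm; rewrite -?val_eqE /=; lia.
Qed.

(** Only the column [q = j] needs work: there the exponent drops by at most one, and [serre_chain]
    gains one from the generators [E r j ^ m_rj]. *)
Lemma serre_parent (v : nat -> nat) : parent w j k v ->
    (forall r : 'I_n, transition w j k r -> L (E r j ^+ m r j)) ->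
  serre (bstat B v) L.
Proof.
move=> pa Ltr p q pq; have [qj|jq] := ltnP q j.
  by apply: (lidX idL) (serreL pq); rewrite ltnS; apply: (bstat_trans_lt pv pa).
have [jq'|qj] := ltnP j q.
  by apply: (lidX idL (a := 1)); rewrite ?expr1 //; apply/serre0/(bstat_inc_eq0 pv).
have {jq qj}qj : q = j by apply: val_inj; rewrite /=; lia.
rewrite {}qj in pq *; have [wkp|wpk] := ltnP (w k) (w p).
  by apply: (lidX idL (a := 1)); rewrite ?expr1 //; apply/serre0/(bstat_last_eq0 pv).
have wpk' : (w p < w k)%N.
  rewrite ltn_neqAle wpk andbT; apply/eqP => /(can_inj (pivot_can pv)) e.
  by have := pivot_lt pv; lia.
apply: (lidX idL) (serre_chain pq wpk' _); last by move=> r tr _ _; apply: Ltr.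
exact: (bstat_trans_last pv pa pq).
Qed.

Section SerreChild.
Variables (i : 'I_n) (w' : nat -> nat).
Hypotheses (tr : transition w j k i) (ch : child w j k i w').
Hypothesis Ltr : forall r : 'I_n, transition w j k r -> (r < i)%N -> L (E r j ^+ m r j).
Local Notation L' := (colon L (E i j ^+ m i j)).

Let ij : (i < j)%N. Proof. exact: transition_lt tr. Qed.
Let w_neq p r : p <> r -> w p <> w r.
Proof. by move=> pr /(can_inj (pivot_can pv)). Qed.
Let between : forall r, (i < r < j)%N -> ~~ (w i < w r < w k)%N.
Proof. exact (transition_between tr). Qed.
Let wik : (w i < w k)%N. Proof. exact: transition_val tr. Qed.
Let wkj : (w k < w j)%N. Proof. exact: pivot_desc pv. Qed.
Let jk : (j < k)%N. Proof. exact: pivot_lt pv. Qed.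
Let idL' : left_ideal L'. Proof. exact: left_ideal_colon. Qed.

Let commE (p q : 'I_n) : (p <= q)%N -> q != i -> p != j -> GRing.comm (E p q) (E i j ^+ m i j).
Proof. by move=> pq qi pj; apply/commrX/E_comm; rewrite // 1?ltnW // eq_sym. Qed.

Let L'comm (p q : 'I_n) s t : (p <= q)%N -> q != i -> p != j -> (s <= t)%N ->
  L (E p q ^+ s) -> L' (E p q ^+ t).
Proof.
move=> pq qi pj st Ls; apply: (lidX idL' st); rewrite /colon.
have -> : E p q ^+ s * E i j ^+ m i j = E i j ^+ m i j * E p q ^+ s.
  exact/commr_sym/commrX/commr_sym/commE.
exact: lidM.
Qed.

Let gt_last (p : 'I_n) : (p < j)%N -> (w k < w p)%N -> L (E p j).
Proof. by move=> pj wkp; apply: serre0 => //; apply: (bstat_last_eq0 pv). Qed.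

(** [E i p] is in [L] because [w p < w i], and [[E i p, E p j] = E i j]. Bracketing
    [E p j ^ (m_pj + 1)] with it [m_ij] times splits off the factor [E i j ^ m_ij], and
    [bstat_child_last_gt] bounds the remaining power of [E p j]. *)
Let serre_child_last_gt (p : 'I_n) : (i < p < j)%N -> (w p < w i)%N ->
  L' (E p j ^+ (bstat B w' p j).+1).
Proof.
move=> /andP[ip pj] wpi.
have m1 : (m p j <= bstat B w' p j + m i j)%N by apply: (bstat_child_last_gt pv tr ch); lia.
have m2 : (m i j <= m p j)%N by apply: (bstat_child_le pv tr ch).
have Lip : L (E i p) by apply: serre0 => //; apply: (bstat_gt_eq0 pv).
apply: (lidX idL' (a := (m p j).+1 - m i j)); first lia.
have := @lid_ad _ _ L idL charK0 (E i p) (E p j) (E i j) (E_bracket ip pj) _ _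
  0 ((m p j).+1 - m i j) (m i j) Lip; rewrite mul1r add0n subnK; last lia.
rewrite /colon; have cE : GRing.comm (E p j) (E i j) by apply: E_comm; rewrite -?val_eqE /=; lia.
have -> : E p j ^+ ((m p j).+1 - m i j) * E i j ^+ m i j =
    E i j ^+ m i j * E p j ^+ ((m p j).+1 - m i j).
  exact/commrX/commr_sym/commrX/commr_sym.
apply=> //; last exact: serreL.
by apply: E_comm; rewrite -?val_eqE /=; lia.
Qed.

Let serre_child_last (p : 'I_n) : (p < j)%N -> L' (E p j ^+ (bstat B w' p j).+1).
Proof.
move=> pj; have [pi|pi] := eqVneq p i.
  by rewrite {1}pi /colon -exprD; apply: lidX (serreL ij) => //; lia.
have jnei : j != i by rewrite -val_eqE /=; lia.
have pnej : p != j by rewrite -val_eqE /=; lia.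
have [wip|wpi'] := ltnP (w i) (w p).
  apply: (lidX idL' (a := 1)) => //; rewrite expr1.
  have [pli|ilp] := ltnP p i; last first.
    rewrite -[E p j]expr1; apply: (@L'comm _ _ 1) => //; first exact: ltnW.
    rewrite expr1; apply: gt_last => //; have := between (r := p).
    by have := @w_neq p k; move: pi; rewrite -val_eqE /=; lia.
  have Lpi : L (E p i) by apply: serre0 => //; apply: (bstat_gt_eq0 pv).
  (* One bracket with [E p i], which is in [L] as [w i < w p], turns [E i j ^ (m_ij + 1)] into a
     multiple of [E p j * E i j ^ m_ij]. *)
  have := @lid_ad _ _ L idL charK0 (E p i) (E i j) (E p j) (E_bracket pli ij) _ _
    0 (m i j) 1 Lpi; rewrite mul1r add0n expr1 addn1; apply; try exact: serreL;
    by apply: E_comm; rewrite -?val_eqE /=; lia.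
have wpi : (w p < w i)%N by have := @w_neq p i; move: pi; rewrite -val_eqE /=; lia.
have [ilp|pli'] := ltnP i p; first by apply: serre_child_last_gt; rewrite ?ilp.
have pli : (p < i)%N by move: pi; rewrite -val_eqE /=; lia.
pose P (a : 'I_n) := (i < a < j)%N && (w p < w a < w i)%N.
have an a : (i < a < j)%N -> (a < n)%N by have := ltn_ord j; lia.
have [a0 Pa0|Pn] := pickP P; last first.
  have nr a : (i < a < j)%N -> ~~ (w p < w a < w i)%N.
    by move=> iaj; have := Pn (Ordinal (an _ iaj)); rewrite /P /= iaj /= => ->.
  have Hm := bstat_child_last_lt pv tr ch pli wpi nr.
  have yx : E i j * E p i = E p i * E i j + - E p j by rewrite E_bracketN.
  (* The case [c = 0] leaves the factor [E i j ^ m_ij] on the right, as the colon ideal requires. *)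
  have := @lid_heisenberg_mix _ _ L idL charK0 (E i j) (E p i) (- E p j) yx _ _
    (m p i).+1 (m i j) 0 (leq0n _) (serreL ij) (serreL pli).
  rewrite addn0 subn0 exprNn -mulrA => H.
  apply: (lidX idL' (a := (m p i).+1)); first by rewrite ltnS.
  have := lidM idL ((-1) ^+ (m p i).+1) (H _ _); rewrite signrMK; apply;
    by apply/commrN/E_comm; rewrite -?val_eqE /=; lia.
(* Split at the last such [r]: [E p j] is the bracket of [E p r] and [E r j], and the relation for
   [E r j] is known because [r] comes after [i]. *)
case: (@arg_maxnP _ a0 P val Pa0) => r /andP[irj wprpi] rmax.
have nr a : (r < a < j)%N -> ~~ (w p < w a < w i)%N.
  move=> raj; apply/negP => wa; have iaj : (i < a < j)%N by lia.
  by have := rmax (Ordinal (an _ iaj)); rewrite /P /=; lia.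
have Hm : (bstat B w' r j + m p r <= bstat B w' p j)%N.
  apply: (bstat_child_last_add pv tr ch) => //; try lia.
apply: (lidX idL' (a := (bstat B w' r j).+1 + m p r)); first by rewrite addSn ltnS.
apply: (lid_heisenberg idL' charK0 (x := E p r) (y := E r j)).
- by apply: E_bracket; lia.
- by apply: E_comm; rewrite -?val_eqE /=; lia.
- by apply: E_comm; rewrite -?val_eqE /=; lia.
- apply: (@L'comm _ _ (m p r).+1) => //; rewrite -?val_eqE /=; try lia.
  by apply: serreL; lia.
- by apply: serre_child_last_gt; lia.
Qed.

(** Three cases, all with [[E p i, E i j] = E p j]. For [w p < w i] the exponent grows by at least
    [m_ij], enough to move [E i j ^ m_ij] across. For [w k < w p] both [E p i] and [E p j] are in
    [L]. In between, [E p i] is in [L] and [serre_chain] supplies [E p j ^ m_pj]. *)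
Let serre_child_col (p : 'I_n) : (p < i)%N -> L' (E p i ^+ (bstat B w' p i).+1).
Proof.
move=> pli; have pj : (p < j)%N by lia.
have zy : GRing.comm (E p j) (E i j) by apply: E_comm; rewrite -?val_eqE /=; lia.
have xz : GRing.comm (E p i) (E p j) by apply: E_comm; rewrite -?val_eqE /=; lia.
have yz := commr_sym zy.
have xyE := E_bracket pli ij.
have [wip|wpi'] := ltnP (w i) (w p); last first.
  have wpi : (w p < w i)%N by have := @w_neq p i; lia.
  have Hm := bstat_child_col pv tr ch pli wpi.
  apply: (lidX idL' (a := (m p i).+1 + m i j)); first by rewrite addSn ltnS.
  by apply: (lid_expr_add idL xyE) => //; apply: serreL.
have Lpi : L (E p i) by apply: serre0 => //; apply: (bstat_gt_eq0 pv).
have [wkp|wpk'] := ltnP (w k) (w p).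
  apply: (lidX idL' (a := 1)) => //; rewrite expr1.
  by apply: (lid_mul_expr idL xyE yz) => //; apply: gt_last.
have wpk : (w p < w k)%N by have := @w_neq p k; lia.
(* The transitions [r] that [serre_chain] asks for lie before [i]: by [between], no position after
   [i] and before [j] has its value between [w i] and [w k]. *)
have Lpj : L (E p j ^+ m p j).
  apply: serre_chain => // r trr pr wpr; apply: Ltr => //.
  have := between (r := r); have := transition_lt trr; have := transition_val trr.
  have : (r : nat) <> i by move=> e; move: wpr; rewrite e; lia.
  by lia.
have Hm := bstat_child_mid pv tr ch pli wip wpk.
have mm : (m p j <= m i j)%N.
  by apply: leq_sum => r _; rewrite /bterm; lia.
apply: (lidX idL' (a := m p j)) => //; rewrite /colon.
have := @lid_ad_expr _ _ L idL (E p i) (E i j) (E p j) xyE xz yz (m p j) 0 (m i j - m p j) Lpi.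
rewrite mul1r add0n subnK //; apply.
have -> : E p j ^+ m p j * E i j ^+ (m i j - m p j) = E i j ^+ (m i j - m p j) * E p j ^+ m p j.
  exact/commrX/commr_sym/commrX/commr_sym.
exact: lidM.
Qed.

(** [E q j] is in [L], and [[E q j, E i q] = - E i j]: bracketing [E i q ^ (m_iq + 1)] with it
    [m_ij] times splits off [E i j ^ m_ij], up to a nonzero scalar. *)
Let serre_child_row (q : 'I_n) : (i < q < j)%N -> (w k < w q)%N ->
  L' (E i q ^+ (bstat B w' i q).+1).
Proof.
move=> iqj wkq; have [iq qj] : (i < q)%N /\ (q < j)%N by lia.
have Lqj : L (E q j) by apply: gt_last.
have m1 := bstat_child_row pv tr ch iqj wkq.
have m2 := bstat_child_row_le pv tr ch iqj wkq.
apply: (lidX idL' (a := (m i q).+1 - m i j)); first lia.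
have cE : GRing.comm (E i q) (E i j) by apply: E_comm; rewrite -?val_eqE /=; lia.
have yx : E q j * E i q = E i q * E q j + - E i j by rewrite E_bracketN.
have cZ : GRing.comm (E q j) (E i j) by apply: E_comm; rewrite -?val_eqE /=; lia.
have := @lid_ad _ _ L idL charK0 (E q j) (E i q) (- E i j) yx (commrN cZ) (commrN cE)
  0 ((m i q).+1 - m i j) (m i j) Lqj; rewrite mul1r add0n subnK; last lia.
move=> /(_ (serreL iq)); rewrite exprNn -mulrA => /(lidM idL ((-1) ^+ m i j)).
rewrite signrMK /colon.
have -> : E i j ^+ m i j * E i q ^+ ((m i q).+1 - m i j) =
    E i q ^+ ((m i q).+1 - m i j) * E i j ^+ m i j.
  exact/commrX/commr_sym/commrX.
by [].
Qed.

(** Here [m_pq] may drop although [E p q] commutes with [E i j], so the relation is rebuilt from the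
    square with rows [p], [i] and columns [q], [j]: [lid_two_by_two] with [A = m_iq - m_ij],
    [B = m_pj] and [m = m_ij]. *)
Let serre_child_corner (p q : 'I_n) : (p < i)%N -> (i < q < j)%N ->
    (w i < w p)%N -> (w p < w k)%N -> (w k < w q)%N ->
  L' (E p q ^+ (bstat B w' p q).+1).
Proof.
move=> pi iqj wip wpk wkq; have [iq qj] : (i < q)%N /\ (q < j)%N by lia.
have pq : (p < q)%N by lia.
have pj : (p < j)%N by lia.
have Lpi : L (E p i) by apply: serre0 => //; apply: (bstat_gt_eq0 pv).
have Lqj : L (E q j) by apply: gt_last.
have Lpj : L (E p j ^+ m p j).
  apply: serre_chain => // r trr pr wpr; apply: Ltr => //.
  have := between (r := r); have := transition_lt trr; have := transition_val trr.
  have : (r : nat) <> i by move=> e; move: wpr; rewrite e; lia.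
  by lia.
have m1 := bstat_child_corner pv tr ch pi iqj wip wpk wkq.
have m2 := bstat_child_row_le pv tr ch iqj wkq.
have m3 : (m p j <= m i j)%N.
  by apply: leq_sum => r _; rewrite /bterm; lia.
have m4 := bstat_trans_gt0 pv pj wpk.
apply: (lidX idL' (a := (m i q - m i j) + m p j)); first lia.
apply: (@lid_two_by_two _ _ L idL charK0 (E p i) (E q j) _ (E i q) (E p j));
  rewrite ?m4 ?m3 ?subnK //.
all: try (by apply: E_comm; rewrite -?val_eqE /=; lia).
- exact: E_bracket.
- exact: E_bracket.
- exact: E_bracketN.
- exact: serreL.
Qed.

(** If [E p q] commutes with [E i j] and the exponent does not drop, its relation passes to the
    colon ideal. What remains is [p = j], the columns [i] and [j], the row [i] for [w k < w q], and
    the corner. *)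
Lemma serre_child : serre (bstat B w') L'.
Proof.
move=> p q pq; have [jq|qj] := ltnP j q.
  apply: (lidX idL' (a := 1)) => //; rewrite expr1.
  have Lpq : L (E p q) by apply: serre0 => //; apply: (bstat_inc_eq0 pv).
  have [pj|pj] := eqVneq p j; last first.
    by rewrite -[E p q]expr1; apply: (@L'comm _ _ 1) => //; rewrite -?val_eqE /=; lia.
  rewrite pj in pq Lpq *; have Liq : L (E i q).
    by apply: serre0; [lia | apply: (bstat_inc_eq0 pv)].
  apply: (@lid_mul_expr _ _ L idL (E j q) (E i j) (- E i q)) => //.
  - exact: E_bracketN.
  - by apply/commrN/E_comm; rewrite -?val_eqE /=; lia.
  - exact: lidN.
have [jq|qj'] := leqP j q.
  have qE : q = j by apply: val_inj; rewrite /=; lia.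
  by rewrite qE in pq *; apply: serre_child_last.
have [qi|qi] := eqVneq q i; first by rewrite qi in pq *; apply: serre_child_col.
have pj : p != j by rewrite -val_eqE /=; lia.
have [pi|pi] := eqVneq p i.
  rewrite pi in pq pj *; have [wkq|wqk] := ltnP (w k) (w q).
    by apply: serre_child_row => //; lia.
  apply: (lidX idL' (a := 1)) => //.
  apply: (@L'comm _ _ 1) => //; first lia.
  rewrite expr1; apply: serre0 => //; apply: (bstat_gt_eq0 pv).
  by have := between (r := q); have := @w_neq q k; have := @w_neq q i; lia.
have [qlti|iltq] := ltnP q i.
  apply: L'comm (serreL pq) => //; first lia.
  by rewrite ltnS; apply: (bstat_child_off_lt pv tr ch).
have iqj : (i < q < j)%N by move: qi; rewrite -val_eqE /=; lia.
have [bad|good] := boolP ((w i < w p < w k)%N && (w k < w q)%N).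
  apply: serre_child_corner; try lia.
  by have := between (r := p); move: pi; rewrite -val_eqE /=; lia.
apply: L'comm (serreL pq) => //; first lia.
rewrite ltnS; apply: (bstat_child_off_mid pv tr ch) => //.
  by move=> e; move/eqP: pi; apply; apply: val_inj.
by have := @w_neq q k; move: good; lia.
Qed.

End SerreChild.
End Serre.

(** * The Fock space *)

Section Fock.
Variables (K : fieldType) (n B : nat).
Local Notation mode := ('I_n * 'I_B)%type.

Definition fock := {ffun {set mode} -> K^o}.
HB.instance Definition _ := GRing.Lmodule.on fock.

Implicit Types (x y z t : mode) (S : {set mode}) (F : fock).

(* Modes are ordered factor by factor, so that an operator preserving the
   factors acts with the signs of the exterior power of a single factor. *)
Definition rank (z : mode) : nat := z.2 * n + z.1.

Lemma rank_inj : injective rank.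
Proof.
move=> [p c] [q d] /= e.
have cd : c = d :> nat.
  by have := congr1 (divn^~ n) e; rewrite !divnMDl ?divn_small ?addn0 //; case: n p {q e} => // -[].
by congr (_, _); apply: val_inj => //=; move: e; rewrite /rank /= cd => /addnI.
Qed.

(** The Jordan-Wigner sign: the cost of moving [z] past the modes of [S] of smaller rank. *)
Definition sg (z : mode) (S : {set mode}) : K :=
  (-1) ^+ #|[set y in S | (rank y < rank z)%N]|.

Lemma sgM z S : sg z S * sg z S = 1.
Proof. by rewrite /sg -expr2 sqrr_sign. Qed.

Lemma sgD1 z y S : y \in S -> sg z S = (-1) ^+ (rank y < rank z)%N * sg z (S :\ y).
Proof.
move=> yS; rewrite /sg -exprD (cardsD1 y) inE yS /=; congr (_ ^+ (_ + #|pred_of_set _|)).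
by apply/setP => x; rewrite !inE andbA.
Qed.

Lemma sgU1 z y S : y \notin S -> sg z (y |: S) = (-1) ^+ (rank y < rank z)%N * sg z S.
Proof. by move=> yS; rewrite (sgD1 _ (setU11 y S)) setU1K. Qed.

Lemma sg_swap y z : y != z ->
  (-1) ^+ (rank y < rank z)%N = - (-1) ^+ (rank z < rank y)%N :> K.
Proof.
move=> yz; have : rank y != rank z by rewrite (inj_eq rank_inj).
by case: ltngtP => // _ _; rewrite ?opprK ?expr1 ?expr0.
Qed.

(** Creation and annihilation of a particle in mode [z]. They are given on coordinates, so that
    creation removes the mode from the index; [cr_delta] and [an_delta] describe them on basis
    vectors. *)
Definition cr (z : mode) (F : fock) : fock :=
  [ffun S : {set mode} => if z \in S then sg z S * F (S :\ z) else 0].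

Definition an (z : mode) (F : fock) : fock :=
  [ffun S : {set mode} => if z \in S then 0 else sg z S * F (z |: S)].

Lemma cr_linear z : linear (cr z).
Proof.
move=> a F G; apply/ffunP => S; rewrite !ffunE; case: ifP => _.
  by rewrite mulrDr; congr (_ + _); rewrite /GRing.scale /= mulrCA.
by rewrite scaler0 addr0.
Qed.
HB.instance Definition _ z := GRing.isLinear.Build K fock fock _ (cr z) (cr_linear z).

Lemma an_linear z : linear (an z).
Proof.
move=> a F G; apply/ffunP => S; rewrite !ffunE; case: ifP => _.
  by rewrite scaler0 addr0.
by rewrite mulrDr; congr (_ + _); rewrite /GRing.scale /= mulrCA.
Qed.
HB.instance Definition _ z := GRing.isLinear.Build K fock fock _ (an z) (an_linear z).

(** Together with [an_an] and [an_cr], these are the canonical anticommutation relations. *)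
Lemma cr_cr z y F : cr z (cr y F) = - cr y (cr z F).
Proof.
apply/ffunP => S; rewrite !ffunE !inE.
have [->|zy] := eqVneq z y; first by rewrite /= mulr0; case: ifP; rewrite oppr0.
rewrite /=; have [zS|zS] := boolP (z \in S); have [yS|yS] := boolP (y \in S);
  rewrite ?mulr0 ?oppr0 //.
rewrite (sgD1 y zS) (sgD1 z yS) (sg_swap zy) setDDl setUC -setDDl; ring.
Qed.

Lemma an_an z y F : an z (an y F) = - an y (an z F).
Proof.
apply/ffunP => S; rewrite !ffunE !inE.
have [->|zy] := eqVneq z y; first by rewrite /= mulr0; case: ifP; rewrite oppr0.
rewrite /=; have [zS|zS] := boolP (z \in S); have [yS|yS] := boolP (y \in S);
  rewrite ?mulr0 ?oppr0 //.
rewrite (sgU1 y zS) (sgU1 z yS) (sg_swap zy) setUCA; ring.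
Qed.

Lemma an_cr z y F : an z (cr y F) = (if z == y then F else 0) - cr y (an z F).
Proof.
apply/ffunP => S; rewrite !ffunE !inE.
have [->|zy] := eqVneq z y.
  rewrite /=; have [yS|yS] := boolP (y \in S).
    by rewrite (sgD1 y yS) ltnn expr0 mul1r mulrA sgM mul1r setD1K // subrr.
  by rewrite (sgU1 y yS) ltnn expr0 mul1r mulrA sgM mul1r setU1K // subr0.
rewrite ffunE add0r /=. 
have [zS|zS] := boolP (z \in S); have [yS|yS] := boolP (y \in S);
  rewrite ?mulr0 ?oppr0 //.
have -> : (z |: S) :\ y = z |: (S :\ y).
  by apply/setP => u; rewrite !inE; case: (eqVneq u y) => // ->; rewrite eq_sym (negPf zy).
by rewrite (sgU1 y zS) (sgD1 z yS) (sg_swap zy); case: ltnP => _ /=; ring.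
Qed.

(** A matrix unit of the Lie algebra [gl] of the space spanned by the modes: a particle goes from
    [y] to [x]. *)
Definition hop x y F : fock := cr x (an y F).
HB.instance Definition _ x y := GRing.Linear.copy (hop x y) (cr x \o an y).

Lemma hop_hop x y z t F : hop x y (hop z t F) - hop z t (hop x y F) =
  (if y == z then hop x t F else 0) - (if x == t then hop z y F else 0).
Proof.
have E : cr z (cr x (an t (an y F))) = cr x (cr z (an y (an t F))).
  by rewrite an_an !linearN /= cr_cr opprK.
rewrite /hop !an_cr !linearB /= E opprK addrACA addNr addr0 (eq_sym t x).
by case: (y == z); case: (x == t); rewrite ?linear0.
Qed.

Lemma hop_comm x y z t F : y != z -> x != t -> hop x y (hop z t F) = hop z t (hop x y F).
Proof.
by move=> /negPf yz /negPf xt; apply/eqP; rewrite -subr_eq0 hop_hop yz xt subrr.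
Qed.

Lemma hop_hop0 x y F : x != y -> hop x y (hop x y F) = 0.
Proof.
have cr2 G : cr x (cr x G) = 0.
  by apply/ffunP => S; rewrite !ffunE !inE eqxx /= mulr0 if_same.
by move=> xy; rewrite /hop an_cr eq_sym (negPf xy) add0r linearN /= cr2 oppr0.
Qed.

Lemma an_hop x y z F :
  an z (hop x y F) = hop x y (an z F) + (if z == x then an y F else 0).
Proof. by rewrite /hop an_cr (an_an y) linearN /= addrC. Qed.

Definition delta S : fock := [ffun T => (T == S)%:R].

Lemma an_delta z S : an z (delta S) = if z \in S then sg z S *: delta (S :\ z) else 0.
Proof.
apply/ffunP => T; rewrite !ffunE; have [zT|zT] := boolP (z \in T).
  case: ifP => // _; rewrite ?ffunE //.
  by case: eqP => [e|]; rewrite ?scaler0 //; move: zT; rewrite e !inE eqxx.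
have [<-|ne] := eqVneq (z |: T) S.
  rewrite setU11 !ffunE setU1K // eqxx.
  by rewrite (sgU1 z zT) ltnn expr0 mul1r.
rewrite mulr0; case: ifP => zS; rewrite !ffunE //.
case: eqP => [e|_]; last by rewrite scaler0.
by move: ne; rewrite e setD1K // eqxx.
Qed.

Lemma cr_delta z S : cr z (delta S) = if z \in S then 0 else sg z S *: delta (z |: S).
Proof.
apply/ffunP => T; rewrite !ffunE; have [zT|zT] := boolP (z \in T); last first.
  case: ifP => zS; rewrite !ffunE //; case: eqP => [e|_]; last by rewrite scaler0.
  by move: zT; rewrite e setU11.
have [<-|ne] := eqVneq (T :\ z) S.
  by rewrite setD11 !ffunE setD1K // eqxx (sgD1 z zT) ltnn expr0 mul1r.
rewrite mulr0; case: ifP => zS; rewrite !ffunE //.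
case: eqP => [e|_]; last by rewrite scaler0.
by move: ne; rewrite e setU1K ?zS ?eqxx.
Qed.

Lemma hop_delta x y S : x != y ->
  exists2 e : K, e != 0 & hop x y (delta S) =
    if (y \in S) && (x \notin S) then e *: delta (x |: (S :\ y)) else 0.
Proof.
have sg0 z T : sg z T != 0 by rewrite signr_eq0.
move=> xy; exists (sg y S * sg x (S :\ y)); first by rewrite mulf_neq0.
rewrite /hop an_delta; case: ifP => yS; last by rewrite linear0.
by rewrite linearZ /= cr_delta !inE xy /=; case: ifP; rewrite ?scaler0 ?scalerA.
Qed.

Lemma delta_neq0 S : delta S != 0.
Proof. by apply/eqP => /ffunP/(_ S); rewrite !ffunE eqxx => /eqP; rewrite oner_eq0. Qed.

(** The matrix unit [e_pq] acting on all factors at once; [colmove] is its counterpart on the factor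
    labels. *)
Definition gl (p q : 'I_n) F : fock := \sum_(c : 'I_B) hop (p, c) (q, c) F.

Lemma gl_linear p q : linear (gl p q).
Proof.
move=> a F G; rewrite /gl scaler_sumr -big_split; apply: eq_bigr => c _.
by rewrite linearP.
Qed.
HB.instance Definition _ p q := GRing.isLinear.Build K fock fock _ (gl p q) (gl_linear p q).

Lemma gl_gl p q r s F : gl p q (gl r s F) - gl r s (gl p q F) =
  (if q == r then gl p s F else 0) - (if p == s then gl r q F else 0).
Proof.
rewrite /gl; under eq_bigr do rewrite linear_sum.
under [X in _ - X]eq_bigr do rewrite linear_sum.
rewrite [X in _ - X]exchange_big -sumrB.
under eq_bigr => c _.
  rewrite -sumrB; under eq_bigr => d _ do rewrite hop_hop !xpair_eqE.
  rewrite sumrB.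
  rewrite (bigD1 c) //= eqxx andbT big1 ?addr0; last first.
    by move=> d /negPf dc; rewrite (eq_sym c) dc andbF.
  rewrite [X in _ - X](bigD1 c) //= eqxx andbT big1 ?addr0; last first.
    by move=> d /negPf dc; rewrite (eq_sym c) dc andbF.
  over.
by rewrite sumrB; case: eqP => _; case: eqP => _; rewrite ?big1_eq.
Qed.

Lemma an_gl z p q F :
  an z (gl p q F) = gl p q (an z F) + (if z.1 == p then an (q, z.2) F else 0).
Proof.
rewrite /gl (linear_sum (an z)); rewrite (eq_bigr (fun c => hop (p, c) (q, c) (an z F) +
  (if z == (p, c) then an (q, c) F else 0))) => [|c _]; last exact: an_hop.
rewrite big_split; congr (_ + _); case: z => y d /=.
rewrite (bigD1 d) //= big1 ?addr0 => [|c cd]; last first.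
  by rewrite xpair_eqE (eq_sym d) (negPf cd) andbF.
by rewrite xpair_eqE eqxx andbT.
Qed.

Definition colmove (x y : 'I_B) F : fock := \sum_(p : 'I_n) hop (p, x) (p, y) F.

Lemma colmove_linear (x y : 'I_B) : linear (colmove x y).
Proof.
move=> a F G; rewrite /colmove scaler_sumr -big_split; apply: eq_bigr => c _.
by rewrite linearP.
Qed.
HB.instance Definition _ (x y : 'I_B) :=
  GRing.isLinear.Build K fock fock _ (colmove x y) (colmove_linear x y).

(** The actions of [gl_n] on rows and of [gl_B] on factors commute: in the double sum of commutators
    only [r = q] and [r = p] survive, and the remainders cancel after summation over the factors. *)
Lemma gl_colmove p q (x y : 'I_B) F : gl p q (colmove x y F) = colmove x y (gl p q F).
Proof.
apply/eqP; rewrite -subr_eq0 /gl /colmove; under eq_bigr do rewrite linear_sum.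
under [X in _ - X]eq_bigr do rewrite linear_sum.
rewrite [X in _ - X]exchange_big -sumrB.
under eq_bigr => c _.
  rewrite -sumrB; under eq_bigr => r _ do rewrite hop_hop !xpair_eqE.
  rewrite sumrB.
  rewrite (bigD1 q) //= eqxx andTb big1 ?addr0; last first.
    by move=> r /negPf rq; rewrite (eq_sym q) rq.
  rewrite [X in _ - X](bigD1 p) //= eqxx andTb big1 ?addr0; last first.
    by move=> r /negPf rp; rewrite (eq_sym p) rp.
  over.
rewrite sumrB (bigD1 x) //= eqxx big1 ?addr0 => [|c /negPf-> //].
by rewrite (bigD1 y) //= eqxx big1 ?addr0 ?subrr // => c /negPf->.
Qed.

End Fock.

(** * Powers of sums of commuting square-zero operators *)

Section CommutingNilpotents.
Variables (K : fieldType) (V : lmodType K) (T : finType) (o : T -> {linear V -> V}).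
Hypothesis o_comm : forall t u v, o t (o u v) = o u (o t v).
Hypothesis o_sq : forall t v, o t (o t v) = 0.
Local Notation O := (fun v => \sum_t o t v).
Local Notation prodo := (foldr (fun t => o t)).

Lemma prodo_comm t v s : prodo (o t v) s = o t (prodo v s).
Proof. by elim: s => //= u s ->; rewrite o_comm. Qed.

Lemma prodo_perm v s1 s2 : perm_eq s1 s2 -> prodo v s1 = prodo v s2.
Proof.
elim: s1 s2 => [|t s1 IH] s2; first by rewrite perm_sym => /perm_nilP->.
move=> s12; have ts2 : t \in s2 by rewrite -(perm_mem s12) mem_head.
rewrite /= (IH (rem t s2)); last first.
  by rewrite -(perm_cons t); apply: perm_trans s12 (perm_to_rem ts2).
elim: s2 ts2 {s12 IH} => //= u s2 IH; rewrite inE.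
by have [->|ut] //= := eqVneq u t => /IH <-; rewrite o_comm.
Qed.

Lemma iterO_sum m I (r : seq I) (F : I -> V) :
  iter m O (\sum_(i <- r) F i) = \sum_(i <- r) iter m O (F i).
Proof.
elim: m => //= m ->; rewrite exchange_big; apply: eq_bigr => t _; exact: linear_sum.
Qed.

(** The power expands into words in [s]. Since the operators commute and square to zero, only the
    [(size s)!] arrangements of [s] survive. *)
Lemma iterO s v : uniq s -> (forall t, t \notin s -> o t v = 0) ->
  iter (size s) O v = (size s)`!%:R *: prodo v s.
Proof.
move: {2}(size s) (erefl (size s)) => m; elim: m s v => [|m IHm] s v sm us sv.
  by rewrite sm (size0nil sm) /= scale1r.
rewrite sm iterSr (bigID (mem s)) /= [X in _ + X]big1 ?addr0 => [|t ts]; last exact: sv.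
rewrite -big_uniq //= iterO_sum.
have step t : t \in s -> iter m O (o t v) = (m`!)%:R *: prodo v s.
  move=> ts; have srem : size (rem t s) = m by rewrite size_rem // sm.
  rewrite -{1}srem (IHm (rem t s)) ?rem_uniq // => [|u].
    rewrite srem prodo_comm; congr (_ *: _).
    by rewrite [RHS](prodo_perm _ (perm_to_rem ts)).
  rewrite mem_rem_uniq // inE negb_and negbK => /orP[/eqP->|us']; first exact: o_sq.
  by rewrite o_comm sv // linear0.
rewrite big_seq (eq_bigr _ step) -big_seq big_const_seq count_predT sm iter_addr_0.
by rewrite -scaler_nat scalerA -natrM -factS.
Qed.

Lemma iterO0 s v : uniq s -> (forall t, t \notin s -> o t v = 0) ->
  iter (size s).+1 O v = 0.
Proof.
move=> us sv; rewrite iterS iterO //; apply: big1 => t _; rewrite linearZ /=.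
have prodo0 r : prodo 0 r = 0 by elim: r => //= u r ->; rewrite linear0.
have [ts|ts] := boolP (t \in s); last by rewrite -prodo_comm sv // prodo0 scaler0.
by rewrite (prodo_perm _ (perm_to_rem ts)) /= o_sq scaler0.
Qed.

End CommutingNilpotents.

Section Hops.
Variables (K : fieldType) (n B : nat) (T : finType).
Hypothesis charK0 : [pchar K] =i pred0.
Variables z z' : T -> ('I_n * 'I_B)%type.
Hypotheses (z_inj : injective z) (z'_inj : injective z').
Hypothesis zz' : forall t u, z t != z' u.
Local Notation O := (fun F : fock K n B => \sum_t hop (z' t) (z t) F).
Implicit Type S : {set 'I_n * 'I_B}.

Definition movable S := [set t | (z t \in S) && (z' t \notin S)].
Definition moved S := [set z' t | t in movable S] :|: (S :\: [set z t | t in movable S]).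

Let ho t : {linear fock K n B -> fock K n B} := hop (z' t) (z t).

Let ho_comm t u F : ho t (ho u F) = ho u (ho t F).
Proof. by rewrite /ho /= hop_comm // eq_sym. Qed.

Let ho_sq t F : ho t (ho t F) = 0.
Proof. by rewrite /ho /= hop_hop0 // eq_sym. Qed.

Let ho_delta0 S t : t \notin enum (movable S) -> ho t (delta K S) = 0.
Proof.
rewrite mem_enum inE /ho /= => tS.
by have [|e _ ->] := @hop_delta K n B (z' t) (z t) S; rewrite 1?eq_sym // (negPf tS).
Qed.

Let prodo_delta S (s : seq T) : uniq s -> {subset s <= movable S} ->
  exists2 e : K, e != 0 & foldr (fun t => ho t) (delta K S) s =
    e *: delta K ([set z' t | t in s] :|: (S :\: [set z t | t in s])).
Proof.
elim: s => [|t s IHs] /=.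
  exists 1; rewrite ?oner_neq0 // scale1r; congr (delta K _).
  apply/setP => y; rewrite !inE; have -> : (y \in [set z' t | t in [::]]) = false.
    by apply/imsetP => -[].
  by have -> : (y \in [set z t | t in [::]]) = false by apply/imsetP => -[].
move=> /andP[ts us] sub; have [|e e0 ->] := IHs us.
  by move=> u us'; apply: sub; rewrite inE us' orbT.
have := sub t (mem_head _ _); rewrite inE => /andP[ztS z'tS].
rewrite linearZ /= /ho /=.
set S' := _ :|: _; have [|d d0 ->] := @hop_delta K n B (z' t) (z t) S'.
  by rewrite eq_sym.
have -> : z t \in S'.
  rewrite !inE ztS andbT; apply/orP; right; apply/imsetP => -[u us' /z_inj e'].
  by rewrite -e' (negPf ts) in us'.
have -> : z' t \notin S'.
  rewrite !inE (negPf z'tS) andbF orbF; apply/imsetP => -[u us' /z'_inj e'].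
  by rewrite -e' (negPf ts) in us'.
exists (e * d); first by rewrite mulf_neq0.
rewrite /= scalerA; congr (_ *: delta K _); apply/setP => y; rewrite !inE.
have mcons (f : T -> ('I_n * 'I_B)%type) :
    (y \in [set f u | u in t :: s]) = (y == f t) || (y \in [set f u | u in s]).
  apply/imsetP/orP => [[u]|[/eqP->|/imsetP[u us' ->]]].
  - by rewrite inE => /orP[/eqP->|us'] ->; [left | right; apply/imsetP; exists u].
  - by exists t; rewrite ?mem_head.
  - by exists u; rewrite // inE us' orbT.
rewrite !mcons; case: eqP => //= _; case: eqP => [->|] //=.
by rewrite orbF; apply/esym/negbTE/imsetP => -[u _ /eqP]; rewrite (negPf (zz' _ _)).
Qed.

(** The hops commute and square to zero, and those not movable kill [delta S]; so this power of
    their sum is a factorial, nonzero in characteristic zero, times the product of the movable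
    ones. *)
Lemma iter_hop S : exists2 e : K, e != 0 &
  iter #|movable S| O (delta K S) = e *: delta K (moved S).
Proof.
have [|e e0 E] := @prodo_delta S (enum (movable S)) (enum_uniq _).
  by move=> t; rewrite mem_enum.
exists ((#|movable S|)`!%:R * e).
  by rewrite mulf_neq0 // ((pcharf0P K).1 charK0) -lt0n fact_gt0.
have := iterO ho_comm ho_sq (enum_uniq _) (@ho_delta0 S).
rewrite -cardE => ->; rewrite E scalerA /moved.
have enumE (f : T -> ('I_n * 'I_B)%type) :
    [set f t | t in enum (movable S)] = [set f t | t in movable S].
  by apply/setP => y; apply/imsetP/imsetP => -[t]; rewrite ?mem_enum => tS ->;
    exists t; rewrite ?mem_enum.
by rewrite !enumE.
Qed.

Lemma iter_hop0 S m : (#|movable S| < m)%N -> iter m O (delta K S) = 0.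
Proof.
move=> lt_m; rewrite -(subnK lt_m) iterD cardE.
rewrite (iterO0 ho_comm ho_sq (enum_uniq _) (@ho_delta0 S)).
by elim: (_ - _)%N => //= k ->; apply: big1 => t _; rewrite linear0.
Qed.

End Hops.

(** * The twisted action of b on the Fock space *)

Section FockRep.
Variables (K : fieldType) (n B : nat) (mu : 'I_n -> K).
Local Notation fock := (fock K n B).
Implicit Types (X Y : 'M[K]_n) (x y : borel K n) (F : fock).

Definition glmx X F : fock := \sum_p \sum_q X p q *: gl p q F.
Definition wtr X : K := \sum_p mu p * X p p.
(** The action of [gl_n] restricted to [b] and tensored with the character with coordinates [mu];
    the contraction in the recursion changes this character. *)
Definition fock_act x F : fock := glmx (bmx x) F + wtr (bmx x) *: F.

Lemma glmx_linl F : linear (glmx^~ F).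
Proof.
move=> a X Y; rewrite /glmx scaler_sumr -big_split; apply: eq_bigr => p _ /=.
rewrite scaler_sumr -big_split; apply: eq_bigr => q _ /=.
by rewrite !mxE scalerDl scalerA.
Qed.

Lemma glmx_linr X : linear (glmx X).
Proof.
move=> a F G; rewrite /glmx scaler_sumr -big_split; apply: eq_bigr => p _ /=.
rewrite scaler_sumr -big_split; apply: eq_bigr => q _ /=.
by rewrite linearP scalerDr !scalerA mulrC.
Qed.
HB.instance Definition _ X := GRing.isLinear.Build K fock fock _ (glmx X) (glmx_linr X).

Lemma an_glmx (z : 'I_n * 'I_B) X F :
  an z (glmx X F) = glmx X (an z F) + \sum_q X z.1 q *: an (q, z.2) F.
Proof.
rewrite /glmx (linear_sum (an z)) (bigD1 z.1) //= [in RHS](bigD1 z.1) //= addrAC; congr (_ + _).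
  rewrite (linear_sum (an z)) -big_split; apply: eq_bigr => q _ /=.
  by rewrite linearZ /= an_gl eqxx scalerDr.
apply: eq_bigr => p pz; rewrite (linear_sum (an z)); apply: eq_bigr => q _ /=.
by rewrite linearZ /= an_gl eq_sym (negPf pz) addr0.
Qed.

Lemma wtr_lin a X Y : wtr (a *: X + Y) = a * wtr X + wtr Y.
Proof.
rewrite /wtr mulr_sumr -big_split; apply: eq_bigr => p _ /=.
by rewrite !mxE mulrDr mulrCA.
Qed.

Lemma glmx_mul X Y F :
  glmx X (glmx Y F) - glmx Y (glmx X F) = glmx (X *m Y - Y *m X) F.
Proof.
have E (Z W : 'M[K]_n) : glmx Z (glmx W F) =
    \sum_p \sum_q \sum_r \sum_s (Z p q * W r s) *: gl p q (gl r s F).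
  rewrite /glmx; apply: eq_bigr => p _; apply: eq_bigr => q _.
  rewrite (linear_sum (gl p q)) scaler_sumr; apply: eq_bigr => r _ /=.
  rewrite (linear_sum (gl p q)) scaler_sumr; apply: eq_bigr => s _ /=.
  by rewrite linearZ /= scalerA.
have -> : glmx Y (glmx X F) =
    \sum_p \sum_q \sum_r \sum_s (X p q * Y r s) *: gl r s (gl p q F).
  rewrite E (eq_bigr (fun p => \sum_r \sum_q \sum_s
    (X r s * Y p q) *: gl p q (gl r s F))); last first.
    move=> p _; rewrite exchange_big; apply: eq_bigr => q _; apply: eq_bigr => r _.
    by apply: eq_bigr => s _; rewrite mulrC.
  rewrite exchange_big; apply: eq_bigr => p _ /=.
  rewrite (eq_bigr (fun q => \sum_s \sum_r (X p s * Y q r) *: gl q r (gl p s F))).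
    by rewrite exchange_big; apply: eq_bigr.
  by move=> q _; rewrite exchange_big.
rewrite E -sumrB.
transitivity (\sum_p \sum_q \sum_r \sum_s (X p q * Y r s) *:
   ((if q == r then gl p s F else 0) - (if p == s then gl r q F else 0))).
  apply: eq_bigr => p _; rewrite -sumrB; apply: eq_bigr => q _; rewrite -sumrB.
  by apply: eq_bigr => r _; rewrite -sumrB; apply: eq_bigr => s _; rewrite -scalerBr gl_gl.
have -> : glmx (X *m Y - Y *m X) F = glmx (X *m Y) F - glmx (Y *m X) F.
  by rewrite addrC -scaleN1r glmx_linl scaleN1r addrC.
rewrite (eq_bigr (fun p => \sum_q \sum_r \sum_s (X p q * Y r s) *: (if q == r then gl p s F else 0)
  - \sum_q \sum_r \sum_s (X p q * Y r s) *: (if p == s then gl r q F else 0))); last first.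
  move=> p _; rewrite -sumrB; apply: eq_bigr => q _; rewrite -sumrB.
  by apply: eq_bigr => r _; rewrite -sumrB; apply: eq_bigr => s _; rewrite scalerBr.
rewrite sumrB; congr (_ - _).
  apply: eq_bigr => p _.
  rewrite (eq_bigr (fun q => \sum_s (X p q * Y q s) *: gl p s F)) => [|q _]; last first.
    rewrite (bigD1 q) //= eqxx [X in _ + X]big1 ?addr0 // => r /negPf qr.
    by rewrite big1 // => s _; rewrite eq_sym qr scaler0.
  by rewrite exchange_big; apply: eq_bigr => s _ /=; rewrite mxE scaler_suml.
rewrite (eq_bigr (fun p => \sum_q \sum_r (X p q * Y r p) *: gl r q F)); last first.
  move=> p _; apply: eq_bigr => q _; apply: eq_bigr => r _.
  by rewrite (bigD1 p) //= eqxx big1 ?addr0 // => s /negPf ps; rewrite eq_sym ps scaler0.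
rewrite (eq_bigr (fun p => \sum_r \sum_q (X p q * Y r p) *: gl r q F)); last first.
  by move=> p _; rewrite exchange_big.
rewrite exchange_big; apply: eq_bigr => r _ /=; rewrite exchange_big; apply: eq_bigr => q _ /=.
by rewrite mxE scaler_suml; apply: eq_bigr => p _; rewrite mulrC.
Qed.

(** The diagonal of a product of upper triangular matrices is the product of the diagonals, so [wtr]
    is a character of [b]. *)
Lemma wtr_lie x y : wtr (bmx x *m bmx y - bmx y *m bmx x) = 0.
Proof.
have diagM (z t : borel K n) p : (bmx z *m bmx t) p p = bmx z p p * bmx t p p.
  rewrite mxE (bigD1 p) //= big1 ?addr0 // => q qp.
  have [pq|pq] := ltnP p q.
    by rewrite [bmx t q p](upper_trigP _ (bmxP t)) ?mulr0.
  rewrite [bmx z p q](upper_trigP _ (bmxP z)) ?mul0r //.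
  by rewrite ltn_neqAle pq andbT.
apply: big1 => p _; have -> : (bmx x *m bmx y - bmx y *m bmx x) p p =
    (bmx x *m bmx y) p p - (bmx y *m bmx x) p p by rewrite [LHS]mxE [in X in _ + X]mxE.
by rewrite !diagM [in X in _ - X]mulrC subrr mulr0.
Qed.

Fact fock_act_linl F : linear (fock_act^~ F).
Proof.
move=> a x y; rewrite /fock_act glmx_linl wtr_lin scalerDl scalerDr scalerA.
by rewrite addrACA.
Qed.

Fact fock_act_linr x : linear (fock_act x).
Proof.
move=> a F G; rewrite /fock_act linearP /= scalerDr scalerDr !scalerA mulrC.
by rewrite addrACA.
Qed.
HB.instance Definition _ x := GRing.isLinear.Build K fock fock _ (fock_act x) (fock_act_linr x).

Fact fock_act_lie x y F :
  fock_act (lie x y) F = fock_act x (fock_act y F) - fock_act y (fock_act x F).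
Proof.
rewrite /fock_act -[bmx (lie x y)]/(bmx x *m bmx y - bmx y *m bmx x) wtr_lie scale0r addr0.
have Z (a a' b c d : fock) : a - a' = (a + b + (c + d)) - (a' + c + (b + d)).
  have -> : a + b + (c + d) = a + (b + c + d) by rewrite -!addrA.
  have -> : a' + c + (b + d) = a' + (b + c + d) by rewrite -!addrA (addrCA c).
  by rewrite opprD addrACA subrr addr0.
have L X G c : glmx X (G + c *: F) = glmx X G + c *: glmx X F.
  by rewrite linearD linearZ.
by rewrite -glmx_mul !L !scalerDr !scalerA [wtr (bmx y) * _]mulrC -Z.
Qed.

Definition fock_rep : lie_rep (borel K n) fock :=
  LieRep fock_act_linl fock_act_linr fock_act_lie.

End FockRep.

(** * Actions of the enveloping algebra *)

Section UenvAction.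
Variables (K : fieldType) (L : lieAlgType K).
Local Notation U := (Uenv L).

Section OneRep.
Variables (V : lmodType K) (rho : lie_rep L V).

Definition uact (f : U) (v : V) : V := @rep_scale K L V rho f v.

Lemma uact_pi t v : uact (Upi t) v = ueval rho t v.
Proof. exact: rep_scaleE. Qed.
Lemma uact_in x v : uact (Uin x) v = rho x v.
Proof. exact: uact_pi. Qed.
Lemma uactD f g v : uact (f + g) v = uact f v + uact g v.
Proof. exact: rep_scaleDl. Qed.
Lemma uactM f g v : uact (f * g) v = uact f (uact g v).
Proof. by symmetry; apply: rep_scaleA. Qed.
Lemma uact1 v : uact 1 v = v.
Proof. exact: rep_scale1. Qed.
Lemma uactZ c f v : uact (c *: f) v = c *: uact f v.
Proof. by rewrite -[f]UreprK /GRing.scale /= UscaleE !uact_pi. Qed.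
Lemma uactB f g v : uact (f - g) v = uact f v - uact g v.
Proof. by rewrite -[- g]scaleN1r uactD uactZ scaleN1r. Qed.
Lemma uact0l v : uact 0 v = 0.
Proof. by rewrite -(subrr 0) uactB subrr. Qed.
Lemma uact_linear f : linear (uact f).
Proof. by rewrite -[f]UreprK => a u v; rewrite !uact_pi ueval_linear. Qed.
HB.instance Definition _ f := GRing.isLinear.Build K V V _ (uact f) (uact_linear f).
Lemma uactX f m v : uact (f ^+ m) v = iter m (uact f) v.
Proof. by elim: m => [|m IHm]; rewrite ?uact1 // exprS uactM IHm. Qed.

Lemma left_ideal_ann v : left_ideal (fun f => uact f v = 0).
Proof.
split=> [|f g f0 g0|f g g0]; first exact: uact0l.
  by rewrite uactD f0 g0 addr0.
by rewrite uactM g0 linear0.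
Qed.

End OneRep.

(* [Phi] is only required to be equivariant on the submodule [P]. *)
Lemma uact_equiv (V W : lmodType K) (rho : lie_rep L V) (rho' : lie_rep L W)
    (P : V -> Prop) (Phi : {linear V -> W}) :
    (forall a u v, P u -> P v -> P (a *: u + v)) -> (forall x v, P v -> P (rho x v)) ->
    (forall x v, P v -> Phi (rho x v) = rho' x (Phi v)) ->
  forall f v, P v -> Phi (uact rho f v) = uact rho' f (Phi v).
Proof.
move=> Plin Prho Phirho f v Pv; rewrite -[f]UreprK !uact_pi.
suff [] : P (ueval rho (repr f) v) /\ Phi (ueval rho (repr f) v) = ueval rho' (repr f) (Phi v) by [].
have P0 : P 0 by rewrite -(addNr v) -scaleN1r; apply: Plin.
elim: (repr f) v Pv => [x||| a IHa b IHb | a IHa | a IHa b IHb | c a IHa] v Pv /=.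
- by split; [apply: Prho | apply: Phirho].
- by rewrite linear0.
- by [].
- have [Pa Ea] := IHa v Pv; have [Pb Eb] := IHb v Pv.
  by rewrite linearD Ea Eb -[X in P (X + _)]scale1r; split=> //; apply: Plin.
- have [Pa Ea] := IHa v Pv; rewrite linearN Ea; split=> //.
  by rewrite -scaleN1r -[_ *: _]addr0; apply: Plin.
- by have [Pb <-] := IHb v Pv; apply: IHa.
- have [Pa Ea] := IHa v Pv; rewrite linearZ Ea; split=> //.
  by rewrite -[_ *: _]addr0; apply: Plin.
Qed.

End UenvAction.

(** * Weights and root vectors in the Fock space *)

Section FockWeights.
Variables (K : fieldType) (n B : nat) (charK0 : [pchar K] =i pred0).
Local Notation U := (Uenv (borel K n)).
Local Notation fock := (fock K n B).
Local Notation fact mu := (uact (fock_rep B mu)).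
Implicit Types (S : {set 'I_n * 'I_B}) (F : fock) (mu : 'I_n -> K) (h : borel K n).

Definition rowcard S (p : 'I_n) : nat := \sum_(c : 'I_B) ((p, c) \in S).

Definition weight mu S h : K := \sum_p (mu p + (rowcard S p)%:R) * bmx h p p.

Lemma hop_diag z S : hop z z (delta K S) = if z \in S then delta K S else 0.
Proof.
rewrite /hop an_delta; case: ifP => zS; last by rewrite linear0.
rewrite linearZ /= cr_delta !inE eqxx /= scalerA (sgD1 K z zS) ltnn expr0 mul1r sgM scale1r.
by rewrite setD1K.
Qed.

Lemma fact_diag mu S h : is_diag_mx (bmx h) ->
  fact mu (Uin h) (delta K S) = weight mu S h *: delta K S.
Proof.
move=> /is_diag_mxP dh; rewrite uact_in /= /fock_act /glmx /weight.
under [X in _ = X *: _]eq_bigr do rewrite mulrDl.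
rewrite big_split scalerDl addrC; congr (_ *: _ + _).
rewrite scaler_suml; apply: eq_bigr => p _.
rewrite (bigD1 p) //= big1 ?addr0 => [|q qp]; last first.
  by rewrite dh ?scale0r // eq_sym.
rewrite [_ * bmx h p p]mulrC -scalerA; congr (_ *: _).
rewrite /gl /rowcard natr_sum scaler_suml; apply: eq_bigr => c _.
by rewrite hop_diag; case: ifP => _; rewrite ?scale1r ?scale0r.
Qed.

Lemma fact_E mu (p q : 'I_n) F : (p < q)%N -> fact mu (Uelt K p q) F = gl p q F.
Proof.
move=> pq; rewrite uact_in /= /fock_act /glmx /wtr ebor_val ?(ltnW pq) //.
rewrite [X in X *: _](_ : _ = 0) ?scale0r ?addr0; last first.
  apply: big1 => r _; rewrite mxE; case: eqP => [->|]; rewrite ?mulr0 //.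
  by case: eqP => [e|]; rewrite ?mulr0 //; move: pq; rewrite e ltnn.
rewrite (bigD1 p) //= [X in _ + X]big1 ?addr0 => [|r rp]; last first.
  by apply: big1 => s _; rewrite mxE (negPf rp) scale0r.
rewrite (bigD1 q) //= big1 ?addr0 => [|s sq]; last first.
  by rewrite mxE (negPf sq) andbF scale0r.
by rewrite mxE !eqxx scale1r.
Qed.

Lemma fact_EX mu (p q : 'I_n) m F : (p < q)%N ->
  fact mu (Uelt K p q ^+ m) F = iter m (gl p q) F.
Proof. by move=> pq; rewrite uactX; apply: eq_iter => G; apply: fact_E. Qed.

Lemma Uin_Uelt h (i j : 'I_n) : is_diag_mx (bmx h) -> (i < j)%N ->
  Uin h * Uelt K i j = Uelt K i j * Uin h + (bmx h i i - bmx h j j) *: Uelt K i j.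
Proof.
move=> /is_diag_mxP dh ij; apply/eqP; rewrite addrC -subr_eq -Uin_lie; apply/eqP.
have -> : lie h (ebor K i j) = (bmx h i i - bmx h j j) *: ebor K i j.
  apply: val_inj; rewrite /= ebor_val ?(ltnW ij) //; apply/matrixP => p q; rewrite !mxE.
  rewrite (bigD1 i) //= big1 ?addr0 => [|r ri]; last by rewrite mxE (negPf ri) mulr0.
  rewrite (bigD1 j) //= big1 ?addr0 => [|r rj]; last by rewrite mxE (negPf rj) andbF mul0r.
  rewrite !mxE !eqxx /= andbT.
  have [->|pi] := eqVneq p i; have [->|qj] := eqVneq q j; 
    rewrite ?mulr0 ?mul0r ?mulr1 ?mul1r ?subr0 ?subrr //.
  - by rewrite (dh j q) 1?eq_sym ?subr0.
  - by rewrite (dh p i) ?subr0.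
by have := @Uin_linear K (borel K n) (bmx h i i - bmx h j j) (ebor K i j) 0; rewrite Uin0 !addr0.
Qed.

Lemma Uin_UeltX h (i j : 'I_n) m : is_diag_mx (bmx h) -> (i < j)%N ->
  Uin h * Uelt K i j ^+ m =
  Uelt K i j ^+ m * Uin h + ((bmx h i i - bmx h j j) *+ m) *: Uelt K i j ^+ m.
Proof.
move=> dh ij; have yz : GRing.comm (Uelt K i j) ((bmx h i i - bmx h j j) *: Uelt K i j).
  by rewrite /GRing.comm -scalerAl -scalerAr.
rewrite (mul_expr (Uin_Uelt dh ij) yz) -scalerAl; congr (_ + _).
by case: m => [|m]; rewrite ?mulr0n ?scale0r // -exprS scalerMnl.
Qed.

End FockWeights.

(** * The transition recursion *)

Definition wperm B (w wi : nat -> nat) :=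
  [/\ cancel w wi, cancel wi w & forall r, (B <= r)%N -> w r = r].

Section TransitionPerms.
Variables (B : nat) (w wi : nat -> nat) (j k : nat).
Hypothesis pv : pivot B w wi j k.

Let wK : cancel w wi. Proof. exact (pivot_can pv). Qed.
Let wiK : cancel wi w. Proof. exact (pivot_can_inv pv). Qed.
Let wB : forall r, (B <= r)%N -> w r = r. Proof. exact (pivot_fix pv). Qed.
Let w_inc : forall a b, (j < a)%N -> (a < b)%N -> (w a < w b)%N. Proof. exact (pivot_inc pv). Qed.
Let jk : (j < k)%N. Proof. exact: pivot_lt pv. Qed.
Let kB : (k < B)%N. Proof. exact: trans_lt_bound pv. Qed.
Let w_inj := can_inj wK.

Definition parent_fun r := if r == j then w k else if r == k then w j else w r.
Definition parent_inv x := if x == w k then j else if x == w j then k else wi x.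

Lemma parent_funP : parent w j k parent_fun.
Proof.
split; rewrite /parent_fun ?eqxx //; first by rewrite gtn_eqF.
by move=> r /eqP/negPf-> /eqP/negPf->.
Qed.

Lemma parent_perm : wperm B parent_fun parent_inv.
Proof.
rewrite /parent_fun /parent_inv; split=> r.
- have [->|rj] := eqVneq r j; first by rewrite eqxx.
  have [->|rk] := eqVneq r k; first by rewrite eqxx (inj_eq w_inj) ltn_eqF.
  by rewrite !(inj_eq w_inj) (negPf rj) (negPf rk) wK.
- have [->|rj] := eqVneq r (w k); first by rewrite eqxx.
  have [->|rk] := eqVneq r (w j); first by rewrite eqxx gtn_eqF.
  by rewrite !(can2_eq wiK wK) (negPf rj) (negPf rk) wiK.
- by move=> Br; rewrite !gtn_eqF ?wB //; lia.
Qed.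

Let w_tail r : (j < r)%N -> r <> k ->
  ((r < k)%N /\ (w r < w k)%N) \/ ((k < r)%N /\ (w j < w r)%N).
Proof.
move=> jr rk; have [rlk|kr] := ltnP r k; first by left; rewrite w_inc.
by right; have := pivot_max pv (r := r); lia.
Qed.

(** Inversions are labelled by a position [p] and a value [w r], and the conditional is the position
    of that value in the parent. In this labelling the parent loses the single inversion at position
    [j] with value [w k]. *)
Lemma inversion_parent p r :
  (p < if r == k then j else if r == j then k else r)%N && (w r < parent_fun p)%N =
  inversion w p r && ~~ ((p == j) && (r == k)).
Proof.
have wkj := pivot_desc pv.
rewrite /inversion /parent_fun; have := w_tail (r := r); have := w_tail (r := p).
case: (eqVneq p j) => [->|pj]; [|case: (eqVneq p k) => [->|pk]];
  (case: (eqVneq r k) => [->|rk]; [|case: (eqVneq r j) => [->|rj]]); lia.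
Qed.

Lemma parent_inc a b : (j < a)%N -> (a < b)%N -> (parent_fun a < parent_fun b)%N.
Proof.
move=> ja ab; rewrite /parent_fun (gtn_eqF ja) (gtn_eqF (ltn_trans ja ab)).
have := @w_inc a b ja ab; have wjk := pivot_desc pv; have := @w_inc a k ja.
have := pivot_max pv (r := b).
by case: (eqVneq a k) => [ak|ak]; case: (eqVneq b k) => [bk|bk]; lia.
Qed.

Variable i : nat.
Hypothesis tr : transition w j k i.
Let ij : (i < j)%N. Proof. exact: transition_lt tr. Qed.

Definition child_fun r :=
  if r == i then w k else if r == j then w i else if r == k then w j else w r.
Definition child_inv x :=
  if x == w k then i else if x == w i then j else if x == w j then k else wi x.

Lemma child_funP : child w j k i child_fun.
Proof.
split; rewrite /child_fun ?eqxx //.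
- by rewrite gtn_eqF.
- by rewrite !gtn_eqF //; lia.
- by move=> r /eqP/negPf-> /eqP/negPf-> /eqP/negPf->.
Qed.

Lemma child_perm : wperm B child_fun child_inv.
Proof.
rewrite /child_fun /child_inv; have ik : (i < k)%N by lia.
split=> r.
- have [->|ri] := eqVneq r i; first by rewrite eqxx.
  have [->|rj] := eqVneq r j; first by rewrite eqxx (inj_eq w_inj) ltn_eqF.
  have [->|rk] := eqVneq r k.
    by rewrite eqxx !(inj_eq w_inj) ltn_eqF // gtn_eqF.
  by rewrite !(inj_eq w_inj) (negPf ri) (negPf rj) (negPf rk) wK.
- have [->|rk] := eqVneq r (w k); first by rewrite eqxx.
  have [->|ri] := eqVneq r (w i); first by rewrite eqxx gtn_eqF.
  have [->|rj] := eqVneq r (w j); first by rewrite eqxx !gtn_eqF //; lia.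
  by rewrite !(can2_eq wiK wK) (negPf ri) (negPf rj) (negPf rk) wiK.
- by move=> Br; rewrite !gtn_eqF ?wB //; lia.
Qed.

(** [M] is the set of inversions, labelled by position and value, after all possible moves from row
    [j] to row [i]; [mv'] marks the rows that can then be moved from the factor [w k] to the factor
    [w i]. Both moves together give the inversions of the child. *)
Lemma inversion_child p r (mv := fun q => inversion w j q && ~~ inversion w i q)
    (M := fun p q => (p == i) && mv q || inversion w p q && ~~ ((p == j) && mv q))
    (mv' := fun p => M p k && ~~ M p i) :
  (p < if r == k then i else if r == i then j else if r == j then k else r)%N &&
    (w r < child_fun p)%N = (r == i) && mv' p || M p r && ~~ ((r == k) && mv' p).
Proof.
have wkj := pivot_desc pv; have wik := transition_val tr.
have between := transition_between tr (r := p).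
have neq q q' : q <> q' -> w q <> w q' by move=> qq' /w_inj.
rewrite /mv' /M /mv /inversion /child_fun; have := w_tail (r := r); have := w_tail (r := p).
have := neq p i; have := neq p k; have := neq r i; have := neq r p.
have := transition_between tr (r := r).
case: (eqVneq p i) => [->|pi]; [|case: (eqVneq p j) => [->|pj]; [|case: (eqVneq p k) => [->|pk]]];
  (case: (eqVneq r k) => [->|rk]; [|case: (eqVneq r i) => [->|ri];
     [|case: (eqVneq r j) => [->|rj]]]); lia.
Qed.

(** Rows movable between the two factors after the row move to [i0] are movable after that to [i] as
    well, and [i] is not among them. This makes the comparison strict in [shift_fvec0]. *)
Lemma inversion_child_lt i0 p : transition w j k i0 -> (i0 < i)%N ->
    let mv a q := inversion w j q && ~~ inversion w a q in
    let M a q := (p == a) && mv a q || inversion w p q && ~~ ((p == j) && mv a q) in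
  M i0 k && ~~ M i0 i -> [&& p != i, M i k & ~~ M i i].
Proof.
move=> tr0 i0i mv M; rewrite /M /mv /inversion.
have := pivot_desc pv; have := transition_val tr; have := transition_val tr0.
have := transition_between tr0 (r := i); have := @w_tail p.
have w_neq q q' : q <> q' -> w q <> w q' by move=> qq' /w_inj.
have := w_neq i i0.
case: (eqVneq p i0) => [->|pi0]; [|case: (eqVneq p i) => [->|pi]]; lia.
Qed.

Lemma child_inc a b : (j < a)%N -> (a < b)%N -> (child_fun a < child_fun b)%N.
Proof.
move=> ja ab; have := parent_inc ja ab; rewrite /child_fun /parent_fun.
have jb := ltn_trans ja ab.
by rewrite (gtn_eqF ja) (gtn_eqF jb) (gtn_eqF (ltn_trans ij ja)) (gtn_eqF (ltn_trans ij jb)).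
Qed.

End TransitionPerms.

(** * The annihilator of the Fock vector, by induction along the transition recursion *)

Section Presentation.
Variables (K : fieldType) (n B : nat) (charK0 : [pchar K] =i pred0).
Local Notation U := (Uenv (borel K n)).
Local Notation fock := (fock K n B).
Local Notation fact mu := (uact (fock_rep B mu)).
Local Notation E := (@Uelt K n).
Implicit Types (mu : 'I_n -> K) (w wi : nat -> nat).

(* [(p, c)] says that [u_p] occurs in the factor of the value [c]. *)
Definition invset w wi : {set 'I_n * 'I_B} := [set z : 'I_n * 'I_B | inversion w z.1 (wi z.2)].

Local Notation fvec w wi := (delta K (invset w wi)).

Definition relations mu w wi (L : U -> Prop) :=
  serre E (bstat B w) L /\
  forall h, is_diag_mx (bmx h) -> L (Uin h - (weight mu (invset w wi) h)%:A).

(** The twist [mu] is quantified here because passing to the parent changes it, and the left ideal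
    because the parent and the children are applied to ideals larger than [I_w]. *)
Definition presented w wi := forall mu f, fact mu f (fvec w wi) = 0 ->
  forall L, left_ideal L -> relations mu w wi L -> L f.

Lemma wperm_lt w wi r : wperm B w wi -> (r < B)%N -> (w r < B)%N.
Proof.
case=> wK _ wB rB; rewrite ltnNge; apply/negP => Bw.
by have := wK (w r); rewrite (wB _ Bw) wK; lia.
Qed.

(** In the factor [w r], replacing [u_q] by [u_p] is possible when [(q, r)] is an inversion and
    [(p, r)] is not, that is when [q < r] and [w p < w r < w q]. *)
Lemma card_movable w wi (p q : 'I_n) : wperm B w wi -> (p < q)%N ->
  #|movable (pair q) (pair p) (invset w wi)| = bstat B w p q.
Proof.
move=> ww pq; have [wK wiK wB] := ww.
rewrite -sum1_card big_mkcond /=; pose f (r : 'I_B) := Ordinal (wperm_lt ww (ltn_ord r)).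
have f_inj : injective f.
  by move=> r s [/(can_inj wK)] e; apply: val_inj.
rewrite (reindex_inj f_inj); apply: eq_bigr => r _.
rewrite !inE /= wK /inversion /bterm.
have : (r : nat) <> p -> w r <> w p by move=> rp /(can_inj wK).
have := fun e : (r : nat) = p => congr1 w e.
by case: ifP; lia.
Qed.

Lemma iter_gl w wi (p q : 'I_n) : wperm B w wi -> (p < q)%N -> exists2 e : K, e != 0 &
  iter (bstat B w p q) (gl p q) (fvec w wi) =
    e *: delta K (moved (pair q) (pair p) (invset w wi)).
Proof.
move=> ww pq; rewrite -(card_movable ww pq); apply: iter_hop => //.
- by move=> c d [].
- by move=> c d [].
- by move=> c d; apply/eqP => -[e _]; move: pq; rewrite e ltnn.
Qed.

Lemma iter_gl0 w wi (p q : 'I_n) : wperm B w wi -> (p < q)%N ->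
  iter (bstat B w p q).+1 (gl p q) (fvec w wi) = 0.
Proof.
move=> ww pq; rewrite -(card_movable ww pq); apply: iter_hop0; last by rewrite ltnS.
by move=> c d; apply/eqP => -[e _]; move: pq; rewrite e ltnn.
Qed.

Lemma relations_ann mu w wi : wperm B w wi ->
  relations mu w wi (fun f => fact mu f (fvec w wi) = 0).
Proof.
move=> ww; split=> [p q pq | h dh]; first by rewrite fact_EX // iter_gl0.
by rewrite uactB uactZ uact1 fact_diag // subrr.
Qed.

(* One may intersect [L] with the annihilator of [u_w]. *)
Lemma presentedI w wi : wperm B w wi ->
    (forall mu f, fact mu f (fvec w wi) = 0 -> forall L, left_ideal L ->
       relations mu w wi L -> (forall g, L g -> fact mu g (fvec w wi) = 0) -> L f) ->
  presented w wi.
Proof.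
move=> ww H mu f f0 L idL [sL wL].
have [sA wA] := relations_ann mu ww.
pose L1 g := L g /\ fact mu g (fvec w wi) = 0.
suff [] : L1 f by [].
apply: (H mu) => // [||g []//]; last by split=> [p q pq|h dh]; split; auto.
have [A0 AD AM] := left_ideal_ann (fock_rep B mu) (fvec w wi).
have [L0 LD LM] := idL.
split=> [|a b [La Aa] [Lb Ab]|a b [Lb Ab]]; split; auto.
Qed.

Lemma mem_imset_row (i p : 'I_n) (c : 'I_B) (A : {set 'I_B}) :
  ((p, c) \in [set (i, d) | d in A]) = (p == i) && (c \in A).
Proof.
apply/imsetP/andP => [[d dA [-> ->]]|[/eqP-> cA]]; first by rewrite eqxx.
by exists c.
Qed.

Lemma mem_imset_col (x : 'I_B) (p : 'I_n) (c : 'I_B) (A : {set 'I_n}) :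
  ((p, c) \in [set (q, x) | q in A]) = (c == x) && (p \in A).
Proof.
apply/imsetP/andP => [[d dA [-> ->]]|[/eqP-> cA]]; first by rewrite eqxx.
by exists p.
Qed.

Lemma mem_invset w wi (p : 'I_n) (c : 'I_B) r : wperm B w wi -> c = w r :> nat ->
  ((p, c) \in invset w wi) = inversion w p r.
Proof. by case=> wK _ _ cr; rewrite inE /= cr wK. Qed.

Section Step.
Variables (w wi : nat -> nat) (j : 'I_n) (k : nat).
Hypothesis pv : pivot B w wi j k.

Let wK := pivot_can pv.
Let wiK := pivot_can_inv pv.
Let ww : wperm B w wi. Proof. by split; [exact wK | exact wiK | exact (pivot_fix pv)]. Qed.
Let jk : (j < k)%N. Proof. exact: pivot_lt pv. Qed.
Let kB : (k < B)%N. Proof. exact: trans_lt_bound pv. Qed.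

Let wkj : (w k < w j)%N. Proof. exact: pivot_desc pv. Qed.
Let w_inj := can_inj wK.
Let xk : 'I_B := Ordinal (wperm_lt ww kB).

Let w_tail r : (j < r)%N -> r <> k ->
  ((r < k)%N /\ (w r < w k)%N) \/ ((k < r)%N /\ (w j < w r)%N).
Proof.
move=> jr rk; have [rlk|kr] := ltnP r k; first by left; rewrite (pivot_inc pv).
by right; have := pivot_max pv (r := r); lia.
Qed.

Let w_neq p r : p <> r -> w p <> w r. Proof. by move=> pr /w_inj. Qed.

Lemma invset_parent : invset (parent_fun w j k) (parent_inv w wi j k) = invset w wi :\ (j, xk).
Proof.
apply/setP => -[p c]; rewrite !inE xpair_eqE -!val_eqE /= -[in RHS](wiK c).
have := wiK c; move: (wi c) => r rc; rewrite -rc wK (inj_eq w_inj).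
have -> : inversion (parent_fun w j k) p (parent_inv w wi j k (w r)) =
    (p < if r == k then j : nat else if r == j then k else r)%N && (w r < parent_fun w j k p)%N.
  rewrite /inversion; have [_ -> _] := parent_perm pv.
  by rewrite /parent_inv !(inj_eq w_inj) wK.
by rewrite (inversion_parent pv p r) andbC.
Qed.

Let mem_jk : (j, xk) \in invset w wi.
Proof. by rewrite (mem_invset j ww (r := k)) // /inversion jk. Qed.

Let muj mu : 'I_n -> K := fun p => mu p + (p == j)%:R.

(** The dual of [u_j] is a weight vector for [b] only modulo the duals of [u_q] with [q > j].
    Contraction with it is therefore compared with the action of [b] on tensors whose factor [w k]
    involves no such [u_q]. *)
Let beyond (F : fock) := forall q : 'I_n, (j < q)%N -> an (q, xk) F = 0.

Let beyond_sum (x : borel K n) (p : 'I_n) F : (j <= p)%N -> beyond F ->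
  \sum_q bmx x p q *: an (q, xk) F = (if p == j then bmx x j j *: an (j, xk) F else 0).
Proof.
move=> jp bF; have z (r q : 'I_n) : (j <= r)%N -> r != j \/ q != j -> bmx x r q *: an (q, xk) F = 0.
  move=> jr H; have [qp|pq] := ltnP q r.
    by rewrite [bmx x r q](upper_trigP _ (bmxP x)) ?scale0r.
  rewrite bF ?scaler0 //; case: H; rewrite -val_eqE /=; lia.
case: ifP => [/eqP-> //|/negbT pj]; last by apply: big1 => q _; apply: z => //; left.
rewrite (bigD1 j) //= big1 ?addr0 // => q qj.
by apply: z => //; right.
Qed.

Let beyond_act mu (x : borel K n) F : beyond F -> beyond (fock_act mu x F).
Proof.
move=> bF q jq; rewrite /fock_act linearD linearZ /= an_glmx (bF _ jq) linear0.
rewrite beyond_sum ?(ltnW jq) // scaler0 addr0.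
by rewrite -val_eqE /= (gtn_eqF jq) add0r.
Qed.

Let contract_act mu (x : borel K n) F : beyond F ->
  an (j, xk) (fock_act mu x F) = fock_act (muj mu) x (an (j, xk) F).
Proof.
move=> bF; rewrite /fock_act linearD linearZ /= an_glmx beyond_sum // eqxx -addrA.
congr (_ + _); rewrite -scalerDl; congr (_ *: _); rewrite /wtr addrC.
have -> : bmx x j j = \sum_p (p == j)%:R * bmx x p p.
  by rewrite (bigD1 j) //= eqxx mul1r big1 ?addr0 // => p /negPf->; rewrite mul0r.
by rewrite -big_split; apply: eq_bigr => p _ /=; rewrite mulrDl.
Qed.

Let beyond_fvec : beyond (fvec w wi).
Proof.
move=> q jq; rewrite an_delta (mem_invset _ ww (r := k)) // /inversion.
have := w_tail (r := q) jq; have := w_neq (p := q) (r := k).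
by case: ifP => // H; have : (q : nat) <> k; lia.
Qed.

Lemma contract_fvec mu f :
  an (j, xk) (fact mu f (fvec w wi)) = sg K (j, xk) (invset w wi) *:
    fact (muj mu) f (fvec (parent_fun w j k) (parent_inv w wi j k)).
Proof.
have beyond_lin a F G : beyond F -> beyond G -> beyond (a *: F + G).
  by move=> bF bG q jq; rewrite linearP /= bF // bG // scaler0 addr0.
rewrite (uact_equiv (rho := fock_rep B mu) (rho' := fock_rep B (muj mu)) (Phi := an (j, xk))
  beyond_lin (@beyond_act mu) (@contract_act mu) f beyond_fvec).
by rewrite /= an_delta mem_jk invset_parent linearZ.
Qed.

(** Read off from the action of [h] on both sides of [contract_fvec], without counting rows. *)
Lemma weight_parent mu h : is_diag_mx (bmx h) ->
  weight (muj mu) (invset (parent_fun w j k) (parent_inv w wi j k)) h =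
  weight mu (invset w wi) h.
Proof.
move=> dh; have := contract_fvec mu (Uin h).
rewrite !fact_diag // linearZ /= an_delta mem_jk invset_parent !scalerA.
move=> /ffunP/(_ (invset w wi :\ (j, xk))); rewrite !ffunE eqxx /GRing.scale /= !mulr1 mulrC.
by move=> /mulfI ->//; rewrite signr_eq0.
Qed.

Section StepChild.
Variable i : 'I_n.
Hypothesis tr : transition w j k i.
Let ij : (i < j)%N. Proof. exact: transition_lt tr. Qed.
Let xi : 'I_B := Ordinal (wperm_lt ww (ltn_trans ij (ltn_trans jk kB))).
Let y := E i j ^+ bstat B w i j.

Let colz (p : 'I_n) : 'I_n * 'I_B := (p, xk).
Let colz' (p : 'I_n) : 'I_n * 'I_B := (p, xi).

Let rowmoved (a : 'I_n) := moved (pair j) (pair a) (invset w wi).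

Let mem_rowmoved (a p : 'I_n) (c : 'I_B) r : c = w r :> nat ->
  ((p, c) \in rowmoved a) =
  (p == a) && (inversion w j r && ~~ inversion w a r) ||
   inversion w p r && ~~ ((p == j) && (inversion w j r && ~~ inversion w a r)).
Proof.
move=> cr; rewrite /rowmoved /moved in_setU in_setD !mem_imset_row.
by rewrite in_set !(mem_invset _ ww cr) andbC [X in _ || X]andbC.
Qed.

(** [colmove xi xk] takes a vector from the factor [w k] to the factor [w i]; the exponent is the
    largest for which the power does not kill [y u_w]. *)
Definition shift (F : fock) : fock := iter #|movable colz colz' (rowmoved i)| (colmove xi xk) F.

Let shift_linear : linear shift.
Proof.
rewrite /shift; elim: #|_| => // m IHm a F G; rewrite !iterS IHm; exact: linearP.
Qed.
HB.instance Definition _ := GRing.isLinear.Build K fock fock _ shift shift_linear.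

Let colzz' t u : colz t != colz' u.
Proof.
apply/eqP => -[_] /w_inj e; have := jk; have := ij; lia.
Qed.

Lemma shift_act mu f F : shift (fact mu f F) = fact mu f (shift F).
Proof.
apply: (@uact_equiv _ _ _ _ (fock_rep B mu) (fock_rep B mu) (fun=> True)) => // x G _ /=.
rewrite /shift; elim: #|_| => // m IHm; rewrite !iterS IHm /fock_act linearD linearZ /=.
congr (_ + _); rewrite /glmx linear_sum; apply: eq_bigr => p _; rewrite linear_sum.
by apply: eq_bigr => q _; rewrite linearZ /= gl_colmove.
Qed.

Let movableE (a p : 'I_n) :
  (p \in movable colz colz' (rowmoved a)) = ((p, xk) \in rowmoved a) && ((p, xi) \notin rowmoved a).
Proof. by rewrite in_set. Qed.

Let mem_rowmovedk a p := mem_rowmoved a p (erefl (w k) : xk = w k :> nat).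
Let mem_rowmovedi a p := mem_rowmoved a p (erefl (w i) : xi = w i :> nat).

Lemma moved_child :
  moved colz colz' (rowmoved i) = invset (child_fun w j k i) (child_inv w wi j k i).
Proof.
apply/setP => -[p c]; rewrite /moved in_setU in_setD !mem_imset_col !movableE.
rewrite -!val_eqE /= -(wiK c); move: (wi c) (esym (wiK c)) => r cr.
rewrite !(inj_eq w_inj) (mem_rowmoved _ _ cr) !mem_rowmovedk !mem_rowmovedi.
have -> : ((p, c) \in invset (child_fun w j k i) (child_inv w wi j k i)) =
    (p < if r == k then i : nat else if r == i then j : nat else if r == j then k else r)%N &&
    (w r < child_fun w j k i p)%N.
  rewrite in_set /= /inversion; have [_ -> _] := child_perm pv tr.
  by rewrite cr /child_inv !(inj_eq w_inj) wK.
rewrite (inversion_child pv tr p r) [_ && ~~ ((r == k) && _)]andbC.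
by rewrite -!val_eqE.
Qed.

Lemma shift_fvec mu : exists2 e : K, e != 0 &
  shift (fact mu y (fvec w wi)) = e *: fvec (child_fun w j k i) (child_inv w wi j k i).
Proof.
rewrite fact_EX //; have [e e0 ->] := iter_gl ww ij.
have [||d d0 Ed] := @iter_hop K n B _ charK0 colz colz' _ _ colzz' (rowmoved i).
- by move=> p q [].
- by move=> p q [].
exists (e * d); first by rewrite mulf_neq0.
by rewrite linearZ /= -scalerA -moved_child -Ed.
Qed.

(** After [y_a], fewer rows can be moved between the two factors than after [y_i], so the exponent
    in [shift] is too large. *)
Lemma shift_fvec0 mu (a : 'I_n) : transition w j k a -> (a < i)%N ->
  shift (fact mu (E a j ^+ bstat B w a j) (fvec w wi)) = 0.
Proof.
move=> tra ai; have aj : (a < j)%N by lia.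
rewrite fact_EX //; have [e e0 ->] := iter_gl ww aj.
rewrite linearZ /= [shift _](_ : _ = 0) ?scaler0 //.
apply: (@iter_hop0 K n B _ colz colz' colzz').
apply: proper_card; apply/properP; split.
  apply/subsetP => p; rewrite !movableE.
  rewrite !mem_rowmovedk !mem_rowmovedi.
  by move=> /(inversion_child_lt pv tr tra ai) /and3P[_ -> ->].
(* The row [i] itself can be moved after [y_i] but not after [y_a]. *)
exists i.
  rewrite movableE !mem_rowmovedk !mem_rowmovedi.
  by rewrite /inversion -!val_eqE /=; have := transition_val tr; lia.
rewrite movableE.
  rewrite !mem_rowmovedk !mem_rowmovedi.
by apply/negP => /(inversion_child_lt pv tr tra ai); rewrite eqxx.
Qed.

Lemma weight_child mu h : is_diag_mx (bmx h) ->
  weight mu (invset (child_fun w j k i) (child_inv w wi j k i)) h =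
  weight mu (invset w wi) h + (bmx h i i - bmx h j j) *+ bstat B w i j.
Proof.
move=> dh; have [e e0 Ee] := shift_fvec mu.
have : shift (fact mu (Uin h * y) (fvec w wi)) =
    (weight mu (invset w wi) h + (bmx h i i - bmx h j j) *+ bstat B w i j) *:
    shift (fact mu y (fvec w wi)).
  rewrite Uin_UeltX // uactD uactM uactZ fact_diag // linearD !linearZ /= scalerDl.
  by [].
rewrite uactM shift_act Ee linearZ /= fact_diag // !scalerA [in LHS]mulrC.
by move=> /ffunP/(_ (invset (child_fun w j k i) (child_inv w wi j k i))); rewrite !ffunE eqxx
  /GRing.scale /= !mulr1 => /(mulIf e0).
Qed.

End StepChild.

Hypothesis presented_parent : presented (parent_fun w j k) (parent_inv w wi j k).
Hypothesis presented_child : forall i : 'I_n, transition w j k i ->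
  presented (child_fun w j k i) (child_inv w wi j k i).

Section Filtration.
Variables (mu : 'I_n -> K) (L : U -> Prop).
Hypotheses (idL : left_ideal L) (relL : relations mu w wi L).
Hypothesis annL : forall g, L g -> fact mu g (fvec w wi) = 0.

Let gen (r : 'I_n) : U := E r j ^+ bstat B w r j.
Let filt_pred t (r : 'I_n) := (r < t)%N && `[< transition w j k r >].
(** A partial sum of [L + sum_r U(b) y_r], with the coefficients kept visible because [filt_descend]
    needs the one of the last generator. *)
Definition filt t (g : U) := exists H : 'I_n -> U, L (g - \sum_(r | filt_pred t r) H r * gen r).

Lemma filt_ideal t : left_ideal (filt t).
Proof.
split.
- by exists (fun=> 0); rewrite big1 ?subr0 => [|r _]; rewrite ?mul0r //; apply: (lid0 idL).
- move=> a b [H La] [H' Lb]; exists (fun r => H r + H' r).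
  under eq_bigr do rewrite mulrDl.
  by rewrite big_split opprD addrACA; apply: lidD.
- move=> a b [H Lb]; exists (fun r => a * H r).
  under eq_bigr do rewrite -mulrA.
  by rewrite -mulr_sumr -mulrBr; apply: lidM.
Qed.

Lemma filt_sub t g : L g -> filt t g.
Proof. by exists (fun=> 0); rewrite big1 ?subr0 => [|r _]; rewrite ?mul0r. Qed.

Lemma filt_gen t (r : 'I_n) : transition w j k r -> (r < t)%N -> filt t (gen r).
Proof.
move=> tr rt; exists (fun s => (s == r)%:R).
rewrite (bigD1 r) /=; last by rewrite /filt_pred rt; apply/asboolP.
rewrite eqxx mul1r big1 => [|s /andP[_ /negPf->]]; last by rewrite mul0r.
by rewrite addr0 subrr; apply: (lid0 idL).
Qed.

Lemma filt_shift (i : 'I_n) (tr : transition w j k i) g : filt i g ->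
  shift tr (fact mu g (fvec w wi)) = 0.
Proof.
move=> [H /annL]; rewrite uactB => /eqP; rewrite subr_eq0 => /eqP ->.
have [K0 KD KM] : left_ideal (fun f => shift tr (fact mu f (fvec w wi)) = 0).
  split=> [|a b|a b]; first by rewrite uact0l linear0.
    by rewrite uactD linearD /= => -> ->; rewrite addr0.
  by move=> Hb; rewrite uactM shift_act Hb linear0.
elim/big_ind: _ => // r /andP[ri /asboolP trr]; apply: (KM) => //.
exact: shift_fvec0.
Qed.

(** Let [H] be the coefficient of [y_t] in [g]. The shift for [t] kills [g u_w] and the image of the
    smaller partial sum, hence [H] kills the vector of the child. The presentation of the child,
    applied to the colon ideal, puts [H y_t] in the smaller sum. *)
Lemma filt_descend t g : (t <= j)%N -> fact mu g (fvec w wi) = 0 -> filt t g -> L g.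
Proof.
move=> + g0; elim: t => [|t IHt] tj.
  by case=> H; rewrite big_pred0 ?subr0 // => r; rewrite /filt_pred ltn0.
case=> H LH; apply: IHt; first exact: ltnW.
have tn : (t < n)%N by apply: leq_trans tj (ltnW (ltn_ord j)).
pose i := Ordinal tn; have [tr|ntr] := asboolP (transition w j k i); last first.
  exists H; rewrite (eq_bigl (filt_pred t.+1)) // => r.
  rewrite /filt_pred ltnS [in RHS]leq_eqVlt.
  have [e|//] := eqVneq (r : nat) t; rewrite e ltnn /=.
  by apply/esym/negbTE/asboolP.
have Fi : filt i (g - H i * gen i).
  exists H; move: LH; rewrite (bigD1 i) /=; last by rewrite /filt_pred ltnSn; apply/asboolP.
  rewrite opprD addrA; congr (L (_ - _)); apply: eq_bigl => r.
  rewrite /filt_pred ltnS -val_eqE /= [in RHS]ltn_neqAle.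
  by rewrite andbAC [X in X && _ = _]andbC.
suff Fhi : filt i (H i * gen i) by rewrite -(subrK (H i * gen i) g); apply: (lidD (filt_ideal t)).
have [serL wtL] := relL.
have idC := left_ideal_colon (gen i) (filt_ideal t).
apply: (presented_child tr (mu := mu) (f := H i) _ idC).
  have [e e0 Ee] := shift_fvec tr mu.
  have := filt_shift tr Fi; rewrite uactB g0 sub0r linearN /= uactM shift_act Ee linearZ /=.
  by move=> /eqP; rewrite oppr_eq0 scaler_eq0 (negPf e0) => /eqP.
split.
  have serF : serre E (bstat B w) (filt t) by move=> p q pq; apply/filt_sub/serL.
  apply: (serre_child charK0 (@Uelt_mul K n) pv (filt_ideal t) serF tr (child_funP pv tr)).
  by move=> r trr ri; apply: filt_gen.
move=> h dh; rewrite /colon weight_child // mulrBl Uin_UeltX // scalerDl mulrDl.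
rewrite !mulr_algl opprD addrACA [X in _ + X]addrN addr0 -mulr_algr -mulrBr.
by apply: (lidM (filt_ideal t)); apply: filt_sub; apply: wtL.
Qed.

(** By contraction, [g] kills the vector of the parent with the twisted action, and the relations of
    the parent hold in the full sum by [serre_parent]. *)
Lemma filt_top g : fact mu g (fvec w wi) = 0 -> filt j g.
Proof.
move=> g0; have [serL wtL] := relL.
have idF := filt_ideal j.
apply: (presented_parent (mu := muj mu) _ idF).
  have := contract_fvec mu g; rewrite g0 linear0 => /esym/eqP.
  by rewrite scaler_eq0 signr_eq0 => /eqP.
split; last by move=> h dh; rewrite weight_parent //; apply/filt_sub/wtL.
apply: (serre_parent charK0 (@Uelt_mul K n) pv idF _ (parent_funP pv)).
  by move=> p q pq; apply/filt_sub/serL.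
by move=> r tr; apply: filt_gen => //; apply: transition_lt tr.
Qed.

End Filtration.

Lemma presented_step : presented w wi.
Proof.
apply: presentedI => // mu f f0 L idL relL annL.
exact: (filt_descend idL relL annL (leqnn _) f0 (filt_top idL relL f0)).
Qed.

End Step.

(** Every [E p q] is in [L], so [f] is a scalar modulo [L]; that scalar is the action of [f] on the
    vacuum, which is zero. *)
Lemma presented_increasing w wi : wperm B w wi ->
  (forall a b, (a < b)%N -> (w a < w b)%N) -> presented w wi.
Proof.
move=> ww w_inc; have S0 : invset w wi = set0.
  apply/setP => -[p c]; rewrite in_set in_set0 /inversion /=.
  by case: ltnP => //= /w_inc; lia.
apply: presentedI => // mu f f0 L idL [serL wtL] annL.
have E0 (p q : 'I_n) : (p < q)%N -> L (E p q).
  move=> pq; have := serL p q pq; rewrite /bstat big1 ?expr1 // => r _.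
  by rewrite /bterm; have := w_inc q r; lia.
have [s Ls] : exists s : K, L (f - s%:A).
  rewrite -[f]UreprK; elim: (repr f) => [x||| a [s Hs] b [t Ht] | a [s Hs]
      | a [s Hs] b [t Ht] | c a [s Hs]].
  - pose UL : {linear borel K n -> U} := HB.pack (@Uin K (borel K n))
      (GRing.isLinear.Build K (borel K n) U _ (@Uin K (borel K n)) (@Uin_linear K (borel K n))).
    (* The strictly upper triangular part of [x]; the rest is diagonal and is a scalar modulo
       [L]. *)
    pose y : borel K n := \sum_(p < n) \sum_(q < n | (p < q)%N) bmx x p q *: ebor K p q.
    have bmxZ c (a : borel K n) : bmx (c *: a) = c *: bmx a by [].
    have bmxB (a b : borel K n) : bmx (a - b) = bmx a - bmx b by [].
    have yE i l : bmx y i l = if (i < l)%N then bmx x i l else 0.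
      have bmx_sum I (r : seq I) (P : pred I) (G : I -> borel K n) :
          bmx (\sum_(a <- r | P a) G a) = \sum_(a <- r | P a) bmx (G a).
        by apply: (big_morph (@bmx K n)).
      rewrite /y bmx_sum summxE (bigD1 i) //= bmx_sum summxE.
      rewrite [X in _ + X]big1 ?addr0 => [|p pi]; last first.
        rewrite bmx_sum summxE big1 // => q pq.
        by rewrite ?bmxZ ebor_val ?(ltnW pq) // !mxE eq_sym (negPf pi) mulr0.
      rewrite big_mkcond (bigD1 l) //= big1 ?addr0 => [|q ql]; last first.
        case: ifP => // iq.
        by rewrite ?bmxZ ebor_val ?(ltnW iq) // !mxE eqxx eq_sym (negPf ql) mulr0.
      case: ifP => // il.
      by rewrite ?bmxZ ebor_val ?(ltnW il) // !mxE !eqxx mulr1.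
    have dd : is_diag_mx (bmx (x - y)).
      apply/is_diag_mxP => p q pq; rewrite bmxB 2!mxE yE.
      case: ltnP => [_|qp]; rewrite ?subrr // subr0.
      by rewrite (upper_trigP _ (bmxP x)) //; lia.
    exists (weight mu (invset w wi) (x - y)).
    have -> : Upi (UGen x) = Uin (x - y) + \sum_(p < n) \sum_(q < n | (p < q)%N) bmx x p q *: E p q.
      rewrite -[LHS]/(UL x) -{1}(subrK y x) linearD; congr (_ + _).
      rewrite linear_sum; apply: eq_bigr => p _; rewrite linear_sum; apply: eq_bigr => q _.
      by rewrite linearZ.
    rewrite addrAC; apply: (lidD idL); first exact: wtL.
    apply: (lid_sum idL) => p _; apply: (lid_sum idL) => q pq.
    by apply: (lidZ idL); apply: E0.
  - by exists 0; rewrite scale0r subr0; apply: (lid0 idL).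
  - by exists 1; rewrite scale1r subrr; apply: (lid0 idL).
  - exists (s + t); have -> : Upi (UAdd a b) = Upi a + Upi b :> U by rewrite /GRing.add /= UaddE.
    by rewrite scalerDl opprD addrACA; apply: (lidD idL).
  - exists (- s); have -> : Upi (UOpp a) = - Upi a :> U by rewrite /GRing.opp /= UoppE.
    by rewrite scaleNr -opprD; apply: (lidN idL).
  - exists (s * t); have -> : Upi (UMul a b) = Upi a * Upi b :> U by rewrite /GRing.mul /= UmulE.
    have -> : Upi a * Upi b - (s * t)%:A = Upi a * (Upi b - t%:A) + t *: (Upi a - s%:A) :> U.
      by rewrite mulrBr mulr_algr scalerBr scalerA addrA subrK mulrC.
    by apply: (lidD idL); [apply: (lidM idL) | apply: (lidZ idL)].
  - exists (c * s); have -> : Upi (UScale c a) = c *: Upi a :> U by rewrite /GRing.scale /= UscaleE.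
    by rewrite -scalerA -scalerBr; apply: (lidZ idL).
have /eqP := annL _ Ls; rewrite uactB f0 uactZ uact1 sub0r oppr_eq0 scaler_eq0.
rewrite (negPf (delta_neq0 _ _)) orbF => /eqP s0.
by move: Ls; rewrite s0 scale0r subr0.
Qed.

(** Induction on the bound [J], then on the value at the position just below it, which is smaller in
    the parent and in every child. If no later position has a smaller value, the bound itself can be
    lowered. *)
Lemma presented_inc J w wi : (J <= n)%N -> wperm B w wi ->
  (forall a b, (J <= a)%N -> (a < b)%N -> (w a < w b)%N) -> presented w wi.
Proof.
elim: J w wi => [|J IHJ] w wi Jn ww w_inc.
  by apply: presented_increasing => // a b; apply: w_inc.
have [c] := ubnP (w J); elim: c w wi ww w_inc => // c IHc w wi ww w_inc wJ.
have [wK wiK wB] := ww; pose j := Ordinal Jn.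
have [/existsP[r0 r0P]|/existsPn noinv] := boolP [exists r : 'I_B, (J < r)%N && (w r < w J)%N].
  have exP : exists r, (J < r)%N && (w r < w J)%N by exists r0.
  have bnd r : (J < r)%N && (w r < w J)%N -> (r <= B)%N.
    move=> /andP[Jr wr]; rewrite leqNgt; apply/negP => Br.
    have := wB r (ltnW Br) => wr'.
    have : (B <= w J)%N by lia.
    by move=> /wB /(can_inj wK); lia.
  case: (ex_maxnP exP bnd) => k /andP[Jk wkJ] kmax.
  have pv : pivot B w wi j k.
    split=> // r kr; rewrite ltnNge; apply/negP => /= wr.
    have : w r <> w J by move=> /(can_inj wK); lia.
    by move=> ne; have := kmax r; lia.
  apply: (presented_step pv) => [|i tr].
    apply: IHc; first exact: parent_perm pv.
      exact: parent_inc pv.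
    by rewrite /parent_fun /= eqxx; lia.
  apply: IHc; first exact: (child_perm pv tr).
    exact: (child_inc pv tr).
  have := transition_lt tr; have := transition_val tr; rewrite /child_fun /= eqxx.
  by case: eqP; lia.
apply: IHJ => //; first exact: ltnW.
move=> a b; rewrite leq_eqVlt => /orP[/eqP<-|Ja]; last exact: w_inc.
move=> Jb; have [bB|Bb] := ltnP b B.
  have := noinv (Ordinal bB); rewrite /= Jb /= -leqNgt leq_eqVlt => /orP[/eqP|//].
  by move=> /(can_inj wK); lia.
rewrite (wB b Bb) ltnNge; apply/negP => bw.
have : (B <= w J)%N by lia.
by move=> /wB /(can_inj wK); lia.
Qed.

End Presentation.

(** * Comparison with the tensor product of exterior powers *)

(** Strong induction: if the maps agree before [i], then [f i = g b] forces [b >= i], hence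
    [g i <= f i], and symmetrically. *)
Lemma incr_image_eq (m n : nat) (f g : 'I_m -> 'I_n) :
    {homo f : a b / (a < b)%N} -> {homo g : a b / (a < b)%N} ->
    (forall i, exists i', f i = g i') -> (forall i, exists i', g i = f i') -> f =1 g.
Proof.
move=> fm gm fg gf; have half (f1 g1 : 'I_m -> 'I_n) (i : 'I_m) : {homo f1 : a b / (a < b)%N} ->
    {homo g1 : a b / (a < b)%N} -> (forall a, exists b, f1 a = g1 b) ->
    (forall a : 'I_m, (a < i)%N -> f1 a = g1 a) -> (g1 i <= f1 i)%N.
  move=> f1m g1m f1g1 eqlt; have [b fb] := f1g1 i; rewrite fb.
  have [bi|] := ltnP b i.
    by have := f1m b i bi; rewrite eqlt // fb ltnn.
  by rewrite leq_eqVlt => /orP[/eqP/val_inj-> //|/g1m/ltnW].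
move=> i; have [d] := ubnP i; elim: d i => // d IHd i id.
have eqlt (a : 'I_m) : (a < i)%N -> f a = g a by move=> ai; apply: IHd; lia.
apply: val_inj; apply/eqP; rewrite eqn_leq (half g f) ?(half f g) // => a ai.
by rewrite eqlt.
Qed.

Section ExteriorSigns.
Variables (K : fieldType) (n l : nat).
Implicit Types (S T : lsub n l) (A : {set 'I_n}).

Lemma selt_mono S (a b : 'I_l) : (a < b)%N -> (selt S a < selt S b)%N.
Proof.
move=> ab; rewrite /selt /enum_val.
set s := enum _; have ss : sorted ltn [seq nat_of_ord t | t <- s].
  rewrite /s /enum_mem sorted_map; apply: sorted_filter.
    by move=> x y z; apply: ltn_trans.
  by rewrite -enumT -(@sorted_map _ _ (@nat_of_ord n) ltn) val_enum_ord iota_ltn_sorted.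
have sz : size s = l by rewrite -cardE (eqP (valP S)).
set x0 := enum_default _.
set x1 := enum_default _.
have aS : (a < size s)%N by rewrite sz.
have bS : (b < size s)%N by rewrite sz.
rewrite (set_nth_default x1 x0) ?aS //=.
rewrite -!(nth_map _ (x1 : nat) (@nat_of_ord n)) //.
by apply: (sorted_ltn_nth ltn_trans) => //; rewrite inE size_map.
Qed.

Definition esg (p : 'I_n) A : K := (-1) ^+ #|[set t in A | (t < p)%N]|.

Lemma esg_selt S (a : 'I_l) : esg (selt S a) (val S) = (-1) ^+ a.
Proof.
congr (_ ^+ _); have -> : [set t in val S | (t < selt S a)%N] =
    [set selt S b | b in [set b : 'I_l | (b < a)%N]].
  apply/setP => t; rewrite inE; apply/andP/imsetP => [[/seltP[b <-] ba]|[b]].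
    exists b => //; rewrite inE ltnNge leq_eqVlt; apply/negP => /orP[/eqP/val_inj e|/(selt_mono S)].
      by rewrite e ltnn in ba.
    by rewrite ltnNge (ltnW ba).
  by rewrite inE => ba ->; rewrite selt_mem selt_mono.
rewrite card_imset; last exact: selt_inj.
rewrite -sum1_card; under eq_bigl do rewrite inE.
by rewrite (big_ord_narrow (ltnW (ltn_ord a))) /= sum1_card card_ord.
Qed.

Lemma esgD1 (p : 'I_n) A : esg p (A :\ p) = esg p A.
Proof.
rewrite /esg; congr (_ ^+ _); apply: eq_card => t; rewrite !inE.
by have [->|] := eqVneq t p; rewrite ?ltnn ?andbF.
Qed.

(** Both sets are listed in increasing order, so equal sets give the identity matrix; otherwise some
    row vanishes. *)
Lemma det_selt_minor S T (k a : 'I_l) :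
  \det (\matrix_(b, d) (selt T (lift a d) == selt S (lift k b))%:R) =
  (val T :\ selt T a == val S :\ selt S k)%:R :> K.
Proof.
have liftm (S1 : lsub n l) (e : 'I_l) : {homo (fun b : 'I_l.-1 => selt S1 (lift e b)) :
    b d / (b < d)%N >-> (b < d)%N}.
  by move=> b d bd; apply: selt_mono; rewrite /= /bump; lia.
have memD (S1 : lsub n l) (e : 'I_l) t : t \in val S1 :\ selt S1 e ->
    exists b, t = selt S1 (lift e b).
  rewrite !inE => /andP[te /seltP[b tb]]; case: (unliftP e b) => [b' bE|bE].
    by exists b'; rewrite -bE tb.
  by move: te; rewrite -tb bE eqxx.
have memL (S1 : lsub n l) (e : 'I_l) b : selt S1 (lift e b) \in val S1 :\ selt S1 e.
  by rewrite !inE selt_mem (inj_eq (@selt_inj _ _ S1)) eq_sym neq_lift.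
case: eqP => [eqD|/eqP neD].
  have E : (fun b => selt S (lift k b)) =1 (fun b => selt T (lift a b)).
    by apply: incr_image_eq => [||b|b]; try exact: liftm; apply: memD;
      rewrite ?eqD // -?eqD.
  rewrite -[RHS](@det1 K l.-1); congr (\det _); apply/matrixP => b d; rewrite !mxE E.
  by rewrite (inj_eq (@selt_inj _ _ T)) (inj_eq lift_inj) eq_sym.
have /subsetPn[t tS tT] : ~~ (val S :\ selt S k \subset val T :\ selt T a).
  apply: contra neD => ST; rewrite eq_sym eqEcard ST /=.
  have cD (S1 : lsub n l) e : #|val S1 :\ selt S1 e| = l.-1.
    have := cardsD1 (selt S1 e) (val S1); rewrite selt_mem (eqP (valP S1)).
    by move/(congr1 predn) => /= ->.
  by rewrite !cD.
have [b tE] := memD _ _ _ tS; rewrite (expand_det_row _ b) big1 // => d _.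
rewrite mxE; case: eqP => [e|_]; last by rewrite mul0r.
by rewrite tE -e memL in tT.
Qed.

(** The action on an exterior power in the form of a hop: expanding each determinant along its
    changed row replaces one [u_q] by [u_p], with the signs of [q] in [S] and of [p] in [T]. *)
Lemma leibniz_uvec (X : 'M[K]_n) S T : leibniz X (fun i => uvec K (selt S i)) T =
  \sum_p \sum_q ((p \in val T) && (q \in val S) && (val T :\ p == val S :\ q))%:R *
     (X p q * (esg p (val T) * esg q (val S))).
Proof.
rewrite /leibniz ext_sumE exchange_big /=.
transitivity (\sum_(q in val S) \sum_(p in val T) (val T :\ p == val S :\ q)%:R *
    (X p q * (esg p (val T) * esg q (val S)))); last first.
  rewrite big_mkcond; apply: eq_bigr => q _; case: ifP => qS; last first.
    by rewrite big1 // => p _; rewrite andbF mul0r.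
  by rewrite big_mkcond; apply: eq_bigr => p _; case: ifP => pT; rewrite ?mul0r.
have im (S1 : lsub n l) : val S1 = [set selt S1 a | a in 'I_l].
  apply/setP => t; apply/idP/imsetP => [/seltP[a <-]|[a _ ->]]; last exact: selt_mem.
  by exists a.
rewrite [in RHS](eq_bigl (fun q => q \in [set selt S a | a in 'I_l])); last by move=> q; rewrite -im.
rewrite big_imset /=; last by move=> a b _ _ /selt_inj.
apply: eq_bigr => k _; rewrite ffunE (expand_det_row _ k).
rewrite [in RHS](eq_bigl (fun p => p \in [set selt T a | a in 'I_l])); last by move=> p; rewrite -im.
rewrite big_imset /=; last by move=> a b _ _ /selt_inj.
apply: eq_bigr => a _; rewrite mxE /= eqxx.
have -> : (X *m uvec K (selt S k)) (selt T a) 0 = X (selt T a) (selt S k).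
  rewrite mxE (bigD1 (selt S k)) //= big1 ?addr0 => [|q qk]; first by rewrite mxE !eqxx mulr1.
  by rewrite mxE (negPf qk) mulr0.
rewrite [RHS]mulrCA; congr (_ * _); rewrite /cofactor !esg_selt mulrC -det_selt_minor exprD.
congr (_ * _); last exact: mulrC.
congr (\det _); apply/matrixP => b d; rewrite !mxE eq_sym (negPf (neq_lift _ _)).
by rewrite mxE andbT.
Qed.

End ExteriorSigns.

Section TensorFock.
Variables (K : fieldType) (n N B : nat) (w wi : nat -> nat).
Hypotheses (NB : (N <= B)%N) (ww : wperm B w wi).
Local Notation l := (ldeg n w).
Local Notation tidx := (tidx n N l).
Local Notation mode := ('I_n * 'I_B)%type.
Implicit Types (c : tidx) (A : {set mode}).

(** The factor of position [k] gets the label [w k], as in [invset]. *)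
Definition tcol (k : 'I_N) : 'I_B := Ordinal (wperm_lt ww (leq_trans (ltn_ord k) NB)).

Lemma tcol_inj : injective tcol.
Proof. by move=> k m [/(can_inj (let: And3 wK _ _ := ww in wK))] /val_inj. Qed.

Definition cset c : {set mode} := [set z | [exists k, (tcol k == z.2) && (z.1 \in val (c k))]].

Lemma mem_cset c (p : 'I_n) (k : 'I_N) : ((p, tcol k) \in cset c) = (p \in val (c k)).
Proof.
rewrite inE; apply/existsP/idP => [[m /andP[/eqP/tcol_inj->]] //|pk].
by exists k; rewrite eqxx.
Qed.

Lemma cset_inj : injective cset.
Proof.
move=> c d e; apply/ffunP => k; apply: val_inj; apply/setP => p.
by rewrite -!mem_cset e.
Qed.

(** Modes are ordered factor by factor, so each Fock sign is the exterior sign inside the factor [y]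
    times the sign of the earlier factors. The latter is the same for [A] and [A'] and cancels. *)
Lemma sg_mul (A : {set mode}) (A' : {set mode}) y p q (S S' : {set 'I_n}) :
    (forall t, ((t, y) \in A) = (t \in S)) -> (forall t, ((t, y) \in A') = (t \in S')) ->
    (forall t z, z != y -> ((t, z) \in A) = ((t, z) \in A')) ->
  sg K (p, y) A * sg K (q, y) A' = esg K p S * esg K q S'.
Proof.
have E (C : {set mode}) r (D : {set 'I_n}) : (forall t, ((t, y) \in C) = (t \in D)) ->
    sg K (r, y) C = (-1) ^+ #|[set z in C | (z.2 < y)%N]| * esg K r D.
  move=> CD; rewrite -exprD; congr (_ ^+ _).
  rewrite -(cardsID [set z : mode | (z.2 < y)%N]); congr (_ + _)%N.
    apply: eq_card => -[t x]; rewrite !inE -andbA /rank /=; congr (_ && _).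
    have := ltn_ord t; have := ltn_ord r; nia.
  rewrite -(card_imset (mem [set t in D | (t < r)%N]) (f := fun t => (t, y))); last by move=> a b [].
  apply: eq_card => -[t x]; rewrite !inE /rank /=.
  apply/andP/imsetP => [[xy /andP[tC tr]]|[t' + [-> ->]]].
    have xy' : x = y.
      by apply: val_inj => /=; move: tr xy; have := ltn_ord t; have := ltn_ord r; nia.
    by exists t; rewrite ?xy' // !inE -CD -{1}xy' tC /=; move: tr; rewrite xy' ltn_add2l.
  by rewrite !inE CD ltnn ltn_add2l => ->.
move=> /E-> /(E _ q)-> AA'; rewrite mulrACA.
have -> : #|[set z in A | (z.2 < y)%N]| = #|[set z in A' | (z.2 < y)%N]|.
  apply: eq_card => -[t x]; rewrite !inE /=.
  by have [->|/(AA' t)->] := eqVneq x y; rewrite ?ltnn ?andbF.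
by rewrite -expr2 sqrr_sign mul1r.
Qed.

Lemma mem_csetP c (p : 'I_n) (x : 'I_B) : (p, x) \in cset c -> exists k, x = tcol k.
Proof. by rewrite inE => /existsP[k /andP[/eqP/= <- _]]; exists k. Qed.

Lemma cset_upd c (k : 'I_N) (p q : 'I_n) (T : lsub n (l k)) : val T = p |: (val (c k) :\ q) ->
  (p, tcol k) |: (cset c :\ (q, tcol k)) = cset (upd c T).
Proof.
move=> TE; apply/setP => -[t x]; rewrite in_setU1 in_setD1 !xpair_eqE.
have [[m ->]|nx] := pselect (exists m, x = tcol m).
  rewrite !mem_cset (inj_eq tcol_inj); have [->|mk] := eqVneq m k.
    by rewrite upd_in TE in_setU1 in_setD1 !andbT.
  by rewrite upd_out 1?eq_sym // !andbF.
have /negPf-> : (t, x) \notin cset c by apply/negP => /mem_csetP.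
have /negPf-> : (t, x) \notin cset (upd c T) by apply/negP => /mem_csetP.
rewrite andbF orbF; apply/negbTE/negP => /andP[_ /eqP xk].
by apply: nx; exists k.
Qed.

Lemma hop_cset c (k : 'I_N) (p q : 'I_n) :
  hop (p, tcol k) (q, tcol k) (delta K (cset c)) =
  \sum_(T : lsub n (l k))
     (((p \in val T) && (q \in val (c k)) && (val T :\ p == val (c k) :\ q))%:R *
     (esg K p (val T) * esg K q (val (c k)))) *: delta K (cset (upd c T)).
Proof.
rewrite /hop an_delta mem_cset; case: ifP => qS; last first.
  by rewrite linear0 big1 // => T _; rewrite andbF mul0r scale0r.
rewrite linearZ /= cr_delta.
have memD t : ((t, tcol k) \in cset c :\ (q, tcol k)) = (t \in val (c k) :\ q).
  by rewrite !in_setD1 mem_cset xpair_eqE eqxx andbT.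
rewrite memD; case: ifP => pS.
  rewrite scaler0 big1 // => T _; case: eqP => [e|_]; last by rewrite !andbF mul0r scale0r.
  by move: pS; rewrite -e !inE eqxx.
pose T0 : lsub n (l k) := insubd (c k) (p |: (val (c k) :\ q)).
have T0E : val T0 = p |: (val (c k) :\ q).
  apply: insubdK; rewrite -topredE /= cardsU1 pS.
  by have := valP (c k); rewrite /= (cardsD1 q) qS.
rewrite (bigD1 T0) //= [X in _ + X]big1 ?addr0 => [|T TT0]; last first.
  case: eqP => [e|_]; last by rewrite !andbF mul0r scale0r.
  case: (boolP (p \in val T)) => [pT|_]; last by rewrite mul0r scale0r.
  by move: TT0; rewrite -val_eqE /= T0E -e setD1K // eqxx.
rewrite T0E setU11 setU1K ?pS // eqxx mul1r scalerA (cset_upd T0E); congr (_ *: _).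
rewrite -(esgD1 K p (p |: _)) setU1K ?pS // mulrC [RHS]mulrC.
rewrite [LHS]mulrC; apply: sg_mul => //.
- by move=> t; rewrite mem_cset.
- move=> t z zk; rewrite !inE !xpair_eqE (negPf zk) andbF //.
Qed.

Lemma fock_act_cset (x : borel K n) c :
  fock_act (fun=> 0) x (delta K (cset c)) =
  \sum_(k < N) \sum_(T : lsub n (l k))
    leibniz (bmx x) (fun i => uvec K (selt (c k) i)) T *: delta K (cset (upd c T)).
Proof.
rewrite /fock_act [wtr _ _](_ : _ = 0) ?scale0r ?addr0; last first.
  by apply: big1 => p _; rewrite mul0r.
transitivity (\sum_(y : 'I_B) \sum_p \sum_q bmx x p q *: hop (p, y) (q, y) (delta K (cset c))).
  rewrite [RHS]exchange_big; apply: eq_bigr => p _ /=.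
  by rewrite [RHS]exchange_big; apply: eq_bigr => q _ /=; rewrite /gl scaler_sumr.
rewrite (bigID (mem [set tcol k | k in 'I_N])) /= [X in _ + X]big1 ?addr0; last first.
  move=> y ny; apply: big1 => p _; apply: big1 => q _.
  rewrite /hop an_delta; case: ifP => [/mem_csetP[k yk]|_]; last by rewrite linear0 scaler0.
  by case/negP: ny; rewrite yk imset_f.
rewrite big_imset /=; last by move=> k m _ _ /tcol_inj.
apply: eq_bigr => k _.
under eq_bigr do under eq_bigr do rewrite hop_cset scaler_sumr.
under eq_bigr do rewrite exchange_big.
rewrite exchange_big; apply: eq_bigr => T _ /=.
rewrite leibniz_uvec scaler_suml; apply: eq_bigr => p _.
rewrite scaler_suml; apply: eq_bigr => q _.
by rewrite scalerA mulrCA.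
Qed.

Definition tfock (f : tens K n N l) : fock K n B := \sum_c f c *: delta K (cset c).

Lemma tfock_linear : linear tfock.
Proof.
move=> a f g; rewrite /tfock scaler_sumr -big_split; apply: eq_bigr => c _ /=.
by rewrite !ffunE scalerDl scalerA.
Qed.
HB.instance Definition _ := GRing.isLinear.Build K (tens K n N l) (fock K n B) _ tfock tfock_linear.

Lemma tfock_inj : injective tfock.
Proof.
have E f c : tfock f (cset c) = f c.
  rewrite /tfock sum_ffunE (bigD1 c) //= big1 ?addr0 => [|d dc].
    by rewrite !ffunE eqxx [_ *: _]mulr1.
  by rewrite !ffunE (inj_eq cset_inj) eq_sym (negPf dc) scaler0.
by move=> f g e; apply/ffunP => c; rewrite -!E e.
Qed.

Lemma tfock_act (x : borel K n) f :
  tfock (tens_act (bmx x) f) = fock_act (fun=> 0) x (tfock f).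
Proof.
rewrite {2}/tfock linear_sum /=.
under [RHS]eq_bigr do rewrite linearZ /= fock_act_cset scaler_sumr.
rewrite [RHS]exchange_big /tfock /=.
under eq_bigr do rewrite ffunE scaler_suml.
rewrite exchange_big; apply: eq_bigr => k _ /=.
under [RHS]eq_bigr do rewrite scaler_sumr.
under eq_bigr => c _.
  rewrite /ext_act ext_sumE scaler_suml.
  under eq_bigr do rewrite !ffunE.
  over.
rewrite !pair_bigA /=.
(* The tensor side sums over inputs for a given output index, the Fock side over outputs for a given
   input; [sw] exchanges the two. *)
pose sw (u : tidx * lsub n (l k)) := (upd u.1 u.2, u.1 k).
have swK : involutive sw.
  move=> [c T]; rewrite /sw /= upd_upd upd_in; congr (_, _).
  apply/ffunP => m; have [<-|km] := eqVneq k m; first by rewrite upd_in.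
  by rewrite upd_out.
rewrite [RHS](reindex_inj (inv_inj swK)); apply: eq_bigr => -[c T] _ /=.
rewrite scalerA upd_in upd_upd; congr (_ *: delta K (cset _)).
apply/ffunP => m; have [<-|km] := eqVneq k m; first by rewrite upd_in.
by rewrite upd_out.
Qed.

(** The vector [u_w] is a basis tensor, and by hypothesis [invset] has nothing in the factors of the
    positions from [N] on. *)
Lemma tfock_uw : (forall r, (N <= r)%N -> ldeg n w r = 0%N) ->
  tfock (uw K n w N) = delta K (invset n B w wi).
Proof.
move=> hN; pose c0 : tidx := [ffun k : 'I_N =>
  exist (fun S : {set 'I_n} => #|S| == l k) (Dset n w k) (eqxx _)].
have uwjE (k : 'I_N) : uwj K n w k = [ffun T => (T == c0 k)%:R].
  rewrite -wedge_basis; apply: eq_wedge => a; congr (uvec K _).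
  by rewrite ffunE /selt /=; congr enum_val; apply: val_inj.
have -> : uw K n w N = [ffun c => (c == c0)%:R].
  apply/ffunP => c; rewrite !ffunE; have [->|ne] := eqVneq c c0.
    by apply: big1 => k _; rewrite uwjE ffunE eqxx.
  have [k ck] : exists k, c k != c0 k.
    apply/existsP; apply: contraR ne => /existsPn H; apply/eqP/ffunP => k.
    by apply/eqP; have := H k; rewrite negbK.
  by rewrite (bigD1 k) //= uwjE ffunE (negPf ck) mul0r.
rewrite /tfock (bigD1 c0) //= big1 ?addr0 => [|c /negPf cc0]; last first.
  by rewrite ffunE cc0 scale0r.
rewrite ffunE eqxx scale1r; congr (delta K _); apply/setP => -[p x].
have [wK wiK _] := ww.
rewrite (mem_invset p ww (esym (wiK x))); have [rN|Nr] := ltnP (wi x) N.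
  have -> : x = tcol (Ordinal rN) by apply: val_inj; rewrite /= wiK.
  by rewrite mem_cset ffunE /= inE wK.
have /eqP := hN _ Nr; rewrite cards_eq0 => /eqP/setP/(_ p); rewrite !inE => ->.
apply/negbTE/negP => /existsP[k /andP[/eqP /= xk _]].
by move: Nr; rewrite -xk /= wK leqNgt ltn_ord.
Qed.

End TensorFock.

Lemma ncard_sum B (P : pred nat) : (forall r, P r -> (r < B)%N) ->
  ncard [set r | P r]%classic = (\sum_(r < B) P r)%N.
Proof.
move=> PB; pose F := seq_fset tt [seq r <- iota 0 B | P r].
have -> : [set r | P r]%classic = [set` F]%classic.
  apply/seteqP; split=> r /=; rewrite seq_fsetE mem_filter mem_iota add0n.
    by move=> Pr; rewrite Pr PB.
  by case/andP.
rewrite /ncard set_fsetK size_seq_fset undup_id ?filter_uniq ?iota_uniq //.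
by rewrite size_filter -sum1_count big_mkcond /= -{1}(subn0 B) -/(index_iota 0 B) big_mkord.
Qed.

(** * The ideal [I_w] as the annihilator of [u_w] *)

Section Annihilator.
Variables (n : nat) (K : fieldType) (charK0 : [pchar K] =i pred0).
Variables (w wi : nat -> nat) (N B : nat).
Hypotheses (nB : (n <= B)%N) (NB : (N <= B)%N) (ww : wperm B w wi).
Hypothesis w_inc : forall a b, (n <= a)%N -> (a < b)%N -> (w a < w b)%N.
Hypothesis hN : forall r, (N <= r)%N -> ldeg n w r = 0%N.
Local Notation U := (Uenv (borel K n)).
Local Notation S := (invset n B w wi).

Let lt_bound p r : (p < r)%N -> (w r < w p)%N -> (r < B)%N.
Proof.
have [wK wiK wB] := ww; move=> pr wrp; rewrite ltnNge; apply/negP => Br.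
move: wrp; rewrite (wB _ Br) => rwp.
have /wB /(can_inj wK) : (B <= w p)%N by lia.
by lia.
Qed.

Lemma mstat_bstat p q : mstat w p q = bstat B w p q.
Proof.
rewrite /mstat.
have -> : [set k | (q < k)%N /\ (w p < w k < w q)%N]%classic =
    [set k | (q < k)%N && (w p < w k < w q)%N]%classic.
  by apply/seteqP; split=> k /= /andP.
by rewrite (@ncard_sum B) // => r /andP[qr /andP[_ wr]]; apply: lt_bound wr.
Qed.

Lemma code_rowcard (p : 'I_n) : code w p = rowcard S p.
Proof.
rewrite /code (@ncard_sum B) => [|r /andP[pr wr]]; last exact: lt_bound wr.
pose f (r : 'I_B) := Ordinal (wperm_lt ww (ltn_ord r)).
have f_inj : injective f.
  by have [wK _ _] := ww; move=> r s [/(can_inj wK)] e; apply: val_inj.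
rewrite /rowcard [RHS](reindex_inj f_inj); apply: eq_bigr => r _.
by rewrite (mem_invset p ww (r := r)).
Qed.

Lemma pairing_weight h : pairing (fun i => (code w i)%:Z) h = weight (fun=> 0 : K) S h.
Proof. by apply: eq_bigr => p _; rewrite code_rowcard add0r. Qed.

Lemma tens_fock f (v : tens K n N (ldeg n w)) : tfock NB ww (uact (tens_rep K n N (ldeg n w)) f v) =
  uact (fock_rep B (fun=> 0)) f (tfock NB ww v).
Proof.
apply: (@uact_equiv _ _ _ _ (tens_rep K n N (ldeg n w)) (fock_rep B (fun=> 0))
  (fun=> True) (tfock NB ww)) => // x g _.
exact: tfock_act.
Qed.

(** The embedding [tfock] moves the question to the Fock space, with zero twist. There the
    generators kill the vector, and conversely [presented_inc] with [J = n] applies to [I_w]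
    itself. *)
Lemma Iw_annihilator f : (f \in Iw K n w) <-> f *: (uw K n w N) = 0.
Proof.
have actE : f *: (uw K n w N) = 0 <-> uact (fock_rep B (fun=> 0)) f (delta K S) = 0.
  rewrite -(tfock_uw K NB ww hN) -tens_fock -[uact _ f _]/(f *: uw K n w N).
  split=> [->|]; first exact: linear0.
  by rewrite -[RHS](linear0 (tfock NB ww)) => /tfock_inj.
rewrite actE; split.
  move=> /asboolP; elim=> [|a g x Gg _ x0]; first exact: uact0l.
  have [serA wtA] := relations_ann (n := n) (fun=> 0 : K) ww.
  rewrite uactD uactM x0 addr0; case: Gg => [h dh|i j ij].
    by rewrite pairing_weight wtA // linear0.
  by rewrite emx_ebor mstat_bstat serA // linear0.
move=> f0; apply/asboolP.
apply: (presented_inc charK0 (leqnn n) ww w_inc f0).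
  split=> [|a b La Lb|a b Lb]; first exact: lideal0.
  - by elim: La => [|c g x Gg _ IH]; rewrite ?add0r // -addrA; apply: lideal_step.
  - elim: Lb => [|c g x Gg _ IH]; rewrite ?mulr0; first exact: lideal0.
    by rewrite mulrDr mulrA; apply: lideal_step.
split=> [p q pq|h dh].
  rewrite -mstat_bstat /Uelt -(emx_ebor K pq) -[X in in_lideal _ X]addr0 -[X in X + 0]mul1r.
  by apply: lideal_step; [constructor | exact: lideal0].
rewrite -pairing_weight -[X in in_lideal _ X]addr0 -[X in X + 0]mul1r.
by apply: lideal_step; [constructor | exact: lideal0].
Qed.

End Annihilator.

Theorem theorem4p1 (n : nat) (K : fieldType)
    (n_gt0 : (0 < n)%N) (charK0 : [pchar K] =i pred0)
    (w : nat -> nat) (w_Sn : Sinf_n n w)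
    (N : nat) (hN : forall j, (N <= j)%N -> ldeg n w j = 0%N) :
  exists phi : {linear U_mod_Iw K n w -> KP K n w N},
    [/\ phi (one_mod_Iw K n w) = KPgen K n w N,
        (forall psi : {linear U_mod_Iw K n w -> KP K n w N},
           psi (one_mod_Iw K n w) = KPgen K n w N -> psi =1 phi)
      & bijective phi].
Proof.
have [[[wi wK wiK] [N0 wN0]] w_inc] := w_Sn.
pose B := maxn n (maxn N N0).
have ww : wperm B w wi by split=> // r; rewrite !geq_max => /and3P[_ _ /wN0].
have nB : (n <= B)%N by rewrite leq_maxl.
have NB : (N <= B)%N by rewrite /B maxnCA leq_maxl.
have annP f := Iw_annihilator charK0 nB NB ww w_inc hN f.
pose pi := mod_pi (Iw K n w).
pose act (f : Uenv (borel K n)) : KP K n w N := f *: KPgen K n w N.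
have val_act f : cyc_val (act f) = f *: uw K n w N by [].
have actP f g : pi f = pi g <-> act f = act g.
  split=> [/mod_piP/annP fg|fg].
    apply: val_inj; rewrite [LHS]val_act [RHS]val_act; apply/eqP.
    by rewrite -subr_eq0 -scalerBl; apply/eqP.
  apply: (proj2 (mod_piP (Iw K n w) f g)); apply/annP; rewrite scalerBl; apply/eqP.
  by rewrite subr_eq0 -!val_act fg.
(* Defined through a chosen representative; [actP], which is [Iw_annihilator] for a difference,
   makes it well defined and injective. *)
pose phi0 (v : U_mod_Iw K n w) := act (projT1 (cid (mod_pi_surj v))).
have phi0E f : phi0 (pi f) = act f.
  by rewrite /phi0; case: cid => g /= /actP.
have phi0_lin : linear phi0.
  move=> a u v; have [f ->] := mod_pi_surj u; have [g ->] := mod_pi_surj v.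
  rewrite -[a *: mod_pi _ f]linearZ -linearD !phi0E /act scalerDl.
  by congr (_ + _); rewrite -scalerA.
pose phi : {linear U_mod_Iw K n w -> KP K n w N} := HB.pack phi0
  (GRing.isLinear.Build _ _ _ _ phi0 phi0_lin).
exists phi; split.
- by rewrite [LHS]phi0E /act scale1r.
- move=> psi psi1 v; have [f ->] := mod_pi_surj v.
  have fE : mod_pi (Iw K n w) f = f *: one_mod_Iw K n w.
    transitivity (mod_pi (Iw K n w) (f *: (1 : (Uenv (borel K n))^o))); last exact: linearZ.
    by congr (mod_pi _ _); rewrite -[LHS]mulr1.
  by rewrite [RHS]phi0E {1}fE linearZ psi1.
have surj (v : KP K n w N) : exists f, v = act f.
  have /asboolP[f vf] := cyc_valP v; exists f; exact: val_inj.
exists (fun v => pi (projT1 (cid (surj v)))).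
  move=> u; have [f ->] := mod_pi_surj u; case: cid => g /= e.
  by apply/actP; rewrite -e; apply: phi0E.
by move=> v; case: cid => f /= ->; apply: phi0E.
Qed.
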